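(* Let $(W,S)$ be a Coxeter system, let $k\ge 1$, and let $\mathbf{q}$ be a multiparameter of positive reals such that $\mathbf{q}\in\mathcal{R}_{\mathrm{St}(T)}$ for every spherical subset $T\subseteq S$ with $|T|=k$. Let $\Sigma$ denote the Davis complex with its Coxeter cellulation and $\Sigma^{(k-1)}$ its $(k-1)$-skeleton. Then $L^2_\mathbf{q}H_i(\Sigma,\Sigma^{(k-1)})=0$ for all $i\neq k$.
   Context: A Coxeter system $(W,S)$: $W$ is generated by $S$ with relations $(st)^{m_{st}}=1$ for $m_{st}<\infty$. For $U\subseteq S$, $W_U=\langle U\rangle$; $U$ is spherical if $W_U$ is finite. A multiparameter is $\mathbf{q}=(q_s)_{s\in S}$, $q_s>0$, $q_s=q_{s'}$ when $s,s'$ are conjugate; $q_w=q_{s_1}\cdots q_{s_n}$ for a reduced expression $w=s_1\cdots s_n$. $\mathcal{R}_U$ is the set of $\mathbf{t}\in(0,\infty)^S$ where the growth series $\sum_{w\in W_U}t_w$ converges. $\mathrm{St}(T)=\bigcup\{U\subseteq S: U\cup T \text{ spherical}\}$. The Coxeter cellulation of the Davis complex has cells $wc_U$ ($w\in W$, $U$ spherical), $c_U$ of dimension $|U|$ with boundary the Coxeter complex of $W_U$. Weighted $L^2$-homology: cell $w\sigma$ gets measure $q_u$, $u$ the shortest element of $wW_{S(\sigma)}$ ($S(\sigma)$ the type of $\sigma$); $L^2_\mathbf{q}C_i$ are the square-summable chains for the weighted inner product $\sum f(\sigma)g(\sigma)\mu_\mathbf{q}(\sigma)$; the boundary $\partial^\mathbf{q}$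 is the adjoint of the coboundary for this inner product; reduced homology is $\ker\partial^\mathbf{q}/\overline{\operatorname{im}\partial^\mathbf{q}}$, with relative version for pairs. *)

(* Defs.v *)
From HB Require Import structures.
From Stdlib Require Import Relations.Relation_Operators.
From mathcomp Require Import all_boot all_order all_algebra.
From mathcomp Require Import all_classical all_reals all_analysis.
Set Implicit Arguments. Unset Strict Implicit. Unset Printing Implicit Defensive.
Import Order.TTheory GRing.Theory Num.Theory.
Local Open Scope classical_set_scope.
Local Open Scope ring_scope.

(* Coxeter systems of finite rank n: S = 'I_n, Coxeter matrix m with the    *)
(* convention  m i j = 0  <->  m_{ij} = infinity.                           *)

Definition coxeter_matrix (n : nat) (m : 'I_n -> 'I_n -> nat) : Prop :=
  (forall i, m i i = 1%N) /\ (forall i j, m i j = m j i) /\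
  (forall i j, i != j -> m i j != 1%N).

(* Elements of W are represented by words in the generators. *)
Definition word (n : nat) := seq 'I_n.

Definition relator (n : nat) (m : 'I_n -> 'I_n -> nat) (i j : 'I_n) : word n :=
  flatten (nseq (m i j) [:: i; j]).

Definition cox_step (n : nat) (m : 'I_n -> 'I_n -> nat) (u v : word n) : Prop :=
  exists (a b : word n) (i j : 'I_n),
    m i j != 0%N /\ u = a ++ b /\ v = a ++ relator m i j ++ b.

(* equality in W = < S | (s_i s_j)^{m_ij} = 1 > (m_ii = 1 gives s_i^2 = 1) *)
Definition cox_eq (n : nat) (m : 'I_n -> 'I_n -> nat) : word n -> word n -> Prop :=
  Relation_Operators.clos_refl_sym_trans (word n) (@cox_step n m).

(* the element of W represented by a word, as its class of words *)
Definition cls (n : nat) (m : 'I_n -> 'I_n -> nat) (w : word n) : set (word n) :=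
  [set v | cox_eq m w v].

Definition over (n : nat) (U : {set 'I_n}) (u : word n) : bool := all (mem U) u.

Definition WU (n : nat) (m : 'I_n -> 'I_n -> nat) (U : {set 'I_n}) : set (set (word n)) :=
  cls m @` [set u | over U u].

Definition spherical (n : nat) (m : 'I_n -> 'I_n -> nat) (U : {set 'I_n}) : Prop :=
  finite_set (WU m U).

Definition coset (n : nat) (m : 'I_n -> 'I_n -> nat) (w : word n) (U : {set 'I_n})
  : set (word n) :=
  [set v | exists u, over U u /\ cox_eq m (w ++ u) v].

Definition minlen (n : nat) (C : set (word n)) : nat :=
  xget 0%N [set l | (exists w, C w /\ size w = l) /\ (forall v, C v -> (l <= size v)%N)].

(* t_w for the shortest element w of C, computed along a reduced expression
   (a word of minimal length in C) *)
Definition qword (R : realType) (n : nat) (t : 'I_n -> R) (w : word n) : R :=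
  \prod_(i <- w) t i.

Definition wt (R : realType) (n : nat) (t : 'I_n -> R) (C : set (word n)) : R :=
  xget 0 [set x | exists w, C w /\ size w = minlen C /\ x = qword t w].

Definition conjugate (n : nat) (m : 'I_n -> 'I_n -> nat) (s s' : 'I_n) : Prop :=
  exists w : word n, cox_eq m (w ++ [:: s] ++ rev w) [:: s'].

Definition multiparameter (R : realType) (n : nat) (m : 'I_n -> 'I_n -> nat)
  (q : 'I_n -> R) : Prop :=
  (forall s, 0 < q s) /\ (forall s s', conjugate m s s' -> q s = q s').

Definition in_R (R : realType) (n : nat) (m : 'I_n -> 'I_n -> nat)
  (U : {set 'I_n}) (t : 'I_n -> R) : Prop :=
  (forall s, 0 < t s) /\ (\esum_(C in WU m U) (wt t C)%:E < +oo)%E.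

Definition St (n : nat) (m : 'I_n -> 'I_n -> nat) (T : {set 'I_n}) : {set 'I_n} :=
  [set s | `[< exists U : {set 'I_n}, s \in U /\ spherical m (U :|: T) >]].

(* The Davis complex with its Coxeter cellulation.                          *)
(* A cell w c_U is represented by the pair (w W_U, U).                      *)

Definition cell (n : nat) := (set (word n) * {set 'I_n})%type.

Definition is_cell (n : nat) (m : 'I_n -> 'I_n -> nat) (c : cell n) : Prop :=
  spherical m c.2 /\ exists w, c.1 = coset m w c.2.

Definition icell (n : nat) (m : 'I_n -> 'I_n -> nat) (i : nat) (c : cell n) : Prop :=
  is_cell m c /\ #|c.2| = i.

Definition mu (R : realType) (n : nat) (q : 'I_n -> R) (c : cell n) : R := wt q c.1.

(* Incidence number [tau : sigma], each cell C being oriented as u c_U with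
   u the shortest element of C.  With this orientation,
   d(w c_U) = sum_{s in U} (-1)^{pos(s,U)} sum_{u in W_U^{U-s}} (-1)^{l(u)} w u c_{U-s}. *)
Definition pos (n : nat) (s : 'I_n) (U : {set 'I_n}) : nat :=
  #|[set t in U | (t < s)%N]|.

Definition inc (R : realType) (n : nat) (tau sigma : cell n) : R :=
  \sum_(s in tau.2)
    if (sigma.2 == tau.2 :\ s) && `[< sigma.1 `<=` tau.1 >]
    then (-1) ^+ (pos s tau.2 + minlen sigma.1 + minlen tau.1)
    else 0.

Definition chain (n : nat) (R : realType) := cell n -> R.

Definition sqnorm (R : realType) (n : nat) (m : 'I_n -> 'I_n -> nat) (q : 'I_n -> R)
  (i : nat) (f : chain n R) : \bar R :=
  (\esum_(c in icell m i) ((f c) ^+ 2 * mu q c)%:E)%E.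

Definition L2chain (R : realType) (n : nat) (m : 'I_n -> 'I_n -> nat) (q : 'I_n -> R)
  (i : nat) (f : chain n R) : Prop :=
  (forall c, ~ icell m i c -> f c = 0) /\ (sqnorm m q i f < +oo)%E.

(* the boundary  d^q : L^2_q C_{i+1} -> L^2_q C_i, the adjoint of the
   coboundary (delta f)(tau) = sum_sigma [tau:sigma] f(sigma) for the weighted
   inner products, written out explicitly:
   (d^q g)(sigma) = mu(sigma)^{-1} sum_tau [tau:sigma] mu(tau) g(tau). *)
Definition bdry (R : realType) (n : nat) (m : 'I_n -> 'I_n -> nat) (q : 'I_n -> R)
  (i : nat) (g : chain n R) : chain n R :=
  fun sigma =>
    if `[< icell m i sigma >] then
      (mu q sigma)^-1 *
      \sum_(tau \in [set tau | icell m i.+1 tau /\ sigma.1 `<=` tau.1])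
         (@inc R _ tau sigma * mu q tau * g tau)
    else 0.

(* The pair (Sigma, Sigma^(k-1)): relative i-chains are i-chains for i >= k
   and 0 for i < k; the relative boundary C_{i+1} -> C_i is d^q for i >= k
   and 0 otherwise. *)
Definition relL2chain (R : realType) (n : nat) (m : 'I_n -> 'I_n -> nat) (q : 'I_n -> R)
  (k i : nat) (f : chain n R) : Prop :=
  if (k <= i)%N then L2chain m q i f else f = (fun _ => 0).

Definition relbdry (R : realType) (n : nat) (m : 'I_n -> 'I_n -> nat) (q : 'I_n -> R)
  (k i : nat) (g : chain n R) : chain n R :=
  if (k <= i)%N then bdry m q i g else (fun _ => 0).

Definition relcycle (R : realType) (n : nat) (m : 'I_n -> 'I_n -> nat) (q : 'I_n -> R)
  (k i : nat) (z : chain n R) : Prop :=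
  relL2chain m q k i z /\
  (match i with 0 => True | i'.+1 => relbdry m q k i' z = (fun _ => 0) end).

(* reduced L^2_q H_i(Sigma, Sigma^(k-1)) = ker / closure(im) vanishes:
   every relative i-cycle lies in the closure of the image of the relative
   boundary of L^2 relative (i+1)-chains *)
Definition relL2H_vanishes (R : realType) (n : nat) (m : 'I_n -> 'I_n -> nat)
  (q : 'I_n -> R) (k i : nat) : Prop :=
  forall z, relcycle m q k i z ->
    forall eps : R, 0 < eps ->
      exists c, relL2chain m q k i.+1 c /\
        (sqnorm m q i (fun sigma => (z sigma - relbdry m q k i c sigma)%R) < eps%:E)%E.

(* Main.v *)
(* For [i < k] there are no relative chains.  For [i > k] even the unreduced homology vanishes.
   Multiplying chains by the measure turns them into families [b_V] ([V] spherical) of right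
   [W_V]-invariant functions on [W] with [sum_x b_V(x)^2 / q_x] finite, and the boundary into
   [(dd b)_U = sum_s (+-) b_(U+s)].

   If [q] lies in the convergence region of [W_J], the complex of types inside [J] is exact in
   positive degrees: realise the flags of cells by simplices on generic points of the Tits cone,
   cone them off from the minimal chamber of their [W_J]-coset, and intersect the result with the
   dual cones of all chambers.  A simplex on cells near [x] only meets the dual cone of [w] when
   [w] is, up to bounded error, a prefix of [x].  Boundedness of this kernel follows from Schur's
   test: rows are controlled by the growth series (which still converges after a small dilation),
   columns by a bound on the sums [sum_(w <= x) r^(l(x) - l(w))].  The latter holds because the
   inversions of [x] fall into finitely many colours, inherited from a reflection representation
   over a finite field, such that walls of one colour never cross; a prefix of [x] is therefore
   determined by one number per colour.

   Long exact sequences transport exactness from [J] to the types [V] with [U <= V <= U + J]; for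
   [|U| = k] only [J] inside [St(U)] matters, and a downward induction on [|U|] ends at all types. *)

(* Two facts fix the degree range. Convergence on [W_J] gives no exactness in degree 0, where
   constants are harmonic; and each element moved from [J] into the lower bound [U] of the types
   costs one degree ([Ex_link]), so |U| = k leaves the degrees above k. Enlarging [J] costs none
   ([Ex_join]). General position makes the kernel combinatorial: every determinant is nonzero, an
   intersection number is the common sign of a family of determinants, and the homotopy identity
   becomes a statement on signs of vectors in a plane. No topology of the Tits cone is used. The
   apex sits in the minimal chamber because its inversions are shared by every chamber of the coset;
   it therefore never obstructs the prefix relation. The cone formula yields the unconed transform
   of b, which is not visibly b. A locality argument shows that it is a multiple of b, and
   boundaries of indicators fix the factor as a sign. Schur's test is run with weights r^len for
   some r > 1: the slack r is what the dilation provides, and 1 / r < 1 is what makes the sums over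
   intervals bounded. *)
From Stdlib Require Import Relations.Relation_Operators.
From mathcomp Require Import all_boot all_order all_algebra.
From mathcomp Require Import all_classical all_reals all_analysis.
From mathcomp Require Import fingroup perm cyclic finfield finmap.
From mathcomp Require Import ring lra zify.
Require Import Defs.
Set Implicit Arguments. Unset Strict Implicit. Unset Printing Implicit Defensive.
Import Order.TTheory GRing.Theory Num.Theory.
Local Open Scope classical_set_scope.
Local Open Scope ring_scope.


(** * Words and length *)

Section Words.
Variables (n : nat) (m : 'I_n -> 'I_n -> nat).
Hypothesis hm : coxeter_matrix m.
Implicit Types (u v w : word n) (s t a b : 'I_n).
Notation "u ~ v" := (cox_eq m u v) (at level 70).

Lemma cox_refl u : u ~ u. Proof. exact: rst_refl. Qed.
Lemma cox_sym u v : u ~ v -> v ~ u. Proof. exact: rst_sym. Qed.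
Lemma cox_trans v u w : u ~ v -> v ~ w -> u ~ w. Proof. exact: rst_trans. Qed.

Lemma cox_cat2 w w' u v : u ~ v -> w ++ u ++ w' ~ w ++ v ++ w'.
Proof.
elim=> {u v} [u v [a [b [i [j [h [-> ->]]]]]]|u|u v _ IH|u v z _ IH1 _ IH2].
- apply: rst_step; exists (w ++ a), (b ++ w'), i, j; split=> //.
  by rewrite -!catA.
- exact: cox_refl.
- exact: cox_sym.
- exact: cox_trans IH1 IH2.
Qed.

Lemma cox_cat u u' v v' : u ~ u' -> v ~ v' -> u ++ v ~ u' ++ v'.
Proof.
move=> h1 h2; apply: (@cox_trans (u' ++ v)).
- exact: (@cox_cat2 [::] v u u' h1).
- by have := @cox_cat2 u' [::] v v' h2; rewrite !cats0.
Qed.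

Lemma cox_catl w u v : u ~ v -> w ++ u ~ w ++ v.
Proof. by apply: cox_cat; apply: cox_refl. Qed.
Lemma cox_catr w u v : u ~ v -> u ++ w ~ v ++ w.
Proof. by move=> h; apply: cox_cat => //; apply: cox_refl. Qed.

Lemma cox_relator i j : m i j != 0%N -> relator m i j ~ [::].
Proof.
move=> h; apply: cox_sym; apply: rst_step.
exists [::], [::], i, j; split; [exact: h|split; [by []|by rewrite cats0]].
Qed.

Lemma cox_ss s : [:: s; s] ~ [::].
Proof. by have := @cox_relator s s; rewrite /relator hm.1; apply. Qed.

Lemma catss w s : (w ++ [:: s]) ++ [:: s] ~ w.
Proof. by rewrite -catA; have := cox_catl w (cox_ss s); rewrite cats0. Qed.

Lemma cox_catrev w : w ++ rev w ~ [::].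
Proof.
elim: w => [|s w IH]; first exact: cox_refl.
rewrite rev_cons -cats1 /=.
apply: (@cox_trans ([:: s] ++ [::] ++ [:: s])); last exact: cox_ss.
by rewrite -cat1s catA -catA; have := @cox_cat2 [:: s] [:: s] _ _ IH; rewrite -!catA.
Qed.

Lemma cox_revcat w : rev w ++ w ~ [::].
Proof. by have := cox_catrev (rev w); rewrite revK. Qed.

Lemma cox_injr w u v : u ++ w ~ v ++ w -> u ~ v.
Proof.
move=> h; have := cox_catr (rev w) h; rewrite -!catA => {}h.
have e z : z ++ w ++ rev w ~ z.
  by have := cox_catl z (cox_catrev w); rewrite cats0.
exact: cox_trans (cox_sym (e u)) (cox_trans h (e v)).
Qed.

Lemma cox_injl w u v : w ++ u ~ w ++ v -> u ~ v.
Proof.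
move=> h; have := cox_catl (rev w) h; rewrite !catA => {}h.
have e z : (rev w ++ w) ++ z ~ z by have := cox_catr z (cox_revcat w).
exact: cox_trans (cox_sym (e u)) (cox_trans h (e v)).
Qed.

Lemma cox_rev u v : u ~ v -> rev u ~ rev v.
Proof.
move=> h; apply: (@cox_injl u); apply: (cox_trans (cox_catrev u)).
apply: cox_sym; apply: cox_trans (cox_catrev v).
exact: cox_catr.
Qed.

(** Relators have even length, so the sign character exists; it rules out equal lengths in
    [len_rcons]. *)
Lemma cox_odd u v : u ~ v -> odd (size u) = odd (size v).
Proof.
elim=> {u v} [u v [a [b [i [j [h [-> ->]]]]]]|//|u v _ ->//|u v z _ -> _ //].
rewrite !size_cat /relator.
have -> : size (flatten (nseq (m i j) [:: i; j])) = (m i j).*2.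
  by elim: (m i j) => //= k ->; rewrite doubleS.
by rewrite !oddD odd_double.
Qed.

Fixpoint alt a b k : word n := if k is k'.+1 then a :: alt b a k' else [::].
(** The letter that continues [alt a b k]; see [alt_rcons]. *)
Definition nxt a b k := if odd k then b else a.

Lemma size_alt a b k : size (alt a b k) = k.
Proof. by elim: k a b => //= k IH a b; rewrite IH. Qed.

Lemma nxtS a b k : nxt a b k.+1 = nxt b a k.
Proof. by rewrite /nxt /=; case: odd. Qed.

Lemma alt_add a b k l : alt a b (k + l) = alt a b k ++ alt (nxt a b k) (nxt b a k) l.
Proof.
elim: k a b => [|k IH] a b //=; by rewrite IH !nxtS.
Qed.

Lemma alt_rcons a b k : alt a b k.+1 = rcons (alt a b k) (nxt a b k).
Proof. by rewrite -addn1 alt_add cats1. Qed.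

Lemma rev_alt a b k : rev (alt b a k) = alt (nxt a b k) (nxt b a k) k.
Proof.
elim: k a b => [|k IH] a b //; rewrite alt_rcons rev_rcons IH /=.
by rewrite /nxt /=; case: odd.
Qed.

Lemma alt_relator a b k : alt a b k.*2 = flatten (nseq k [:: a; b]).
Proof. by elim: k => // k IH; rewrite doubleS /= IH. Qed.

Lemma cox_braid a b : m a b != 0%N -> alt a b (m a b) ~ alt b a (m a b).
Proof.
move=> h; apply: (@cox_injr (rev (alt b a (m a b)))).
apply: cox_trans (cox_sym (cox_catrev _)).
rewrite rev_alt -alt_add addnn alt_relator; exact: cox_relator.
Qed.

(** Braiding the first m letters brings the last letter next to its own copy, and the two cancel. *)
Lemma cox_alt_long a b : m a b != 0%N -> alt a b (m a b).+1 ~ alt b a (m a b).-1.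
Proof.
move=> h; rewrite alt_rcons -cats1.
apply: (@cox_trans (alt b a (m a b) ++ [:: nxt a b (m a b)])).
  by apply: cox_catr; apply: cox_braid.
case: (m a b) h => // k _; rewrite alt_rcons -cats1 nxtS; exact: catss.
Qed.

Lemma minlenP (C : set (word n)) w : C w ->
  (exists2 v, C v & size v = minlen C) /\ (forall v, C v -> (minlen C <= size v)%N).
Proof.
move=> Cw.
pose P (k : nat) : bool := `[< exists v, C v /\ size v = k >].
have exP : exists k, P k by exists (size w); apply/asboolP; exists w.
have := @xgetPex _ 0%N [set l | (exists w, C w /\ size w = l) /\ (forall v, C v -> (l <= size v)%N)].
rewrite -/(minlen C); case.
  exists (ex_minn exP); case: ex_minnP => k /asboolP hk hmin; split=> // v Cv.
  by apply: hmin; apply/asboolP; exists v.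
by move=> [v [h1 h2]] h; split=> //; exists v.
Qed.

Definition len w := minlen (cls m w).

Lemma lenP w : (exists2 v, w ~ v & size v = len w) /\ (forall v, w ~ v -> (len w <= size v)%N).
Proof. by apply: (@minlenP (cls m w) w); apply: cox_refl. Qed.

Lemma cls_eq u v : u ~ v -> cls m u = cls m v.
Proof.
move=> h; apply/seteqP; split=> z /= hz; apply: cox_trans hz => //; exact: cox_sym.
Qed.

Lemma len_eq u v : u ~ v -> len u = len v.
Proof. by move=> h; rewrite /len (cls_eq h). Qed.

Lemma len_le_size w : (len w <= size w)%N.
Proof. by apply: (lenP w).2; apply: cox_refl. Qed.

Lemma odd_len w : odd (len w) = odd (size w).
Proof. by have [[v h <-] _] := lenP w; rewrite (cox_odd h). Qed.

Lemma len_cat u v : (len (u ++ v) <= len u + len v)%N.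
Proof.
have [[u' hu <-] _] := lenP u; have [[v' hv <-] _] := lenP v.
by rewrite -size_cat; apply: (lenP _).2; apply: cox_cat.
Qed.

Lemma len_rev u : len (rev u) = len u.
Proof.
have H v : (len (rev v) <= len v)%N.
  have [[v' hv <-] _] := lenP v; rewrite -(size_rev v').
  by apply: (lenP _).2; apply: cox_rev.
by apply/eqP; rewrite eqn_leq H -{1}(revK u) H.
Qed.

Lemma len_nil : len [::] = 0%N.
Proof. by apply/eqP; rewrite -leqn0; apply: len_le_size. Qed.

Lemma len0 u : len u = 0%N -> u ~ [::].
Proof. by have [[v h <-] _] := lenP u => /size0nil e; rewrite -e. Qed.

Lemma len_rcons w s : len (w ++ [:: s]) = (len w).+1 \/ len w = (len (w ++ [:: s])).+1.
Proof.
have h1 := len_cat w [:: s]; have h2 := len_cat (w ++ [:: s]) [:: s].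
rewrite (len_eq (catss w s)) in h2.
have h3 : (len [:: s] <= 1)%N by apply: len_le_size.
have : odd (len (w ++ [:: s])) != odd (len w).
  by rewrite !odd_len size_cat oddD /=; case: odd.
have h4 : (len (w ++ [:: s]) <= (len w).+1)%N by lia.
have h5 : (len w <= (len (w ++ [:: s])).+1)%N by lia.
case: (ltngtP (len (w ++ [:: s])) (len w)) => h; [right|left|by rewrite h eqxx]; lia.
Qed.

Definition reduced w := len w == size w.

Lemma reduced_catl u v : reduced (u ++ v) -> reduced u.
Proof.
rewrite /reduced !eqn_leq !len_le_size /= size_cat => h.
have := len_cat u v; have := len_le_size v; have := len_le_size u; lia.
Qed.
Lemma reduced_catr u v : reduced (u ++ v) -> reduced v.
Proof.
rewrite /reduced !eqn_leq !len_le_size /= size_cat => h.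
have := len_cat u v; have := len_le_size v; have := len_le_size u; lia.
Qed.

Lemma reduced_ex w : exists2 v, w ~ v & reduced v.
Proof.
have [[v h e] _] := lenP w; exists v => //.
by rewrite /reduced e (len_eq h).
Qed.

(* Factorisation of [x] through the minimal element of the coset of a dihedral
   parabolic subgroup. *)
Lemma dihedral_decomp x s t : s != t ->
  exists v a b k,
  [/\ x ~ v ++ alt a b k,
      (len x = len v + k)%N,
      (m s t != 0)%N -> (k <= m s t)%N,
      (a = s /\ b = t) \/ (a = t /\ b = s) &
      len (v ++ [:: s]) = (len v).+1 /\ len (v ++ [:: t]) = (len v).+1].
Proof.
move=> st.
(* The factor [v] is shortest among factorisations in which lengths add up: a descent of [v] in s or
   t could be moved into [z]. The factor [z] is then as short as possible, hence alternating. *)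
pose A (l : nat) := `[< exists v z, [/\ x ~ v ++ z, over [set s; t]%SET z,
   (len x = len v + size z)%N & len v = l] >].
have exA : exists l, A l.
  exists (len x); apply/asboolP; exists x, [::].
  by rewrite cats0 addn0; split=> //; apply: cox_refl.
have /asboolP [v [z [xv oz lx lv]]] : A (ex_minn exA) by case: ex_minnP.
have mn v' z' : x ~ v' ++ z' -> over [set s; t]%SET z' -> (len x = len v' + size z')%N -> (len v <= len v')%N.
  move=> h1 h2 h3; rewrite lv; case: ex_minnP => l _; apply; apply/asboolP.
  by exists v', z'.
have up r : r \in [set s; t]%SET -> len (v ++ [:: r]) = (len v).+1.
  move=> hr; case: (len_rcons v r) => // h; exfalso.
  have := mn (v ++ [:: r]) (r :: z); have e : x ~ (v ++ [:: r]) ++ r :: z.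
    by apply: (cox_trans xv); have := cox_catr z (cox_sym (catss v r)); rewrite -(catA _ [:: r] z).
  have : (len x = len (v ++ [:: r]) + size (r :: z))%N by rewrite lx h /= addnS addSn.
  have o1 : over [set s; t]%SET (r :: z) by rewrite /over /=; apply/andP; split; [exact: hr|exact: oz].
  by move=> e1 /(_ e o1 e1); rewrite h ltnn.
have szmin z' : v ++ z ~ v ++ z' -> (size z <= size z')%N.
  move=> h; have := len_cat v z'; rewrite -(len_eq h) -(len_eq xv) lx.
  have := len_le_size z'; lia.
have altz : exists a b, z = alt a b (size z) /\ ((a = s /\ b = t) \/ (a = t /\ b = s)).
  have : forall p r, z = p ++ r -> exists a b, r = alt a b (size r) /\ ((a = s /\ b = t) \/ (a = t /\ b = s)).
    move=> p r; elim: r p => [|c r IH] p ez; first by exists s, t; split=> //; left.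
    have [|a [b [er hab]]] := IH (rcons p c); first by rewrite cat_rcons.
    have hc : c \in [set s; t]%SET.
      by move: oz; rewrite ez /over all_cat /= => /andP[_ /andP[]].
    case: r er ez {IH} => [|d r] er ez.
      move: hc; rewrite !inE => /orP[]/eqP->; [exists s, t|exists t, s]; split=> //; [left|right]; done.
    have cd : c != d.
      apply/eqP => cd; subst d.
      have := szmin (p ++ r); rewrite ez !size_cat /=.
      have h : v ++ p ++ [:: c, c & r] ~ v ++ p ++ r.
        rewrite !catA; have := @cox_cat2 (v ++ p) r _ _ (cox_ss c); rewrite /= -!catA /=.
        by [].
      by move=> /(_ h); lia.
    move: er => /= [ed er]; subst d.
    exists c, a; split; first by rewrite /=; congr (_ :: _); rewrite er size_alt -/(alt a b (size r).+1); congr (_ :: _); case: hab => -[? ?]; subst; move: hc; rewrite !inE => /orP[]/eqP ?; subst; rewrite ?eqxx // in cd *.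
    by case: hab => -[? ?]; subst; move: hc; rewrite !inE => /orP[]/eqP ?; subst; rewrite ?eqxx // in cd *; [right|left].
  by move=> /(_ [::] z erefl).
have [a [b [ez hab]]] := altz.
exists v, a, b, (size z); split=> //; first by rewrite -ez.
  move=> m0; rewrite leqNgt; apply/negP => lt.
  have mab : m a b = m s t by case: hab => -[-> ->] //; exact: hm.2.1.
  have e : z ~ alt b a (m s t).-1 ++ alt (nxt a b (m s t).+1) (nxt b a (m s t).+1) (size z - (m s t).+1).
    rewrite {1}ez -{1}(subnKC lt) alt_add; apply: cox_catr.
    by rewrite -mab; apply: cox_alt_long; rewrite mab.
  have := szmin _ (cox_catl v e); rewrite size_cat !size_alt; lia.
by split; apply: up; rewrite !inE eqxx ?orbT.
Qed.
End Words.

(** * Reflection representations *)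

(** Chebyshev polynomials of the second kind: [cheb (2 * cos th) k] is sin (k th) / sin th. They are
    taken over any commutative ring because the same formulas serve the reals and a finite field. *)
Fixpoint cheb (K : comNzRingType) (x : K) (k : nat) : K :=
  match k with
  | 0%N => 0
  | 1%N => 1
  | (k'.+1 as k1).+1 => x * cheb x k1 - cheb x k'
  end.

Lemma chebSS (K : comNzRingType) (x : K) k : cheb x k.+2 = x * cheb x k.+1 - cheb x k.
Proof. by []. Qed.

(** The recursion preserves this quadratic form; it plays the part of cos^2 + sin^2 = 1 in
    [act_dihedral]. *)
Lemma cheb_norm (K : comNzRingType) (x : K) k :
  cheb x k.+1 ^+ 2 - x * cheb x k * cheb x k.+1 + cheb x k ^+ 2 = 1.
Proof.
elim: k => [|k IH]; first by rewrite /=; ring.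
by rewrite chebSS -[RHS]IH; ring.
Qed.

Section Representation.
Variables (n : nat) (K : comNzRingType) (x : 'I_n -> 'I_n -> K).
Hypothesis xC : forall i j, x i j = x j i.
Implicit Types (u v w : word n) (s t a b : 'I_n) (z : 'rV[K]_n).

Definition alpha s : 'rV[K]_n := delta_mx 0 s.
Definition cartan s j : K := if s == j then 2 else - x s j.
Definition co s z : K := \sum_j z 0 j * cartan s j.
Definition rmx s : 'M[K]_n := 1%:M - (\col_j cartan s j) *m alpha s.
(** Vectors are rows, so the matrices multiply in reverse order and [act] is a left action. *)
Definition wmx w : 'M[K]_n := foldr (fun s A => A *m rmx s) 1%:M w.
Definition act w z : 'rV[K]_n := z *m wmx w.

Lemma actE w z : act w z = z *m wmx w. Proof. by []. Qed.
Lemma coE s z : co s z = \sum_j z 0 j * cartan s j. Proof. by []. Qed.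
Lemma act_nil z : act [::] z = z. Proof. by rewrite /act /= mulmx1. Qed.
Lemma wmx_cat u v : wmx (u ++ v) = wmx v *m wmx u.
Proof. by elim: u => [|s u IH] /=; rewrite ?mulmx1 // IH mulmxA. Qed.
Lemma act_cat u v z : act (u ++ v) z = act u (act v z).
Proof. by rewrite /act wmx_cat mulmxA. Qed.
Lemma actD w z z' : act w (z + z') = act w z + act w z'.
Proof. exact: mulmxDl. Qed.
Lemma actN w z : act w (- z) = - act w z. Proof. exact: mulNmx. Qed.
Lemma actB w z z' : act w (z - z') = act w z - act w z'.
Proof. exact: mulmxBl. Qed.
Lemma actZ w c z : act w (c *: z) = c *: act w z.
Proof. by rewrite /act scalemxAl. Qed.
Lemma act_sum w I (r : seq I) (P : pred I) (F : I -> 'rV[K]_n) :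
  act w (\sum_(i <- r | P i) F i) = \sum_(i <- r | P i) act w (F i).
Proof. exact: mulmx_suml. Qed.
Lemma act0 w : act w 0 = 0. Proof. exact: mul0mx. Qed.

Lemma act1 s z : act [:: s] z = z - co s z *: alpha s.
Proof.
rewrite /act /= mul1mx /rmx mulmxBr mulmx1 mulmxA; congr (_ - _).
have -> : z *m (\col_j cartan s j) = (co s z)%:M.
  by apply/rowP => i; rewrite !mxE ord1 eqxx; apply: eq_bigr => j _; rewrite mxE.
by rewrite mul_scalar_mx.
Qed.

Lemma act_cons s w z : act (s :: w) z = act w z - co s (act w z) *: alpha s.
Proof. by rewrite -cat1s act_cat act1. Qed.

Lemma coD s z z' : co s (z + z') = co s z + co s z'.
Proof. by rewrite /co -big_split; apply: eq_bigr => j _; rewrite mxE mulrDl. Qed.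
Lemma coZ s c z : co s (c *: z) = c * co s z.
Proof. by rewrite /co big_distrr; apply: eq_bigr => j _; rewrite mxE /= mulrA. Qed.
Lemma coN s z : co s (- z) = - co s z.
Proof. by rewrite -scaleN1r coZ mulN1r. Qed.
Lemma coB s z z' : co s (z - z') = co s z - co s z'.
Proof. by rewrite coD coN. Qed.
Lemma co_alpha s t : co s (alpha t) = cartan s t.
Proof.
rewrite /co (bigD1 t) //= big1 ?addr0 /alpha ?mxE ?eqxx ?mul1r // => j jt.
by rewrite mxE (negbTE jt) andbF mul0r.
Qed.
Lemma cartan_id s : cartan s s = 2. Proof. by rewrite /cartan eqxx. Qed.
Lemma cartan_ne s t : s != t -> cartan s t = - x s t.
Proof. by rewrite /cartan => /negbTE ->. Qed.

Lemma act1_alpha s : act [:: s] (alpha s) = - alpha s.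
Proof.
rewrite act1 co_alpha cartan_id scaler_nat mulr2n opprD addrA subrr sub0r //.
Qed.

Lemma act_ss s z : act [:: s; s] z = z.
Proof.
rewrite act_cons act1 coB coZ co_alpha cartan_id.
apply/rowP => j; rewrite !mxE; ring.
Qed.

(** Both coefficients carry the factor [cheb k], so its vanishing at k = m already gives the
    relation; no division and no nondegenerate form is involved. *)
Lemma act_dihedral a b k z : a != b ->
  act (flatten (nseq k [:: a; b])) z =
  z - (cheb (x a b) k * (co b z * cheb (x a b) k.+1 + co a z * cheb (x a b) k)) *: alpha a
    - (cheb (x a b) k * (co b z * cheb (x a b) k
         + co a z * (x a b * cheb (x a b) k - cheb (x a b) k.+1))) *: alpha b.
Proof.
move=> ab; elim: k => [|k IH].
  by rewrite /= act_nil !mul0r !scale0r !subr0.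
have -> : flatten (nseq k.+1 [:: a; b]) = [:: a, b & flatten (nseq k [:: a; b])] by [].
rewrite act_cons [act (b :: _) z]act_cons IH !(coB, coZ, co_alpha, cartan_id).
rewrite (cartan_ne ab) cartan_ne 1?eq_sym // (xC b a) chebSS.
have e := cheb_norm (x a b) k.
apply/rowP => j; rewrite !mxE.
set u := cheb _ k in e *; set w := cheb _ k.+1 in e *; set y := x a b in e *.
set A := co a z; set B := co b z; set p := (_ == a) in |- *; set r := (_ == b) in |- *.
have e1 : w ^+ 2 = 1 + y * u * w - u ^+ 2 by rewrite -e; ring.
move: (nat_of_bool p)%:R (nat_of_bool r)%:R => P Q.
have -> : w * (B * (y * w - u) + A * w) = B * (y * w ^+ 2 - u * w) + A * w ^+ 2 by ring.
have -> : w * (B * w + A * (y * w - (y * w - u))) = B * w ^+ 2 + A * (u * w) by ring.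
rewrite e1; ring.
Qed.

(** The roots of the dihedral subgroup met along one side of its residue, with coefficients whose
    signs [gx_ge0] controls in the real case. *)
Lemma act_alt a b k : a != b ->
  act (alt a b k) (alpha (nxt a b k))
    = cheb (x a b) k.+1 *: alpha a + cheb (x a b) k *: alpha b.
Proof.
elim: k a b => [|k IH] a b ab; first by rewrite act_nil scale1r scale0r addr0.
rewrite /= nxtS act_cons IH 1?eq_sym // (xC b a) coD !coZ !co_alpha cartan_id (cartan_ne ab).
apply/rowP => j; rewrite !mxE -/(cheb (x a b) k.+2); case: k {IH} => [|k] /=; ring.
Qed.

Lemma act_supp (J : {set 'I_n}) w z j : over J w -> j \notin J -> act w z 0 j = z 0 j.
Proof.
move=> + jJ; elim: w => [|s w IH] /=; first by rewrite act_nil.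
move=> /andP[/= sJ ow]; rewrite act_cons -(IH ow); move: (act w z) => y; rewrite !mxE eqxx /=.
have /negbTE-> : j != s by apply: contraNneq jJ => ->.
by rewrite mulr0 subr0.
Qed.

End Representation.

Section RepRelations.
Variables (n : nat) (m : 'I_n -> 'I_n -> nat) (K : comNzRingType) (x : 'I_n -> 'I_n -> K).
Hypothesis hm : coxeter_matrix m.
Hypothesis xC : forall i j, x i j = x j i.
Hypothesis xm : forall i j, i != j -> m i j != 0%N -> cheb (x i j) (m i j) = 0.

Lemma wmx_eq u v : cox_eq m u v -> wmx x u = wmx x v.
Proof.
elim=> {u v} [u v [a [b [i [j [h [-> ->]]]]]]|//|u v _ ->//|u v z _ -> _ //].
rewrite !wmx_cat; congr (_ *m _).
suff -> : wmx x (relator m i j) = 1%:M by rewrite mulmx1.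
apply/row_matrixP => k; rewrite !rowE mulmx1 -/(act x _ _) -/(@alpha n K k) /relator.
case: (eqVneq i j) => [<-|ij]; first by rewrite hm.1; exact: act_ss.
by rewrite (act_dihedral xC) // xm // !mul0r !scale0r !subr0.
Qed.

Lemma act_eq u v z : cox_eq m u v -> act x u z = act x v z.
Proof. by rewrite /act => /wmx_eq ->. Qed.

Lemma act_rev w z : act x (rev w) (act x w z) = z.
Proof. by rewrite -act_cat (act_eq z (cox_revcat hm w)) act_nil. Qed.
Lemma act_revK w z : act x w (act x (rev w) z) = z.
Proof. by rewrite -act_cat (act_eq z (cox_catrev hm w)) act_nil. Qed.
End RepRelations.

(** * The geometric representation and Matsumoto's theorem *)

Section Geometric.
Variables (R : realType) (n : nat) (m : 'I_n -> 'I_n -> nat).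
Hypothesis hm : coxeter_matrix m.
Implicit Types (u v w : word n) (s t a b : 'I_n) (z : 'rV[R]_n).
Notation "u ~ v" := (cox_eq m u v) (at level 70).
Notation len := (len m).

(** Off the diagonal this is -2 times the Tits form; the value 2 for m = infinity is the limit of 2
    cos (pi / m). *)
Definition gx s t : R := if m s t == 0%N then 2 else 2 * cos (pi / (m s t)%:R).

Lemma gxC s t : gx s t = gx t s. Proof. by rewrite /gx hm.2.1. Qed.

Lemma m_ge2 s t : s != t -> m s t != 0%N -> (1 < m s t)%N.
Proof. by move=> /hm.2.2; case: (m s t) => [|[|]]. Qed.

Lemma cheb_sin (th : R) k : cheb (2 * cos th) k * sin th = sin (k%:R * th).
Proof.
suff: cheb (2 * cos th) k * sin th = sin (k%:R * th) /\
      cheb (2 * cos th) k.+1 * sin th = sin (k.+1%:R * th) by case.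
elim: k => [|k [IH1 IH2]]; first by rewrite /= !mul0r sin0 !mul1r.
split=> //; rewrite chebSS mulrBl -mulrA IH1 IH2.
have -> : k.+2%:R * th = k.+1%:R * th + th by rewrite -natr1; ring.
have -> : sin (k%:R * th) = sin (k.+1%:R * th - th) by congr sin; rewrite -natr1; ring.
rewrite sinB sinD; ring.
Qed.

Lemma cheb2 k : cheb (2 : R) k = k%:R.
Proof.
suff: cheb (2 : R) k = k%:R /\ cheb (2 : R) k.+1 = k.+1%:R by case.
elim: k => [//|k [IH1 IH2]]; split=> //.
by rewrite chebSS IH1 IH2 -(natr1 k.+1) -!natr1; ring.
Qed.

Section Angle.
Variables s t : 'I_n.
Hypothesis st : s != t.
Hypothesis m0 : m s t != 0%N.
Let th : R := pi / (m s t)%:R.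
Let mR : 0 < (m s t)%:R :> R. Proof. by rewrite ltr0n lt0n. Qed.

Lemma gangle : m s t = m s t /\ (m s t)%:R * th = pi /\ 0 < sin th.
Proof.
split=> //; split; first by rewrite /th mulrC divfK // gt_eqF.
apply: sin_gt0_pi; rewrite /th; apply/andP; split; first by rewrite divr_gt0 // pi_gt0.
by rewrite ltr_pdivrMr // ltr_pMr ?pi_gt0 // ltr1n m_ge2.
Qed.

Lemma gx_m : cheb (gx s t) (m s t) = 0.
Proof.
have [_ [e sp]] := gangle; rewrite /gx (negbTE m0).
apply/eqP; have /eqP := cheb_sin th (m s t).
by rewrite e sinpi mulf_eq0 (gt_eqF sp) orbF.
Qed.

Lemma gx_ge0_fin k : (k <= m s t)%N -> 0 <= cheb (gx s t) k.
Proof.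
have [_ [e sp]] := gangle; rewrite /gx (negbTE m0) => km.
rewrite -(pmulr_lge0 _ sp) cheb_sin; apply: sin_ge0_pi; apply/andP; split.
  by rewrite mulr_ge0 // divr_ge0 ?pi_ge0.
apply: (@le_trans _ _ ((m s t)%:R * th)); last by rewrite e.
by rewrite ler_wpM2r ?ler_nat // divr_ge0 ?pi_ge0.
Qed.
End Angle.

Lemma gx_ge0 s t k : s != t -> (m s t != 0%N -> (k <= m s t)%N) -> 0 <= cheb (gx s t) k.
Proof.
move=> st h; have [m0|m0] := eqVneq (m s t) 0%N.
  by rewrite /gx m0 eqxx cheb2.
by apply: gx_ge0_fin => //; apply: h.
Qed.

Local Notation act := (act gx).
Local Notation alpha := (@alpha n R).
Local Notation co := (co gx).

Lemma gact_eq u v z : u ~ v -> act u z = act v z.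
Proof. by move=> h; apply: (act_eq hm gxC) h; apply: gx_m. Qed.
Lemma gact_rev w z : act (rev w) (act w z) = z.
Proof. by apply: (act_rev hm gxC); apply: gx_m. Qed.
Lemma gact_revK w z : act w (act (rev w) z) = z.
Proof. by apply: (act_revK hm gxC); apply: gx_m. Qed.

Definition nonneg z := forall j, 0 <= z 0 j.

Lemma nonneg_lin (c d : R) z z' : 0 <= c -> 0 <= d -> nonneg z -> nonneg z' ->
  nonneg (c *: z + d *: z').
Proof. by move=> c0 d0 h h' j; rewrite !mxE addr_ge0 ?mulr_ge0. Qed.

Lemma nonneg_alpha s : nonneg (alpha s).
Proof. by move=> j; rewrite mxE ler0n. Qed.

Lemma alpha_neq0 s : alpha s != 0.
Proof. by apply/eqP => /rowP/(_ s)/eqP; rewrite !mxE !eqxx oner_eq0. Qed.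

Lemma nonneg_anti z : nonneg z -> nonneg (- z) -> z = 0.
Proof.
move=> h h'; apply/rowP => j; rewrite !mxE; apply/eqP; rewrite eq_le h andbT.
by have := h' j; rewrite mxE oppr_ge0.
Qed.

Lemma len_last w : w <> [::] -> reduced m w -> exists v s, w = v ++ [:: s] /\ len w = (len v).+1.
Proof.
case/lastP: w => // v s _ red; exists v, s; rewrite cats1; split=> //.
have := reduced_catl (u := v) (v := [:: s]); rewrite cats1 => /(_ _ red) /eqP ->.
by move/eqP: red => ->; rewrite size_rcons.
Qed.

(* Humphreys, Theorem 5.4. *)
Lemma ascent_nonneg w s : len (w ++ [:: s]) = (len w).+1 -> nonneg (act w (alpha s)).
Proof.
move: {2}(len w) (leqnn (len w)) => N; elim: N w s => [|N IH] w s le h.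
  have /len0 e : len w = 0%N by apply/eqP; rewrite -leqn0.
  by rewrite (gact_eq _ e) act_nil; apply: nonneg_alpha.
have [v wv red] := reduced_ex m w.
have [v0|/eqP v0] := eqVneq v [::].
  by rewrite (gact_eq _ wv) v0 act_nil; apply: nonneg_alpha.
have [v' [t [ev lv]]] := len_last v0 red.
have lw : len (w ++ [:: t]) = (len v').
  apply: len_eq; apply: (cox_trans (cox_catr _ wv)); rewrite ev; exact: catss.
have st : s != t.
  apply: contra_eqN h => /eqP ->; rewrite lw (len_eq wv) lv neq_ltn; apply/orP; left.
  exact: leqnSn.
have [y [a [b [k [xy lx km hab [ls lt]]]]]] := dihedral_decomp hm w st.
have mab : m a b = m s t by case: hab => -[-> ->] //; exact: hm.2.1.
have ab : a != b by case: hab => -[-> ->] //; rewrite eq_sym.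
have k0 : (0 < k)%N.
  rewrite lt0n; apply/eqP => k0; subst k; rewrite /= cats0 in xy.
  have := len_eq (cox_catr [:: t] xy); rewrite lw lt -(len_eq xy) (len_eq wv) lv; lia.
have ny r : r = s \/ r = t -> nonneg (act y (alpha r)).
  move=> hr; apply: IH; first by lia.
  by case: hr => ->.
(* the last letter of the dihedral part cannot be [s] *)
have nxts : nxt a b k = s.
  have [//|h1] := eqVneq (nxt a b k) s; exfalso.
  have e : nxt a b k.-1 = s.
    move: h1; rewrite -[in nxt a b k](prednK k0) /nxt /=.
    by case: hab => -[-> ->]; case: odd => //=; rewrite ?eqxx.
  have e2 : w ++ [:: s] ~ y ++ alt a b k.-1.
    apply: (cox_trans (cox_catr _ xy)); rewrite -(prednK k0) alt_rcons -cats1 /= -catA.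
    by rewrite e; apply: cox_catl; apply: catss.
  have := len_cat m y (alt a b k.-1); rewrite -(len_eq e2) h.
  have := len_le_size m (alt a b k.-1); rewrite size_alt; lia.
(* If the dihedral part had full length m, then [w s] would be [y] followed by m - 1 letters,
   against the ascent. *)
have kltm : m s t != 0%N -> (k < m s t)%N.
  move=> m0; rewrite ltn_neqAle km // andbT; apply/eqP => kk.
  have e : w ++ [:: s] ~ y ++ alt b a k.-1.
    apply: (cox_trans (cox_catr _ xy)); rewrite -catA; apply: cox_catl.
    rewrite -nxts cats1 -alt_rcons kk -mab; apply: cox_alt_long => //.
    by rewrite mab.
  have := len_cat m y (alt b a k.-1); rewrite -(len_eq e) h.
  have := len_le_size m (alt b a k.-1); rewrite size_alt; lia.
rewrite (gact_eq _ xy) act_cat -nxts (act_alt gxC) // actD !actZ.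
apply: nonneg_lin.
- by apply: gx_ge0 => //; rewrite mab.
- by apply: gx_ge0 => //; rewrite mab => m0; apply: ltnW; apply: kltm.
- by apply: ny; case: hab => -[-> _]; auto.
- by apply: ny; case: hab => -[_ ->]; auto.
Qed.

Lemma descent_nonneg w s : len w = (len (w ++ [:: s])).+1 -> nonneg (- act w (alpha s)).
Proof.
move=> h; rewrite -actN -(act1_alpha gx) -act_cat; apply: ascent_nonneg.
by rewrite (len_eq (catss hm w s)).
Qed.

Lemma act_alpha_neq0 w s : act w (alpha s) != 0.
Proof.
apply/eqP => /(congr1 (act (rev w))); rewrite gact_rev act0 => /eqP.
by rewrite (negbTE (alpha_neq0 s)).
Qed.

Lemma nonneg_descent w s : nonneg (- act w (alpha s)) -> len w = (len (w ++ [:: s])).+1.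
Proof.
move=> h; case: (len_rcons hm w s) => // /ascent_nonneg h'.
by have /eqP := nonneg_anti h' h; rewrite (negbTE (act_alpha_neq0 w s)).
Qed.

Definition is_root z := exists w s, z = act w (alpha s).

Lemma root_alpha s : is_root (alpha s). Proof. by exists [::], s; rewrite act_nil. Qed.
Lemma root_act w z : is_root z -> is_root (act w z).
Proof. by move=> [v [s ->]]; exists (w ++ v), s; rewrite act_cat. Qed.
Lemma rootN z : is_root z -> is_root (- z).
Proof. by move=> [v [s ->]]; exists (v ++ [:: s]), s; rewrite act_cat act1_alpha actN. Qed.
Lemma root_neq0 z : is_root z -> z != 0.
Proof. by move=> [w [s ->]]; apply: act_alpha_neq0. Qed.

Lemma root_sign z : is_root z -> nonneg z \/ nonneg (- z).
Proof.
move=> [w [s ->]]; case: (len_rcons hm w s) => h; [left; exact: ascent_nonneg|right].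
exact: descent_nonneg.
Qed.

Lemma root_nonnegN z : is_root z -> ~ nonneg z -> nonneg (- z).
Proof. by move=> /root_sign[]. Qed.

Lemma root_pos1 z j : is_root z -> 0 < z 0 j -> nonneg z.
Proof.
move=> /root_sign[//|] h p; have := h j; rewrite mxE oppr_ge0 => h'.
by have := lt_le_trans p h'; rewrite ltxx.
Qed.

(** A nonempty reduced word ends in a descent, so it makes a simple root negative and cannot act
    trivially. *)
Lemma faithful u v : wmx gx u = wmx gx v -> u ~ v.
Proof.
move=> e.
have : wmx gx (rev v ++ u) = 1%:M.
  rewrite wmx_cat e -wmx_cat (wmx_eq hm gxC _ (cox_revcat hm v)) //; exact: gx_m.
have H w : wmx gx w = 1%:M -> w ~ [::].
  move=> ew; have [w' ww' red] := reduced_ex m w.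
  have [w0|/eqP w0] := eqVneq w' [::]; first by rewrite w0 in ww'.
  have [v' [s [e1 e2]]] := len_last w0 red.
  have : nonneg (- act w' (alpha s)).
    apply: descent_nonneg; rewrite e2 e1; congr S; apply: len_eq; apply: cox_sym; exact: catss.
  rewrite actE -(wmx_eq hm gxC _ ww'); last exact: gx_m.
  rewrite ew mulmx1 => h.
  by have /eqP := nonneg_anti (nonneg_alpha s) h; rewrite (negbTE (alpha_neq0 s)).
move=> /H h; apply: (@cox_injl _ _ hm (rev v)); apply: (cox_trans h).
by apply: cox_sym; apply: cox_revcat.
Qed.

Definition bil z z' : R := \sum_s z 0 s * co s z'.

Lemma cartanC s t : cartan gx s t = cartan gx t s.
Proof. by rewrite /cartan eq_sym gxC. Qed.
Lemma bilC z z' : bil z z' = bil z' z.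
Proof.
rewrite /bil.
under eq_bigr do rewrite coE big_distrr /=.
rewrite exchange_big /=; apply: eq_bigr => s _; rewrite coE big_distrr /=.
by apply: eq_bigr => t _; rewrite cartanC; ring.
Qed.
Lemma bilDr z z1 z2 : bil z (z1 + z2) = bil z z1 + bil z z2.
Proof. by rewrite /bil -big_split; apply: eq_bigr => s _; rewrite coD mulrDr. Qed.
Lemma bilZr z c z1 : bil z (c *: z1) = c * bil z z1.
Proof. by rewrite /bil big_distrr; apply: eq_bigr => s _; rewrite coZ /=; ring. Qed.
Lemma bil_alpha s z : bil (alpha s) z = co s z.
Proof.
rewrite /bil (bigD1 s) //= big1 ?addr0 ?mxE ?eqxx ?mul1r // => t ts.
by rewrite mxE (negbTE ts) andbF mul0r.
Qed.
Lemma bil_act1 s z z' : bil (act [:: s] z) (act [:: s] z') = bil z z'.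
Proof.
rewrite !act1 -!scaleNr !(bilDr, bilZr) bilC !(bilDr, bilZr).
rewrite [bil _ (alpha s)]bilC [bil (_ + _) (alpha s)]bilC !bil_alpha !(coD, coZ) co_alpha cartan_id.
rewrite (bilC z' z); ring.
Qed.
Lemma bil_act w z z' : bil (act w z) (act w z') = bil z z'.
Proof.
elim: w => [|s w IH]; first by rewrite !act_nil.
by rewrite -cat1s !act_cat bil_act1.
Qed.

(** A reflection is given by its root and the invariant form alone; faithfulness carries the
    equality back to W. *)
Lemma reflection_eq w w' s s' : act w (alpha s) = act w' (alpha s') ->
  w ++ [:: s] ++ rev w ~ w' ++ [:: s'] ++ rev w'.
Proof.
move=> e; apply: faithful; apply/row_matrixP => k; rewrite !rowE -!/(act _ _).
have H v t z : act (v ++ [:: t] ++ rev v) z = z - bil (act v (alpha t)) z *: act v (alpha t).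
  rewrite !act_cat act1 actB actZ gact_revK; congr (_ - _ *: _).
  by rewrite -bil_alpha -(bil_act v) gact_revK.
by rewrite !H e.
Qed.

(** A simple reflection changes a single coordinate, so a positive root made negative is a multiple
    of [alpha s]; the norm 2 of roots fixes the multiple. *)
Lemma root_flip s z : is_root z -> nonneg z -> nonneg (- act [:: s] z) -> z = alpha s.
Proof.
move=> rz h h'.
have z0 j : j != s -> z 0 j = 0.
  move=> js; apply/eqP; rewrite eq_le h andbT.
  have := h' j; rewrite act1 !mxE (negbTE js) andbF mulr0 subr0 oppr_ge0 //.
have ez : z = z 0 s *: alpha s.
  apply/rowP => j; rewrite !mxE eqxx /=; case: (eqVneq j s) => [->|/z0 ->]; by rewrite ?mulr1 ?mulr0.
have : bil z z = 2.
  by case: rz => w [t ->]; rewrite bil_act bil_alpha co_alpha cartan_id.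
rewrite {1 2}ez bilZr bilC bilZr bil_alpha co_alpha cartan_id => e.
have e1 : z 0 s = 1.
  have /eqP : z 0 s * z 0 s = 1 by lra.
  rewrite -expr2 sqrf_eq1 => /orP[/eqP//|/eqP e1].
  by have := h s; rewrite e1 lerNr oppr0 ler10.
by rewrite ez e1 scale1r.
Qed.

(** Along the gallery of [w] the root changes sign at some letter, and by [root_flip] it is simple
    there. *)
Lemma inversion_walk w z : is_root z -> nonneg z -> nonneg (- act (rev w) z) ->
  exists w1 s w2, w = w1 ++ s :: w2 /\ z = act w1 (alpha s).
Proof.
elim: w z => [|s w IH] z rz h.
  rewrite act_nil => h'; have := root_neq0 rz; by rewrite (nonneg_anti h h') eqxx.
rewrite rev_cons -cats1 act_cat => h'.
have [h1|h1] := pselect (nonneg (act [:: s] z)).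
  have [w1 [t [w2 [-> e]]]] := IH _ (root_act [:: s] rz) h1 h'.
  exists (s :: w1), t, w2; split=> //.
  by rewrite -cat1s act_cat -e -act_cat act_ss.
exists [::], s, w; split=> //; rewrite act_nil.
by apply: root_flip => //; apply: root_nonnegN => //; apply: root_act.
Qed.

(** The exchange condition: the deleted letter is the one at which the gallery of [v] crosses the
    wall between [v] and [v s]. *)
Lemma exchange v s : nonneg (- act v (alpha s)) ->
  exists v1 t v2, v = v1 ++ t :: v2 /\ v ++ [:: s] ~ v1 ++ v2.
Proof.
move=> h; have := @inversion_walk (rev v) (alpha s) (root_alpha s) (nonneg_alpha s).
rewrite revK => /(_ h) [w1 [t [w2 [e1 e2]]]].
exists (rev w2), t, (rev w1); split.
  by rewrite -[LHS]revK e1 rev_cat rev_cons cat_rcons.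
have e3 : [:: s] ~ w1 ++ [:: t] ++ rev w1.
  by have := @reflection_eq [::] w1 s t; rewrite act_nil; apply.
have ev : v = rev w2 ++ [:: t] ++ rev w1 by rewrite -[LHS]revK e1 rev_cat rev_cons cat_rcons.
rewrite ev; apply: (cox_trans (cox_catl _ e3)); rewrite -!catA; apply: cox_catl.
have e4 : rev w1 ++ w1 ++ [:: t] ++ rev w1 ~ [:: t] ++ rev w1.
  by rewrite catA; have := cox_catr ([:: t] ++ rev w1) (cox_revcat hm w1).
apply: (cox_trans (cox_catl [:: t] e4)).
by have := cox_catr (rev w1) (cox_ss hm t).
Qed.

(** The exchange condition only deletes letters, so a word over [J] can be reduced without leaving
    [J]. *)
Lemma reduced_over (J : {set 'I_n}) w : over J w ->
  exists v, [/\ w ~ v, over J v & reduced m v].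
Proof.
elim/last_ind: w => [|w s IH].
  by exists [::]; split=> //; [exact: cox_refl|rewrite /reduced len_nil].
rewrite /over all_rcons => /andP[/= sJ /IH [v [wv ov red]]].
have e : rcons w s ~ v ++ [:: s] by rewrite -cats1; apply: cox_catr.
case: (len_rcons hm v s) => h.
  exists (v ++ [:: s]); split=> //; first by rewrite /over all_cat [all _ v]ov /= sJ.
  by rewrite /reduced h size_cat addn1 (eqP red).
have [v1 [t [v2 [ev e2]]]] := exchange (descent_nonneg h).
exists (v1 ++ v2); split; first exact: cox_trans e e2.
  by move: ov; rewrite ev /over !all_cat /= => /andP[-> /andP[_ ->]].
rewrite /reduced -(len_eq e2); apply/eqP/succn_inj; rewrite -h (eqP red) ev !size_cat /=; lia.
Qed.

(** If the dihedral part of [x] were not the longest element, its last root would be positive by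
    [act_alt] and negative by the descents. *)
Lemma two_descents x s t : s != t -> nonneg (- act x (alpha s)) -> nonneg (- act x (alpha t)) ->
  m s t != 0%N /\ exists y, x ~ y ++ alt s t (m s t) /\ (len x = len y + m s t)%N.
Proof.
move=> st hs ht.
have [y [a [b [k [xy lx km hab [ls lt]]]]]] := dihedral_decomp hm x st.
have mab : m a b = m s t by case: hab => -[-> ->] //; exact: hm.2.1.
have ab : a != b by case: hab => -[-> ->] //; rewrite eq_sym.
have nm : ~ (m s t != 0%N -> (k < m s t)%N).
  move=> kltm.
  have : nonneg (act x (alpha (nxt a b k))).
    rewrite (gact_eq _ xy) act_cat (act_alt gxC) // actD !actZ.
    apply: nonneg_lin.
    - by apply: gx_ge0 => //; rewrite mab.
    - by apply: gx_ge0 => //; rewrite mab => m0; apply: ltnW; apply: kltm.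
    - by case: hab => -[-> _]; apply: ascent_nonneg.
    - by case: hab => -[_ ->]; apply: ascent_nonneg.
  have : nonneg (- act x (alpha (nxt a b k))).
    by rewrite /nxt; case: odd; case: hab => -[e1 e2]; rewrite ?e1 ?e2.
  move=> h1 h2; have /eqP := nonneg_anti h2 h1; by rewrite (negbTE (act_alpha_neq0 _ _)).
have m0 : m s t != 0%N by apply/eqP => m0; apply: nm; rewrite m0.
have ek : k = m s t.
  apply/eqP; rewrite eqn_leq km //= leqNgt; apply/negP => h; exact: nm.
split=> //; exists y; rewrite -{2}ek; split=> //; apply: (cox_trans xy); apply: cox_catl.
rewrite ek; case: hab => -[-> ->]; first exact: cox_refl.
by have := @cox_braid _ _ hm t s; rewrite hm.2.1; apply.
Qed.

(** Matsumoto's theorem as an induction principle. When two reduced words end in different letters,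
    both letters are descents, and [two_descents] provides two further words, related by a braid
    move, that end in those letters. *)
Lemma matsumoto (P : word n -> word n -> Prop) :
  (forall u, P u u) -> (forall u v, P u v -> P v u) ->
  (forall u v w, P u v -> P v w -> P u w) ->
  (forall u v s, reduced m (u ++ [:: s]) -> u ~ v -> P u v -> P (u ++ [:: s]) (v ++ [:: s])) ->
  (forall y s t, s != t -> m s t != 0%N -> reduced m (y ++ alt s t (m s t)) ->
     P (y ++ alt s t (m s t)) (y ++ alt t s (m s t))) ->
  forall u v, reduced m u -> reduced m v -> u ~ v -> P u v.
Proof.
move=> Pr Ps Pt Pc Pb a; move: {2}(size a) (leqnn (size a)) => N.
elim: N a => [|N IH] a le b ra rb ab.
  have sz : size b = 0%N by rewrite -(eqP rb) -(len_eq ab) (eqP ra); lia.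
  by rewrite (size0nil sz) (@size0nil _ a); [apply: Pr | lia].
have szab : size a = size b by rewrite -(eqP ra) -(eqP rb) (len_eq ab).
case/lastP: a le ra ab szab => [|a s] le ra ab szab.
  by rewrite (size0nil (esym szab)).
case/lastP: b rb ab szab => [|b t] rb ab szab; first by rewrite size_rcons in szab.
move: le ra rb ab szab; rewrite -!cats1 !size_cat !addn1 => le ra rb ab [szab].
have [ra' rb'] := (reduced_catl ra, reduced_catl rb).
have [est|st] := eqVneq s t.
  subst t; have ab' : a ~ b by apply: cox_injr ab.
  by apply: Pc => //; apply: IH.
have ds : nonneg (- act (a ++ [:: s]) (alpha s)).
  apply: descent_nonneg; rewrite (len_eq (catss hm _ _)) (eqP ra) (eqP ra') size_cat addn1 //.
have dt : nonneg (- act (a ++ [:: s]) (alpha t)).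
  rewrite (gact_eq _ ab); apply: descent_nonneg.
  by rewrite (len_eq (catss hm _ _)) (eqP rb) (eqP rb') size_cat addn1.
have [m0 [y' [xy lx]]] := two_descents st ds dt.
have [y yy ry] := reduced_ex m y'.
have xy1 : a ++ [:: s] ~ y ++ alt s t (m s t) by apply: (cox_trans xy); apply: cox_catr.
have xy2 : a ++ [:: s] ~ y ++ alt t s (m s t).
  by apply: (cox_trans xy1); apply: cox_catl; apply: cox_braid.
have szx : (size a).+1 = (size y + m s t)%N.
  by rewrite -(eqP ry) -(len_eq yy) -lx (eqP ra) size_cat addn1.
have r1 : reduced m (y ++ alt s t (m s t)).
  by rewrite /reduced -(len_eq xy1) (eqP ra) !size_cat size_alt addn1 szx.
have r2 : reduced m (y ++ alt t s (m s t)).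
  by rewrite /reduced -(len_eq xy2) (eqP ra) !size_cat size_alt addn1 szx.
have mp : (0 < m s t)%N by rewrite lt0n.
(* both braid words, ending in different letters, are compared to [a s] and [b t] *)
have key (c : word n) r e f : reduced m (c ++ [:: r]) -> size c = size a -> (e = s /\ f = t \/ e = t /\ f = s) ->
    c ++ [:: r] ~ y ++ alt e f (m s t) -> reduced m (y ++ alt e f (m s t)) ->
    nxt e f (m s t).-1 = r -> P (c ++ [:: r]) (y ++ alt e f (m s t)).
  move=> rc szc hef cy ry' en; rewrite -(prednK mp) alt_rcons en -cats1 catA.
  rewrite -(prednK mp) alt_rcons en -cats1 catA in cy ry'.
  have cy' := cox_injr hm cy.
  apply: Pc => //; apply: IH => //; [by rewrite szc; lia|exact: reduced_catl rc|exact: reduced_catl ry'].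
have [[e1 e2]|[e1 e2]] : (nxt s t (m s t).-1 = s /\ nxt t s (m s t).-1 = t) \/
  (nxt s t (m s t).-1 = t /\ nxt t s (m s t).-1 = s) by rewrite /nxt; case: odd; auto.
- apply: (Pt _ (y ++ alt s t (m s t))); first by apply: key; auto.
  apply: (Pt _ (y ++ alt t s (m s t))); first exact: Pb.
  by apply: Ps; apply: key; auto; apply: (cox_trans (cox_sym ab)).
- apply: (Pt _ (y ++ alt t s (m s t))); first by apply: key; auto.
  apply: (Pt _ (y ++ alt s t (m s t))); first by apply: Ps; apply: Pb.
  by apply: Ps; apply: key; auto; apply: (cox_trans (cox_sym ab)).
Qed.
End Geometric.
Arguments ascent_nonneg {R n m}.
Arguments descent_nonneg {R n m}.
Arguments act_alpha_neq0 {R n m}.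
Arguments root_alpha {R n m}.

(** * Elements, cosets and weights *)

Section Elements.
Variables (R : realType) (n : nat) (m : 'I_n -> 'I_n -> nat).
Hypothesis hm : coxeter_matrix m.
Implicit Types (u v w x y : word n) (s t a b : 'I_n) (z : 'rV[R]_n) (U V J : {set 'I_n}).
Notation "u ~ v" := (cox_eq m u v) (at level 70).
Local Notation len := (len m).
Local Notation gx := (gx R m).
Local Notation act := (act gx).
Local Notation alpha := (@alpha n R).
Local Notation is_root := (is_root (R := R) m).

(** A chosen reduced word. Normal forms represent each element of W once, so sums over W become sums
    over [Wset]. *)
Definition nf w : word n := xget [::] [set v | cox_eq m w v /\ size v = len w].

Lemma nfP w : w ~ nf w /\ size (nf w) = len w.
Proof.
have [[v h1 h2] _] := lenP m w.
exact: (@xgetPex _ [::] [set v | cox_eq m w v /\ size v = len w] (ex_intro _ v (conj h1 h2))).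
Qed.
Lemma cox_nf w : w ~ nf w. Proof. exact: (nfP w).1. Qed.
Lemma cox_nfl w : nf w ~ w. Proof. by apply: cox_sym; apply: cox_nf. Qed.
Lemma size_nf w : size (nf w) = len w. Proof. exact: (nfP w).2. Qed.
Lemma reduced_nf w : reduced m (nf w).
Proof. by rewrite /reduced size_nf -(len_eq (cox_nf w)). Qed.
Lemma nf_eq u v : u ~ v -> nf u = nf v.
Proof.
move=> h; rewrite /nf; congr xget; apply/seteqP; split=> z /= [h1 h2]; split.
- exact: cox_trans (cox_sym h) h1.
- by rewrite h2 (len_eq h).
- exact: cox_trans h h1.
- by rewrite h2 (len_eq h).
Qed.
Lemma nfK w : nf (nf w) = nf w. Proof. by apply: nf_eq; apply: cox_nfl. Qed.
Lemma nf_inj u v : nf u = nf v -> u ~ v.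
Proof. by move=> h; apply: (cox_trans (cox_nf u)); rewrite h; apply: cox_nfl. Qed.

Definition Wset : set (word n) := [set w | nf w = w].
Lemma Wset_nf w : Wset (nf w). Proof. exact: nfK. Qed.
Lemma Wset_inj u v : Wset u -> Wset v -> u ~ v -> u = v.
Proof. by move=> hu hv /nf_eq; rewrite hu hv. Qed.

(* The prefix (right weak) order. *)
Definition ple w x := len x = (len w + len (rev w ++ x))%N.

Lemma cox_ple_mul w x : w ++ (rev w ++ x) ~ x.
Proof. by rewrite catA; have := cox_catr x (cox_catrev hm w). Qed.

Definition inversion w z := [/\ is_root z, nonneg z & nonneg (- act (rev w) z)].

Lemma gact_eqr u v z : u ~ v -> act (rev u) z = act (rev v) z.
Proof. by move=> h; apply: (gact_eq hm); apply: cox_rev. Qed.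

Lemma inversion_eq u v z : u ~ v -> inversion u z -> inversion v z.
Proof. by move=> h [h1 h2 h3]; split=> //; rewrite -(gact_eqr _ h). Qed.

Lemma ple_eq u v x y : u ~ v -> x ~ y -> ple u x -> ple v y.
Proof.
move=> h1 h2; rewrite /ple (len_eq h1) (len_eq h2) => ->; congr (_ + _)%N.
by apply: len_eq; apply: cox_cat => //; apply: cox_rev.
Qed.

(** The first letter of [w] gives an inversion of [x], so [x] can start with it too; the reflection
    carries the other inversions along. *)
Lemma inversion_ple w x : (forall z, inversion w z -> inversion x z) -> ple w x.
Proof.
have [w' ww' red] := reduced_ex m w => H.
suff : ple w' x by apply: ple_eq; [apply: cox_sym|apply: cox_refl].
have {}H z : inversion w' z -> inversion x z.
  by move=> h; apply: H; apply: inversion_eq h; apply: cox_sym.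
move: {w ww'} w' red x H; elim=> [|s w IH] red x H.
  by rewrite /ple len_nil.
have redw : reduced m w by apply: (reduced_catr (u := [:: s])).
have lw : len (s :: w) = (len w).+1 by rewrite (eqP red) (eqP redw).
have asc : nonneg (act (rev w) (alpha s)).
  apply: (ascent_nonneg hm); rewrite -[rev w ++ _]revK rev_cat revK /= len_rev //.
  by rewrite lw len_rev.
have [_ _ hx] : inversion x (alpha s).
  apply: H; split; [exact: root_alpha|exact: nonneg_alpha|].
  by rewrite rev_cons -cats1 act_cat act1_alpha actN opprK.
have lx : len x = (len (s :: x)).+1.
  have := nonneg_descent hm hx; rewrite len_rev // => ->.
  by rewrite -[rev x ++ _]revK rev_cat revK len_rev.
have := IH redw (s :: x); rewrite /ple.
have -> : rev w ++ s :: x = rev (s :: w) ++ x by rewrite rev_cons cat_rcons.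
move=> /(_ _) e; rewrite lx lw addSn; congr S; apply: e => z [rz hz nz].
have e1 : act [:: s] (act [:: s] z) = z by rewrite -act_cat act_ss.
have nz1 : nonneg (act [:: s] z).
  apply: contrapT => /(root_nonnegN hm (root_act [:: s] rz)) h.
  have ez := root_flip hm rz hz h; rewrite ez in nz.
  have /eqP := nonneg_anti asc nz; by rewrite (negbTE (act_alpha_neq0 hm _ _)).
have [_ _ h3] : inversion x (act [:: s] z).
  apply: H; split=> //; first exact: root_act.
  by rewrite rev_cons -cats1 act_cat e1.
by split=> //; rewrite rev_cons -cats1 act_cat.
Qed.

Lemma ple_antisym w x : ple w x -> ple x w -> w ~ x.
Proof.
rewrite /ple => h1 h2.
have /len0 h : len (rev w ++ x) = 0%N by lia.
have := cox_catl w h; rewrite cats0 => h'.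
exact: cox_trans (cox_sym h') (cox_ple_mul w x).
Qed.

Definition inW J w := exists2 u, over J u & w ~ u.

Lemma inW_nil J : inW J [::]. Proof. by exists [::]; [|exact: cox_refl]. Qed.
Lemma over_inW J u : over J u -> inW J u. Proof. by exists u; [|exact: cox_refl]. Qed.
Lemma inW_eq J u v : u ~ v -> inW J u -> inW J v.
Proof. by move=> h [w o e]; exists w => //; apply: cox_trans e; apply: cox_sym. Qed.
Lemma inW_cat J u v : inW J u -> inW J v -> inW J (u ++ v).
Proof.
move=> [u' o1 e1] [v' o2 e2]; exists (u' ++ v'); first by rewrite /over all_cat [all _ _]o1.
exact: cox_cat.
Qed.
Lemma inW_rev J u : inW J u -> inW J (rev u).
Proof.
move=> [u' o1 e1]; exists (rev u'); first by rewrite /over all_rev.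
exact: cox_rev.
Qed.
Lemma over_sub U J u : U \subset J -> over U u -> over J u.
Proof. by move=> /fintype.subsetP sUJ; apply: sub_all => s /sUJ. Qed.
Lemma inW_sub U J u : U \subset J -> inW U u -> inW J u.
Proof. by move=> h [u' /(over_sub h) o e]; exists u'. Qed.

Definition same J x y := inW J (rev x ++ y).

Lemma same_refl J x : same J x x.
Proof. by apply: (inW_eq (cox_sym (cox_revcat hm x))); apply: inW_nil. Qed.
Lemma same_sym J x y : same J x y -> same J y x.
Proof. by move=> /inW_rev; rewrite rev_cat revK. Qed.
Lemma same_trans J y x w : same J x y -> same J y w -> same J x w.
Proof.
move=> h1 h2; apply: (inW_eq _ (inW_cat h1 h2)); rewrite -catA; apply: cox_catl.
exact: cox_ple_mul.
Qed.
Lemma same_cat J x u : inW J u -> same J x (x ++ u).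
Proof.
move=> h; apply: inW_eq h; rewrite catA.
by apply: cox_sym; have := cox_catr u (cox_revcat hm x).
Qed.
Lemma same_eq J x y : x ~ y -> same J x y.
Proof.
move=> h; apply: (inW_eq _ (inW_nil J)); apply: cox_sym.
by apply: cox_trans (cox_revcat hm y); apply: cox_catr; apply: cox_rev.
Qed.
Lemma same_sub U J x y : U \subset J -> same U x y -> same J x y.
Proof. exact: inW_sub. Qed.
Lemma sameP J x y : same J x y <-> exists2 u, over J u & x ++ u ~ y.
Proof.
split=> [[u o e]|[u o e]].
  exists u => //; apply: (cox_trans (cox_catl x (cox_sym e))); exact: cox_ple_mul.
by apply: (same_trans (same_cat x (over_inW o))); apply: same_eq.
Qed.

Lemma coset_same U x : coset m x U = [set y | same U x y].
Proof.
apply/seteqP; split=> y /=; first by move=> [u [ou e]]; apply/sameP; exists u.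
by move=> /sameP [u o e]; exists u.
Qed.
Lemma coset_eqP U x y : coset m x U = coset m y U <-> same U x y.
Proof.
rewrite !coset_same; split=> [e|h].
  have h : [set z | same U y z] y by apply: same_refl.
  by rewrite -e in h.
apply/seteqP; split=> z /=; first exact: same_trans (same_sym h).
exact: same_trans h.
Qed.

Definition suppin U z := forall j, j \notin U -> z 0 j = 0.

Lemma suppin_decomp U z : suppin U z -> z = \sum_(s in U) z 0 s *: alpha s.
Proof.
move=> h; apply/rowP => j; rewrite summxE.
have [jU|jU] := boolP (j \in U).
  rewrite (bigD1 j) //= big1 => [|s /andP[_ sj]]; rewrite !mxE ?eqxx ?mulr1 ?addr0 //.
  by rewrite eq_sym (negbTE sj) andbF mulr0.
rewrite h // big1 // => s sU; rewrite !mxE; have [e|] := eqVneq j s; last by rewrite andbF mulr0.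
by rewrite e sU in jU.
Qed.

Lemma nonneg_act_supp U y z : suppin U z -> nonneg z ->
  (forall s, s \in U -> nonneg (act y (alpha s))) -> nonneg (act y z).
Proof.
move=> h z0 H j; rewrite (suppin_decomp h) act_sum summxE sumr_ge0 // => s sU.
by rewrite actZ mxE mulr_ge0 //; apply: H.
Qed.
Lemma nonpos_act_supp U y z : suppin U z -> nonneg z ->
  (forall s, s \in U -> nonneg (- act y (alpha s))) -> nonneg (- act y z).
Proof.
move=> h z0 H j; rewrite (suppin_decomp h) act_sum mxE summxE oppr_ge0 sumr_le0 // => s sU.
by rewrite actZ mxE mulr_ge0_le0 //; have := H s sU j; rewrite mxE oppr_ge0.
Qed.

Lemma act_suppin U u z : inW U u -> suppin U z -> suppin U (act u z).
Proof.
move=> [v o e] h j jU; rewrite (gact_eq hm _ e) (act_supp _ _ o jU); exact: h.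
Qed.
Lemma suppin_alpha U s : s \in U -> suppin U (alpha s).
Proof. by move=> sU j jU; rewrite mxE; have [e|//] := eqVneq j s; rewrite -e (negbTE jU) in sU. Qed.
Lemma suppinN U z : suppin U z -> suppin U (- z).
Proof. by move=> h j /h; rewrite mxE => ->; rewrite oppr0. Qed.

Lemma act_inW_coord U u z j : inW U u -> j \notin U -> act u z 0 j = z 0 j.
Proof. by move=> [v o e] jU; rewrite (gact_eq hm _ e) (act_supp _ _ o jU). Qed.

(** Coordinates outside [J] agree at [x] and [y], so those of a separating root are both nonnegative
    and nonpositive. *)
Lemma separating_supp J x y z : same J x y -> is_root z ->
  nonneg (act (rev x) z) -> nonneg (- act (rev y) z) -> suppin J (act (rev x) z).
Proof.
move=> h rz h1 h2 j jJ; apply/eqP; rewrite eq_le h1 andbT.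
have e : act (rev y) z = act (rev y ++ x) (act (rev x) z).
  by rewrite act_cat (gact_revK hm).
have := h2 j; rewrite e mxE (act_inW_coord _ (same_sym h) jJ) oppr_ge0 //.
Qed.
Lemma separating_supp' J x y z : same J x y -> is_root z ->
  nonneg (act (rev x) z) -> nonneg (- act (rev y) z) -> suppin J (act (rev y) z).
Proof.
move=> h rz h1 h2.
have e : act (rev y) z = act (rev y ++ x) (act (rev x) z).
  by rewrite act_cat (gact_revK hm).
rewrite e; apply: act_suppin (same_sym h) _; exact: separating_supp h2.
Qed.

Lemma min_coset J x : exists2 y, same J x y & forall s, s \in J -> nonneg (act y (alpha s)).
Proof.
pose A (l : nat) := `[< exists2 y, same J x y & len y = l >].
have exA : exists l, A l by exists (len x); apply/asboolP; exists x => //; apply: same_refl.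
have /asboolP [y xy ly] : A (ex_minn exA) by case: ex_minnP.
exists y => // s sJ; apply: ascent_nonneg => //; case: (len_rcons hm y s) => // h; exfalso.
have : A (len (y ++ [:: s])).
  apply/asboolP; exists (y ++ [:: s]) => //; apply: (same_trans xy); apply: same_cat.
  by apply: over_inW; rewrite /over /= sJ.
by move: ly h; case: ex_minnP => l _ H -> e /H; lia.
Qed.

(** An inversion of [x] missed by [y] is, seen from [x], a nonpositive combination of [J]; since [x]
    keeps the roots of [J] positive, the root would be negative. *)
Lemma min_coset_inv J x y z : same J x y -> (forall s, s \in J -> nonneg (act x (alpha s))) ->
  inversion x z -> inversion y z.
Proof.
move=> h H [rz z0 nz]; split=> //; apply: contrapT => nn.
have py : nonneg (act (rev y) z).
  by have [//|/nn] := root_sign hm (root_act (rev y) rz).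
have sx := separating_supp' (same_sym h) rz py nz.
have := nonneg_act_supp (suppinN sx) nz H; rewrite actN (gact_revK hm) => z1.
have := root_neq0 hm rz; by rewrite (nonneg_anti z0 z1) eqxx.
Qed.

Lemma max_coset_inv U x y z : same U x y -> (forall s, s \in U -> nonneg (- act x (alpha s))) ->
  inversion y z -> inversion x z.
Proof.
move=> h H [rz z0 nz]; split=> //; apply: contrapT => nn.
have px : nonneg (act (rev x) z).
  by have [//|/nn] := root_sign hm (root_act (rev x) rz).
have sx := separating_supp h rz px nz.
have := nonpos_act_supp sx px H; rewrite (gact_revK hm) => z1.
have := root_neq0 hm rz; by rewrite (nonneg_anti z0 z1) eqxx.
Qed.

Lemma spherical_reps U : spherical m U ->
  exists l : seq (word n), forall u, inW U u -> exists2 v, v \in l & u ~ v.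
Proof.
move=> /finite_seqP [cs e]; exists (map (xget [::]) cs) => u [u' o eu].
have hC : WU m U (cls m u') by exists u'.
rewrite e in hC; exists (xget [::] (cls m u')); first by apply: map_f.
apply: (cox_trans eu); apply: (@xgetPex _ [::] (cls m u')); exists u'; exact: cox_refl.
Qed.

Lemma spherical_bound U : spherical m U -> exists L, forall u, inW U u -> (len u <= L)%N.
Proof.
move=> /spherical_reps [l hl]; exists (\max_(v <- l) size v)%N => u /hl [v vl uv].
rewrite (len_eq uv); apply: (leq_trans (len_le_size m v)).
exact: (leq_bigmax_seq v).
Qed.

Lemma sub_spherical U V : U \subset V -> spherical m V -> spherical m U.
Proof.
move=> sUV; apply: sub_finite_set => C [u o <-]; exists u => //; exact: over_sub o.
Qed.

Lemma max_coset U x : spherical m U ->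
  exists2 y, same U x y & forall s, s \in U -> nonneg (- act y (alpha s)).
Proof.
move=> /spherical_bound [L hL].
pose A (l : nat) := `[< exists2 y, same U x y & len y = l >].
have exA : exists l, A l by exists (len x); apply/asboolP; exists x => //; apply: same_refl.
have ub l : A l -> (l <= len x + L)%N.
  move=> /asboolP [y xy <-]; rewrite -(len_eq (cox_ple_mul x y)).
  by apply: (leq_trans (len_cat m _ _)); rewrite leq_add2l; apply: hL.
have /asboolP [y xy ly] : A (ex_maxn exA ub) by case: ex_maxnP.
exists y => // s sU; apply: descent_nonneg => //; case: (len_rcons hm y s) => // h; exfalso.
have : A (len (y ++ [:: s])).
  apply/asboolP; exists (y ++ [:: s]) => //; apply: (same_trans xy); apply: same_cat.
  by apply: over_inW; rewrite /over /= sU.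
by move: ly h; case: ex_maxnP => l _ H -> e /H; lia.
Qed.
End Elements.

(** * The weights q_w and their growth along words *)

Section Weights.
Variables (R : realType) (n : nat) (m : 'I_n -> 'I_n -> nat) (q : 'I_n -> R).
Hypothesis hm : coxeter_matrix m.
Hypothesis hq : multiparameter m q.
Implicit Types (u v w x y : word n) (s t : 'I_n).
Notation "u ~ v" := (cox_eq m u v) (at level 70).
Local Notation len := (len m).
Local Notation nf := (nf m).

Lemma qword_cat u v : qword q (u ++ v) = qword q u * qword q v.
Proof. exact: big_cat. Qed.
Lemma qword_gt0 u : 0 < qword q u.
Proof. by apply: prodr_gt0 => s _; apply: hq.1. Qed.

Lemma qword_alt s t k :
  qword q (alt s t k) = q s ^+ uphalf k * q t ^+ half k.
Proof.
elim: k s t => [|k IH] s t; first by rewrite /qword big_nil !expr0 mulr1.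
by rewrite /qword /= big_cons -/(qword q _) IH exprS; ring.
Qed.

Lemma qword_braid s t : s != t -> m s t != 0%N ->
  qword q (alt s t (m s t)) = qword q (alt t s (m s t)).
Proof.
move=> st m0; rewrite !qword_alt uphalf_half; case: (boolP (odd (m s t))) => o; last first.
  by rewrite add0n; ring.
suff -> : q s = q t by ring.
(* For odd m the alternating word of m - 1 letters conjugates s to t, so the surplus letter has the
   same weight on both sides. *)
apply: hq.2; exists (alt s t (m s t).-1).
have mp : (0 < m s t)%N by rewrite lt0n.
have oo : odd (m s t).-1 = false by rewrite -[m s t](prednK mp) /= in o; apply/negbTE.
have e1 : rev (alt s t (m s t).-1) = alt t s (m s t).-1 by rewrite rev_alt /nxt oo.
apply: (cox_injr hm (w := [:: t])).
apply: cox_trans (cox_sym (cox_ss hm t)).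
have -> : (alt s t (m s t).-1 ++ [:: s] ++ rev (alt s t (m s t).-1)) ++ [:: t] = relator m s t.
  rewrite e1 /relator -alt_relator.
  have -> : (m s t).*2 = ((m s t).-1 + (m s t).-1.+2)%N by rewrite -addnn; lia.
  rewrite alt_add /nxt oo -catA; congr (_ ++ _).
  rewrite -[alt s t _.+2]/(s :: alt t s (m s t).-1.+1) alt_rcons /nxt oo -cats1.
  by rewrite -catA.
exact: cox_relator.
Qed.

Lemma qword_reduced u v : reduced m u -> reduced m v -> u ~ v -> qword q u = qword q v.
Proof.
apply: (matsumoto R hm (P := fun u v => qword q u = qword q v)) => //.
- by move=> a b c -> ->.
- by move=> a b s _ _ e; rewrite !qword_cat e.
- by move=> y s t st m0 _; rewrite !qword_cat qword_braid.
Qed.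

Definition qe w := qword q (nf w).

Lemma qe_gt0 w : 0 < qe w. Proof. exact: qword_gt0. Qed.
Lemma qe_eq u v : u ~ v -> qe u = qe v. Proof. by move=> h; rewrite /qe (nf_eq h). Qed.
Lemma qe_reduced w : reduced m w -> qe w = qword q w.
Proof. by move=> r; apply: qword_reduced => //; [apply: reduced_nf|apply: cox_nfl]. Qed.

Lemma qe_cat u v : len (u ++ v) = (len u + len v)%N -> qe (u ++ v) = qe u * qe v.
Proof.
move=> h; have e : u ++ v ~ nf u ++ nf v by apply: cox_cat; apply: cox_nf.
rewrite (qe_eq e) qe_reduced; first by rewrite qword_cat.
by rewrite /reduced -(len_eq e) h size_cat !size_nf.
Qed.

Lemma qe_ple w x : ple m w x -> qe x = qe w * qe (rev w ++ x).
Proof.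
move=> h; rewrite -qe_cat; first by apply: qe_eq; apply: cox_sym; apply: cox_ple_mul.
by rewrite (len_eq (cox_ple_mul hm w x)).
Qed.

(** Bounds the factor by which one letter, appended or cancelled, can change q_w; bounded errors in
    words then cost bounded factors. *)
Definition qK : R := 1 + \sum_s (q s + (q s)^-1).

Lemma qK_ge1 : 1 <= qK.
Proof. by rewrite lerDl sumr_ge0 // => s _; rewrite addr_ge0 ?invr_ge0 // ltW //; apply: hq.1. Qed.
Lemma qK_ge s : q s <= qK /\ (q s)^-1 <= qK.
Proof.
have h t : 0 <= q t by apply: ltW; apply: hq.1.
rewrite /qK (bigD1 s) //=.
have : 0 <= \sum_(i < n | i != s) (q i + (q i)^-1) by apply: sumr_ge0 => t _; apply: addr_ge0; rewrite ?invr_ge0; apply: h.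
have h1 := h s; have h2 : 0 <= (q s)^-1 by rewrite invr_ge0.
by move=> h3; split; lra.
Qed.

Lemma qe_step w s : qe (w ++ [:: s]) <= qK * qe w.
Proof.
have l1 : len [:: s] = 1%N.
  have := odd_len m [:: s]; have := len_le_size m [:: s] => /=; by case: (len [:: s]) => [|[|]].
have q1 : qe [:: s] = q s by rewrite qe_reduced ?/reduced ?l1 // /qword big_seq1.
case: (len_rcons hm w s) => h.
  by rewrite qe_cat ?l1 ?addn1 // q1 mulrC ler_wpM2r ?(qK_ge s).1 // ltW // qe_gt0.
have : qe w = qe (w ++ [:: s]) * q s.
  rewrite -q1 -qe_cat; first by apply: qe_eq; apply: cox_sym; apply: catss.
  by rewrite l1 addn1 (len_eq (catss hm w s)).
move=> ->; rewrite mulrCA ler_peMr ?(ltW (qe_gt0 _)) //.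
have [_ h2] := qK_ge s; have qs := hq.1 s.
by rewrite -(@mulVf _ (q s)) ?gt_eqF // ler_wpM2r // ltW.
Qed.

Lemma qe_bound w u : qe (w ++ u) <= qK ^+ size u * qe w.
Proof.
elim/last_ind: u => [|u s IH]; first by rewrite cats0 expr0 mul1r.
rewrite -cats1 catA; apply: (le_trans (qe_step _ _)).
rewrite size_cat addn1 exprS -mulrA ler_wpM2l //.
by apply: le_trans qK_ge1.
Qed.
End Weights.

(** * Intervals of the weak order *)

Section Colouring.
Variables (R : realType) (n : nat) (m : 'I_n -> 'I_n -> nat).
Hypothesis hm : coxeter_matrix m.
Variables (F : finFieldType) (fx : 'I_n -> 'I_n -> F).
Hypothesis fxC : forall i j, fx i j = fx j i.
Hypothesis fxm : forall i j, i != j -> m i j != 0%N -> cheb (fx i j) (m i j) = 0.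
Hypothesis fxo : forall i j k, i != j -> m i j != 0%N -> (0 < k < m i j)%N ->
  cheb (fx i j) k.*2 = 0 -> cheb (fx i j) k.*2.+1 = 1 -> False.
Implicit Types (u v w x y p : word n) (s t a b : 'I_n).
Notation "u ~ v" := (cox_eq m u v) (at level 70).
Local Notation len := (len m).
Local Notation act := (act (gx R m)).
Local Notation alpha := (@alpha n R).
Local Notation colour := 'M[F]_n.

(** The root identifies the wall; the colour is its reflection read over the finite field, so the
    colours are finitely many. *)
Definition wall p s : 'rV[R]_n * colour := (act p (alpha s), wmx fx (p ++ [:: s] ++ rev p)).
Fixpoint walls p w : seq ('rV[R]_n * colour) :=
  if w is s :: w' then wall p s :: walls (rcons p s) w' else [::].

Lemma walls_cat p u v : walls p (u ++ v) = walls p u ++ walls (p ++ u) v.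
Proof.
elim: u p => [|s u IH] p /=; first by rewrite cats0.
by rewrite IH -cats1 -catA.
Qed.
Lemma size_walls p u : size (walls p u) = size u.
Proof. by elim: u p => //= s u IH p; rewrite IH. Qed.

Lemma fwmx_eq u v : u ~ v -> wmx fx u = wmx fx v.
Proof. exact: (wmx_eq hm fxC fxm). Qed.

Lemma wall_eq p p' s : p ~ p' -> wall p s = wall p' s.
Proof.
move=> h; rewrite /wall (gact_eq hm _ h); congr (_, _); apply: fwmx_eq.
by apply: cox_cat => //; apply: cox_catl; apply: cox_rev.
Qed.
Lemma walls_eq p p' w : p ~ p' -> walls p w = walls p' w.
Proof.
elim: w p p' => //= s w IH p p' h; rewrite (wall_eq _ h); congr (_ :: _).
by apply: IH; rewrite -!cats1; apply: cox_catr.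
Qed.

Lemma nth_walls_alt p a b k j d : (j < k)%N ->
  nth d (walls p (alt a b k)) j = wall (p ++ alt a b j) (nxt a b j).
Proof.
elim: k p a b j => // k IH p a b [|j] /=; first by rewrite cats0.
by rewrite ltnS => /IH ->; rewrite cat_rcons nxtS.
Qed.

Lemma alt_palindrome a b j : alt a b j ++ [:: nxt a b j] ++ rev (alt a b j) = alt a b j.*2.+1.
Proof.
have -> : j.*2.+1 = (j + j.+1)%N by rewrite -addnn; lia.
rewrite alt_add; congr (_ ++ _) => /=; congr (_ :: _).
by rewrite rev_alt.
Qed.

(** The reflections of a finite dihedral group, written as palindromes, are met in opposite orders
    from the two sides. *)
Lemma odd_alt_eq a b j : m a b != 0%N -> (j < m a b)%N ->
  alt a b j.*2.+1 ~ alt b a (m a b - j.+1).*2.+1.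
Proof.
move=> m0 jm; set l := (m a b - j.+1)%N.
have e : (j.*2.+1 + l.*2.+1 = (m a b).*2)%N by rewrite /l; lia.
have e2 : alt a b j.*2.+1 ++ alt b a l.*2.+1 ~ [::].
  have -> : alt a b j.*2.+1 ++ alt b a l.*2.+1 = relator m a b.
    by rewrite /relator -alt_relator -e alt_add /nxt /= odd_double.
  exact: cox_relator.
apply: (cox_injr hm (w := alt b a l.*2.+1)); apply: (cox_trans e2); apply: cox_sym.
have := cox_catrev hm (alt b a l.*2.+1).
by rewrite rev_alt /nxt /= odd_double.
Qed.

Lemma cheb_sym a b k : a != b -> m a b != 0%N -> (k <= m a b)%N ->
  cheb (gx R m a b) (m a b - k) = cheb (gx R m a b) k.
Proof.
move=> ab m0 km; have [_ [e sp]] := gangle R hm ab m0.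
rewrite /gx (negbTE m0); apply: (mulIf (lt0r_neq0 sp)).
rewrite !cheb_sin natrB // mulrBl e sinB sinpi cospi; ring.
Qed.

(** The two sides of a dihedral residue cross the same walls in reverse order: on roots this is sin
    (pi - x) = sin x, on colours it is [odd_alt_eq]. *)
Lemma walls_braid y a b : a != b -> m a b != 0%N ->
  walls y (alt b a (m a b)) = rev (walls y (alt a b (m a b))).
Proof.
move=> ab m0; pose d := wall y a; have mp : (0 < m a b)%N by rewrite lt0n.
apply: (@eq_from_nth _ d); first by rewrite size_rev !size_walls !size_alt.
rewrite size_walls size_alt => j jm.
rewrite nth_rev size_walls size_alt // !nth_walls_alt //; last by rewrite ltn_subrL mp.
set l := (m a b - j.+1)%N.
have lm : (l < m a b)%N by rewrite ltn_subrL mp.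
have el : (m a b - l.+1 = j)%N by rewrite /l; lia.
rewrite /wall !act_cat; congr (_, _).
  rewrite !act_alt ?(eq_sym b) //; try exact: gxC.
  rewrite (gxC R hm b a) addrC; congr (act y (_ *: _ + _ *: _)).
  - by rewrite -(cheb_sym ab m0 (k := l.+1)) // el.
  - by rewrite -(cheb_sym ab m0 (k := j.+1)) // -/l.
have E c e k : (y ++ alt c e k) ++ [:: nxt c e k] ++ rev (y ++ alt c e k) = y ++ alt c e k.*2.+1 ++ rev y.
  by rewrite -alt_palindrome rev_cat -!catA.
rewrite !E; apply: fwmx_eq; apply: cox_cat2.
by have := @odd_alt_eq b a j; rewrite hm.2.1; apply.
Qed.

(** Equal colours would make some power (ba)^k with 0 < k < m trivial over [F]; applied to a simple
    root, this gives exactly the values that [fxo] excludes. *)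
Lemma colours_braid_uniq y a b : a != b -> m a b != 0%N ->
  uniq (map snd (walls y (alt a b (m a b)))).
Proof.
move=> ab m0; pose d := wall y a; apply/(uniqP d.2) => j l.
rewrite !inE !size_map !size_walls !size_alt => jm lm.
rewrite !(nth_map d) ?size_walls ?size_alt // !nth_walls_alt //.
wlog jl : j l jm lm / (j < l)%N.
  move=> H; case: (ltngtP j l) => // h e; first exact: H.
  by apply/esym; apply: H.
have E c e k : (y ++ alt c e k) ++ [:: nxt c e k] ++ rev (y ++ alt c e k) = y ++ alt c e k.*2.+1 ++ rev y.
  by rewrite -alt_palindrome rev_cat -!catA.
rewrite /wall /= !E => e.
have inv w : wmx fx (rev w) *m wmx fx w = 1%:M by rewrite -wmx_cat (fwmx_eq (cox_catrev hm w)).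
have {}e : wmx fx (alt a b j.*2.+1) = wmx fx (alt a b l.*2.+1).
  have key w : wmx fx w = wmx fx y *m wmx fx (y ++ w ++ rev y) *m wmx fx (rev y).
    rewrite -!wmx_cat; apply: fwmx_eq; apply: cox_sym; rewrite -!catA.
    rewrite catA; apply: (cox_trans (cox_catr _ (cox_revcat hm y))) => /=.
    by have := cox_catl w (cox_revcat hm y); rewrite cats0.
  by rewrite (key (alt a b j.*2.+1)) e -key.
have ba : b != a by rewrite eq_sym.
have e2 : wmx fx (alt b a (l - j).*2) = 1%:M.
  move: e; have -> : l.*2.+1 = (j.*2.+1 + (l - j).*2)%N by lia.
  rewrite alt_add wmx_cat /nxt /= odd_double /= => e1.
  by rewrite -[LHS]mulmx1 -(inv (rev (alt a b j.*2.+1))) revK mulmxA -e1 -wmx_cat (fwmx_eq (cox_revcat hm _)).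
have := act_alt (K := F) fxC (l - j).*2 ba.
rewrite /nxt odd_double actE e2 mulmx1 => /rowP e3.
exfalso; apply: (@fxo b a (l - j)%N ba).
- by rewrite hm.2.1.
- by rewrite hm.2.1; lia.
- have := e3 a; rewrite !mxE !eqxx /= (negbTE ab).
  by rewrite mulr0 mulr1 add0r => <-.
- have := e3 b; rewrite !mxE !eqxx /= (negbTE ba).
  by rewrite mulr0 mulr1 addr0 => <-.
Qed.

Definition cwalls (c : colour) p w := [seq t <- walls p w | t.2 == c].

Lemma cwalls_cat c p u v : cwalls c p (u ++ v) = cwalls c p u ++ cwalls c (p ++ u) v.
Proof. by rewrite /cwalls walls_cat filter_cat. Qed.

(* Two walls of the same colour never cross, so they occur in the same order in
   all reduced words of an element. *)
Lemma cwalls_reduced u v : reduced m u -> reduced m v -> u ~ v ->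
  forall c, cwalls c [::] u = cwalls c [::] v.
Proof.
apply: (matsumoto R hm (P := fun u v => forall c, cwalls c [::] u = cwalls c [::] v)) => //.
- by move=> a b d h1 h2 c; rewrite h1.
- move=> a b s _ ab h c; rewrite !cwalls_cat h; congr (_ ++ _).
  by rewrite /cwalls (walls_eq _ ab).
- move=> y s t st m0 _ c; rewrite !cwalls_cat; congr (_ ++ _).
  rewrite /cwalls /= walls_braid // filter_rev.
  have := colours_braid_uniq y st m0; move: (walls _ _) => l ul.
  suff : (size [seq i <- l | i.2 == c] <= 1)%N by case: [seq i <- l | i.2 == c] => [|i [|]].
  rewrite size_filter; have -> : count (fun i => i.2 == c) l = count (pred1 c) (map snd l).
    by rewrite count_map.
  by rewrite count_uniq_mem //; case: (_ \in _).
Qed.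

Lemma walls_inversion w z : reduced m w -> inversion m w z <-> z \in map fst (walls [::] w).
Proof.
move=> red; have pre : forall p v, reduced m (p ++ v) -> z \in map fst (walls p v) ->
    exists p1 s v1, p ++ v = p1 ++ s :: v1 /\ z = act p1 (alpha s).
  move=> p v; elim: v p => // s v IH p r /=; rewrite inE => /orP[/eqP ->|h].
    by exists p, s, v.
  have [|p1 [t [v1 [e1 e2]]]] := IH (rcons p s) _ h; first by rewrite cat_rcons.
  by exists p1, t, v1; rewrite -e1 cat_rcons.
split.
  move=> [rz z0 nz]; have [w1 [s [w2 [-> ->]]]] := inversion_walk hm rz z0 nz.
  by rewrite walls_cat map_cat mem_cat /= inE eqxx orbT.
move=> /(pre [::] w red) /= [p1 [s [v1 [ew ez]]]]; subst w.
have r1 : reduced m (p1 ++ [:: s]) by apply: (@reduced_catl _ _ _ v1); rewrite -catA.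
have a1 : nonneg (act p1 (alpha s)).
  apply: (ascent_nonneg hm); rewrite (eqP r1) (eqP (reduced_catl r1)) size_cat addn1 //.
split; [by rewrite ez; exists p1, s|by rewrite ez|].
rewrite ez rev_cat act_cat gact_rev // rev_cons -cats1 act_cat act1_alpha actN opprK.
apply: (ascent_nonneg hm); have r2 := reduced_catr red.
rewrite -[rev v1 ++ _]revK rev_cat revK /= !len_rev // (eqP r2).
by rewrite (eqP (reduced_catr (u := [:: s]) r2)).
Qed.

Local Notation nf := (nf m).

(** For each colour, how many walls remain to be crossed from [w] to [x]. *)
Definition defect x w : {ffun colour -> nat} :=
  [ffun c => size (cwalls c w (nf (rev w ++ x)))].

Lemma defect_sum x w : ple m w x -> (\sum_c defect x w c = len x - len w)%N.
Proof.
move=> h; rewrite [len x]h addKn -size_nf -(size_walls w).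
rewrite -sum1_size.
under eq_bigr do rewrite ffunE size_filter -sum1_count big_mkcond.
rewrite exchange_big /=; apply: eq_bigr => i _.
by rewrite -big_mkcond (big_pred1 i.2).
Qed.

(** The walls of one colour are crossed in an order that depends on [x] only. The number left
    therefore tells which ones [w] has crossed, and these inversions determine [w]. *)
Lemma defect_inj x w w' : ple m w x -> ple m w' x -> defect x w = defect x w' -> w ~ w'.
Proof.
have red v : ple m v x -> reduced m (nf v ++ nf (rev v ++ x)) /\ nf v ++ nf (rev v ++ x) ~ x.
  move=> h; have e : nf v ++ nf (rev v ++ x) ~ x.
    apply: cox_trans (cox_ple_mul hm v x); apply: cox_cat; exact: cox_nfl.
  by split=> //; rewrite /reduced (len_eq e) size_cat !size_nf; apply/eqP.
move=> h h' ed.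
have [r1 e1] := red w h; have [r2 e2] := red w' h'.
have E c : cwalls c [::] (nf w) = cwalls c [::] (nf w').
  have := cwalls_reduced r1 r2 (cox_trans e1 (cox_sym e2)) c; rewrite !cwalls_cat /=.
  have sz : size (cwalls c (nf w) (nf (rev w ++ x))) = size (cwalls c (nf w') (nf (rev w' ++ x))).
    have := congr1 (fun f : {ffun colour -> nat} => f c) ed; rewrite !ffunE.
    by rewrite /cwalls !(walls_eq _ (cox_nfl m _)).
  move=> e; have sz2 : size (cwalls c [::] (nf w)) = size (cwalls c [::] (nf w')).
    by have := congr1 size e; rewrite !size_cat sz => /addIn.
  by have := congr1 (take (size (cwalls c [::] (nf w)))) e; rewrite take_size_cat // take_size_cat.
have H v v' z : (forall c, cwalls c [::] (nf v) = cwalls c [::] (nf v')) ->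
    inversion (R := R) m (nf v) z -> inversion (R := R) m (nf v') z.
  move=> He /(walls_inversion z (reduced_nf m v)) /mapP [t ht ->].
  apply/(walls_inversion _ (reduced_nf m v')); apply: map_f.
  have : t \in cwalls t.2 [::] (nf v) by rewrite mem_filter eqxx.
  by rewrite He mem_filter => /andP[].
have : nf w ~ nf w'.
  by apply: (ple_antisym hm); apply: (inversion_ple (R := R) hm) => z; apply: H.
move=> h1; exact: cox_trans (cox_nf m w) (cox_trans h1 (cox_nfl m w')).
Qed.

Lemma geo_sum_le (r : R) N : 0 <= r < 1 -> \sum_(k < N) r ^+ k <= (1 - r)^-1.
Proof.
move=> /andP[r0 r1]; have h : 0 < 1 - r by rewrite subr_gt0.
have e : (1 - r) * \sum_(k < N) r ^+ k = 1 - r ^+ N.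
  by rewrite -[1 in RHS](expr1n _ N) subrXX; congr (_ * _); apply: eq_bigr => i _; rewrite expr1n mul1r.
rewrite -(ler_pM2l h) e mulfV ?gt_eqF // gerBl exprn_ge0 //.
Qed.

(** Defects embed the interval into tuples of naturals indexed by colours, so the sum is dominated
    by one geometric series per colour, uniformly in [x]. *)
Lemma interval_sum (r : R) : 0 <= r < 1 -> exists2 C : R, 0 <= C &
  forall x (l : seq (word n)), uniq l ->
   (forall w, w \in l -> Wset m w /\ ple m w x) ->
   \sum_(w <- l) r ^+ (len x - len w) <= C.
Proof.
move=> r01; have /andP[r0 r1] := r01.
have C0 : 0 <= (1 - r)^-1 by rewrite invr_ge0 subr_ge0 ltW.
exists ((1 - r)^-1 ^+ #|{: colour}|); first exact: exprn_ge0.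
move=> x l ul hl; pose N := len x.
(* Defects are viewed in the finite range 0..len x so that [bigA_distr_bigA] turns the sum over
   tuples into a product of sums. *)
pose g (w : word n) : {ffun colour -> 'I_N.+1} := [ffun c => inord (defect x w c)].
have dN w c : w \in l -> (defect x w c <= N)%N.
  move=> /hl [_ h]; have := defect_sum h; rewrite (bigD1 c) //= /N; lia.
have gE w c : w \in l -> g w c = defect x w c :> nat.
  by move=> wl; rewrite ffunE inordK // ltnS dN.
have gi : {in l &, injective g}.
  move=> w w' wl wl' e; have [W1 h1] := hl _ wl; have [W2 h2] := hl _ wl'.
  apply: (Wset_inj W1 W2); apply: (defect_inj h1 h2); apply/ffunP => c.
  by rewrite -!gE // e.
pose G (f : {ffun colour -> 'I_N.+1}) : R := \prod_c r ^+ f c.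
have -> : \sum_(w <- l) r ^+ (len x - len w) = \sum_(f <- map g l) G f.
  rewrite big_map !big_seq; apply: eq_bigr => w wl; have [_ h] := hl _ wl.
  rewrite -defect_sum // /G prodrXr; congr (_ ^+ _); apply: eq_bigr => c _; by rewrite gE.
have ug : uniq (map g l) by rewrite map_inj_in_uniq.
rewrite big_uniq //=.
apply: (@le_trans _ _ (\sum_(f : {ffun colour -> 'I_N.+1}) G f)).
  rewrite [leRHS](bigID (mem (map g l))) /= lerDl sumr_ge0 // => f _.
  by rewrite /G prodr_ge0 // => c _; apply: exprn_ge0.
rewrite /G -(bigA_distr_bigA (fun (_ : colour) (k : 'I_N.+1) => r ^+ k)) /=.
apply: (@le_trans _ _ (\prod_(c : colour) (1 - r)^-1)); last by rewrite prodr_const.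
apply: ler_prod => c _; rewrite geo_sum_le // andbT sumr_ge0 // => k _.
exact: exprn_ge0.
Qed.
End Colouring.

(** * A reflection representation over a finite field *)

(** With z + 1 / z in the place of 2 cos th, [cheb] becomes a q-integer. *)
Lemma cheb_geom (K : fieldType) (z : K) k : z != 0 ->
  cheb (z + z^-1) k * (z - z^-1) = z ^+ k - z ^- k.
Proof.
move=> z0; suff: cheb (z + z^-1) k * (z - z^-1) = z ^+ k - z ^- k /\
      cheb (z + z^-1) k.+1 * (z - z^-1) = z ^+ k.+1 - z ^- k.+1 by case.
elim: k => [|k [IH1 IH2]]; first by rewrite /= !expr0 invr1 subrr mul0r !expr1 mul1r.
split=> //; rewrite chebSS mulrBl -mulrA IH1 IH2 !exprS.
by field; rewrite expf_neq0 // z0.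
Qed.

Lemma finfield_prim_root (N : nat) : (0 < N)%N ->
  exists (F : finFieldType) (z : F), N.-primitive_root z.
Proof.
move=> N0; have [p pN pp] := prime_above N.
have cop : coprime N p.
  rewrite coprime_sym prime_coprime //; apply/negP => /(dvdn_leq N0); lia.
have k0 : (0 < totient N)%N by rewrite totient_gt0.
have [F _ cF] := PrimePowerField pp k0.
have q1 : (1 < #|F|)%N by rewrite cF -(exp1n (totient N)) ltn_exp2r // prime_gt1.
have dvd : (N %| #|F|.-1)%N.
  have := Euler_exp_totient (a := p) (n := N); rewrite coprime_sym => /(_ cop).
  rewrite cF => /eqP; rewrite eqn_mod_dvd ?expn_gt0 ?prime_gt0 // subn1 //.
have [g] : exists g : F, #|F|.-1.-primitive_root g.
  have qp : (0 < #|F|.-1)%N by lia.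
  have := @has_prim_root F #|F|.-1 (enum [pred x : F | x != 0]) qp.
  have -> : all #|F|.-1.-unity_root (enum [pred x : F | x != 0]).
    apply/allP => x; rewrite mem_enum inE => x0; apply/unity_rootP.
    apply: (mulfI x0); rewrite -exprS prednK ?mulr1; [exact: expf_card|lia].
  rewrite enum_uniq -cardE; have -> : #|[pred x : F | x != 0]| = #|F|.-1.
    by rewrite -(cardC1 (0 : F)); apply: eq_card => x; rewrite !inE.
  by move=> /(_ isT isT (leqnn _)) /hasP [g _ hg]; exists g.
move=> hg; exists F, (g ^+ (#|F|.-1 %/ N)).
by apply: (dvdn_prim_root hg).
Qed.

Section FiniteModel.
Variables (n : nat) (m : 'I_n -> 'I_n -> nat).
Hypothesis hm : coxeter_matrix m.

Lemma finite_model : exists (F : finFieldType) (fx : 'I_n -> 'I_n -> F),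
  [/\ forall i j, fx i j = fx j i,
      forall i j, i != j -> m i j != 0%N -> cheb (fx i j) (m i j) = 0 &
      forall i j k, i != j -> m i j != 0%N -> (0 < k < m i j)%N ->
        cheb (fx i j) k.*2 = 0 -> cheb (fx i j) k.*2.+1 = 1 -> False].
Proof.
(* Infinite entries are replaced by 1 so that the product of all entries is a nonzero common
   multiple. *)
pose mm i j := if m i j == 0%N then 1%N else m i j.
pose M := (\prod_i \prod_j mm i j)%N.
have mm0 i j : (0 < mm i j)%N by rewrite /mm; case: eqP => // /eqP; rewrite lt0n.
have M0 : (0 < M)%N by rewrite prodn_gt0 // => i; rewrite prodn_gt0.
have dv i j : (mm i j %| M)%N.
  rewrite /M (bigD1 i) //= dvdn_mulr // (bigD1 j) //= dvdn_mulr //.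
have N0 : (0 < M.*2)%N by rewrite double_gt0.
have [F [ze hz]] := finfield_prim_root N0.
(* A root of unity of order 2m, the counterpart of exp (i pi / m). *)
pose zz i j := ze ^+ (M %/ mm i j).
have prim i j : ((mm i j).*2).-primitive_root (zz i j).
  have e : (M.*2 %/ (mm i j).*2 = M %/ mm i j)%N.
    by rewrite -!muln2 divnMr.
  rewrite /zz -e; apply: (dvdn_prim_root hz).
  by rewrite -!muln2 dvdn_mul.
have z0 i j : zz i j != 0.
  by apply/eqP => e; have := prim_expr_order (prim i j); rewrite e expr0n gtn_eqF ?double_gt0 //= => /eqP; rewrite eq_sym oner_eq0.
have mE i j : m i j != 0%N -> mm i j = m i j by rewrite /mm => /negbTE ->.
have neq i j : i != j -> m i j != 0%N -> zz i j - (zz i j)^-1 != 0.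
  move=> ij h; rewrite subr_eq0 -(inj_eq (mulfI (z0 i j))) mulfV //.
  rewrite -expr2 -(prim_order_dvd (prim i j)) mE //.
  by have := hm.2.2 _ _ ij; move: (m i j) h => [|[|k]].
have eqz i j k : (zz i j ^+ k - zz i j ^- k == 0) = (mm i j %| k)%N.
  rewrite subr_eq0 -(inj_eq (mulfI (expf_neq0 k (z0 i j)))) (mulfV (expf_neq0 k (z0 i j))).
  by rewrite -exprD addnn -(prim_order_dvd (prim i j)) -!muln2 dvdn_pmul2r.
exists F, (fun i j => zz i j + (zz i j)^-1); split.
- by move=> i j; rewrite /zz /mm hm.2.1.
- move=> i j ij h; apply: (mulIf (neq _ _ ij h)); rewrite cheb_geom // mul0r.
  by apply/eqP; rewrite eqz mE.
- move=> i j k ij h /andP[k0 km] e1 e2.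
  (* [cheb (2k) = 0] makes m divide 2k, so m = 2k. The value 1 of [cheb (m + 1)] would then force
     z^m = 1, against the order 2m. *)
  have := cheb_geom k.*2 (z0 i j); rewrite e1 mul0r => /esym/eqP; rewrite eqz mE // => d.
  have mk : (m i j = k.*2)%N.
    case/dvdnP: d => c e; have : (c < 2)%N by rewrite -(ltn_pmul2r (_ : 0 < m i j)%N) //; lia.
    move: e; case: c => [|[|]] //; lia.
  have := cheb_geom k.*2.+1 (z0 i j); rewrite e2 mul1r -mk => e3.
  have : zz i j ^+ (m i j) = 1.
    have e4 : zz i j ^- (m i j) = zz i j ^+ (m i j).
      by apply/eqP; rewrite eq_sym -subr_eq0 eqz mE.
    apply: (mulIf (neq _ _ ij h)); rewrite mul1r [RHS]e3 exprSr invfM e4; ring.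
  move=> /eqP; rewrite -(prim_order_dvd (prim i j)) mE // => /(dvdn_leq _).
  rewrite lt0n => /(_ h); rewrite -addnn; move: h; rewrite -lt0n; lia.
Qed.
End FiniteModel.

(** * Points in general position *)

Lemma finite_roots (R : realType) (p : {poly R}) : p != 0 -> finite_set [set x | root p x].
Proof.
move: {2}(size p) (leqnn (size p)) => N; elim: N p => [|N IH] p le p0.
  by move: p0; rewrite -size_poly_eq0 -leqn0 le.
have [[a ra]|nr] := pselect (exists a, root p a); last first.
  by rewrite (_ : [set x | root p x] = set0) // -subset0 => x /= rx; apply: nr; exists x.
have /factor_theorem [q e] := ra.
have q0 : q != 0 by apply: contraNneq p0 => q0; rewrite e q0 mul0r.
have : finite_set ([set a] `|` [set x | root q x]).
  rewrite finite_setU; split; first exact: finite_set1.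
  apply: IH => //; move: le; rewrite e size_Mmonic ?monicXsubC // size_XsubC addn2 //=.
apply: sub_finite_set => x /=; rewrite e rootM root_XsubC => /orP[h|/eqP ->]; by [right|left].
Qed.

(** Countably many finite root sets have Lebesgue measure zero and cannot cover (0, 1). *)
Lemma avoid_roots (R : realType) (D : countType) (P : D -> {poly R}) :
  exists2 t : R, 0 < t & forall c, P c != 0 -> ~~ root (P c) t.
Proof.
pose A := \bigcup_(c in [set: D]) [set x | P c != 0 /\ root (P c) x].
have cA : countable A.
  apply: bigcup_countable => // c _; have [h|/negP h] := boolP (P c != 0).
    by apply: finite_set_countable; apply: sub_finite_set (finite_roots h) => x [].
  by rewrite (_ : [set x | _] = set0) // -subset0 => x /= [].
have [t /= ht hA] : exists2 t : R, `]0, 1[%classic t & ~ A t.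
  apply: contrapT => H.
  have sub : `]0 : R, 1[%classic `<=` A.
    by move=> t ht; apply: contrapT => nA; apply: H; exists t.
  have := countable_lebesgue_measure0 (sub_countable (subset_card_le sub) cA).
  by rewrite lebesgue_measure_itv /= lte_fin ltr01 -EFinB subr0 => -[/eqP]; rewrite oner_eq0.
exists t; first by move: ht; rewrite in_itv /= => /andP[].
move=> c h; apply/negP => r; apply: hA; exists c => //.
Qed.

Section GenericPoints.
Variables (R : realType) (n : nat) (m : 'I_n -> 'I_n -> nat).
Hypothesis hm : coxeter_matrix m.
Local Notation act := (act (gx R m)).
Local Notation alpha := (@alpha n R).

(** A chamber with a label that separates several points of one chamber: [Some U] for the point of a
    cell of type [U], [None] for a cone apex. *)
Definition key : Type := (word n * option {set 'I_n})%type.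

(* The point of key [k], in the open chamber of the word [k.1], evaluated at the
   vector [z]; its coordinates in that chamber lie on the moment curve. *)
Definition ev (th : key -> R) (k : key) (z : 'rV[R]_n) : R :=
  \sum_i act (rev k.1) z 0 i * th k ^+ i.

Lemma evE th k z : ev th k z = \sum_i act (rev k.1) z 0 i * th k ^+ i.
Proof. by []. Qed.
Lemma ev_sum th k I (r : seq I) (P : pred I) (c : I -> R) (F : I -> 'rV[R]_n) :
  ev th k (\sum_(i <- r | P i) c i *: F i) = \sum_(i <- r | P i) c i * ev th k (F i).
Proof.
rewrite /ev; under eq_bigr do rewrite act_sum summxE big_distrl /=.
rewrite exchange_big /=; apply: eq_bigr => i _; rewrite big_distrr /=.
by apply: eq_bigr => j _; rewrite actZ mxE mulrA.
Qed.
Lemma evZ th k c z : ev th k (c *: z) = c * ev th k z.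
Proof. by have := @ev_sum th k _ [:: tt] xpredT (fun=> c) (fun=> z); rewrite !big_seq1. Qed.
Lemma evD th k z z' : ev th k (z + z') = ev th k z + ev th k z'.
Proof.
rewrite /ev -big_split; apply: eq_bigr => i _.
by rewrite actD [X in X * _]mxE mulrDl.
Qed.

Definition evmx th p (ks : 'I_p -> key) (rho : 'I_p -> 'I_n) w : 'M[R]_p :=
  \matrix_(a, b) ev th (ks b) (act w (alpha (rho a))).

Definition generic (th : key -> R) := forall p (ks : 'I_p -> key) (rho : 'I_p -> 'I_n) w,
  injective ks -> injective rho -> \det (evmx th ks rho w) != 0.

Let D : countType :=
  {p : nat & ({ffun 'I_p -> key} * {ffun 'I_p.+1 -> 'I_n} * word n * key)%type}.

Let vec p (ks : {ffun 'I_p -> key}) (rho : {ffun 'I_p.+1 -> 'I_n}) (w : word n) (k : key)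
    (th : key -> R) : 'rV[R]_n :=
  act (rev k.1) (\sum_(a < p.+1) ((-1) ^+ a * \det (evmx th ks (fun b => rho (lift a b)) w)) *: act w (alpha (rho a))).
Let Qp p (d : ({ffun 'I_p -> key} * {ffun 'I_p.+1 -> 'I_n} * word n * key)%type)
    (th : key -> R) : {poly R} :=
  \sum_(i < n) (vec d.1.1.1 d.1.1.2 d.1.2 d.2 th) 0 i *: 'X^i.
Let Q (c : D) (th : key -> R) : {poly R} := Qp (projT2 c) th.

(** Parameters are chosen along an enumeration of the keys. A minor, expanded along the column of
    its last key, is a polynomial in the parameter of that key with coefficients already fixed; the
    minors are countably many, so [avoid_roots] applies. *)
Lemma exists_generic : exists2 th : key -> R, (forall k, 0 < th k) & generic th.
Proof.
pose pick (g : key -> R) : R := xget 1 [set t | 0 < t /\ forall c, Q c g != 0 -> ~~ root (Q c g) t].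
have pickP g : 0 < pick g /\ forall c, Q c g != 0 -> ~~ root (Q c g) (pick g).
  have [t t0 ht] := avoid_roots (fun c => Q c g).
  exact: (@xgetPex _ 1 [set t | 0 < t /\ forall c, Q c g != 0 -> ~~ root (Q c g) t] (ex_intro _ t (conj t0 ht))).
(* [f N] carries the final parameters of all keys with code below [N]. *)
pose f := fix f (N : nat) : key -> R := if N is N'.+1 then
   (fun k => if choice.pickle k == N' then pick (f N') else f N' k) else (fun=> 1).
pose th (k : key) := f (choice.pickle k).+1 k.
have thE k : th k = pick (f (choice.pickle k)) by rewrite /th /= eqxx.
have stable N k : (choice.pickle k < N)%N -> f N k = th k.
  elim: N => // N IH; rewrite ltnS leq_eqVlt => /orP[/eqP e|lt]; first by rewrite /th e.
  by rewrite /= ltn_eqF // IH.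
have [inv1 inv2] : (forall w z, act w (act (rev w) z) = z) /\ injective alpha.
  split=> [w z|a b]; first exact: gact_revK.
  by move=> /rowP/(_ a); rewrite !mxE !eqxx /=; case: (eqVneq a b) => // _ /eqP; rewrite oner_eq0.
exists th; first by move=> k; rewrite thE; apply: (pickP _).1.
elim=> [|p IH] ks rho w ki ri; first by rewrite det_mx00 oner_eq0.
have [j jmax] : exists j : 'I_p.+1, forall i, (choice.pickle (ks i) <= choice.pickle (ks j))%N.
  have [j _ h] := @arg_maxnP 'I_p.+1 ord0 xpredT (fun i => choice.pickle (ks i)) isT.
  by exists j => i; apply: h.
set k := ks j; set N := choice.pickle k.
have small b : (choice.pickle (ks (lift j b)) < N)%N.
  rewrite ltn_neqAle jmax andbT; apply/eqP => /(pcan_inj choice.pickleK) /ki e.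
  by have := neq_lift j b; rewrite e eqxx.
pose ks' : {ffun 'I_p -> key} := [ffun b => ks (lift j b)].
pose rho' : {ffun 'I_p.+1 -> 'I_n} := [ffun a => rho a].
pose c : D := existT _ p (ks', rho', w, k).
have same (a : 'I_p.+1) : \det (evmx (f N) ks' (fun b => rho' (lift a b)) w)
    = \det (evmx th (fun b => ks (lift j b)) (fun b => rho (lift a b)) w).
  congr (\det _); apply/matrixP => a' b'; rewrite !mxE !ffunE /ev.
  by apply: eq_bigr => i _; rewrite stable // ffunE.
have cof (a : 'I_p.+1) : \det (evmx th (fun b => ks (lift j b)) (fun b => rho (lift a b)) w) != 0.
  by apply: IH => b b' /=; [move/ki|move/ri]; apply: lift_inj.
(* [vec] is a combination of linearly independent roots whose coefficients are, up to sign, smaller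
   minors, nonzero by induction. *)
have Q0 : Q c (f N) != 0.
  set v := vec ks' rho' w k (f N).
  have v0 : v != 0.
    apply/eqP; rewrite /v /vec => /(congr1 (act k.1)); rewrite inv1 act0.
    under eq_bigr do rewrite -actZ; rewrite -act_sum => /(congr1 (act (rev w))).
    rewrite act0 gact_rev // => /rowP/(_ (rho ord0)); rewrite summxE (bigD1 ord0) //= big1.
      by rewrite addr0 !mxE !ffunE !eqxx mulr1 expr0 mul1r => /eqP; rewrite same (negbTE (cof _)).
    move=> a a0; rewrite !mxE !ffunE eqxx /=; case: eqP => [/ri e|_]; last by rewrite mulr0.
    by rewrite e eqxx in a0.
  have [i vi] : exists i, v 0 i != 0.
    apply: contrapT => H; move/eqP: v0; apply; apply/rowP => i; rewrite [RHS]mxE.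
    by apply/eqP/negPn/negP => h; apply: H; exists i.
  apply: contraNneq vi => /(congr1 (fun q : {poly R} => q`_i)).
  rewrite /Q /Qp /= coef0 coef_sum (bigD1 i) //= big1 => [|l li].
    by rewrite addr0 coefZ coefXn eqxx mulr1 => ->.
  by rewrite coefZ coefXn (inj_eq val_inj) eq_sym (negbTE li) mulr0.
have := (pickP (f N)).2 c Q0; rewrite -thE -/k /root; apply: contraNneq => d0.
have : \det (evmx th ks rho w) = (-1) ^+ j * (Q c (f N)).[th k].
  have -> : (Q c (f N)).[th k] = \sum_(i < n) vec ks' rho' w k (f N) 0 i * th k ^+ i.
    by rewrite /Q /Qp /= horner_sum; apply: eq_bigr => i _; rewrite hornerZ hornerXn.
  rewrite (expand_det_col _ j).
  have -> : \sum_(i < n) vec ks' rho' w k (f N) 0 i * th k ^+ i = ev th k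
      (\sum_(a < p.+1) ((-1) ^+ a * \det (evmx (f N) ks' (fun b => rho' (lift a b)) w)) *: act w (alpha (rho a))).
    rewrite /ev; apply: eq_bigr => i _; congr (_ 0 i * _).
    by rewrite /vec; congr (act _ _); apply: eq_bigr => a _; rewrite ffunE.
  rewrite ev_sum big_distrr /=; apply: eq_bigr => a _.
  rewrite mxE mulrC /cofactor same exprD -/k.
  have -> : row' a (col' j (evmx th ks rho w)) = evmx th (fun b => ks (lift j b)) (fun b => rho (lift a b)) w.
    by apply/matrixP => a' b'; rewrite !mxE.
  ring.
by rewrite d0 => /esym/eqP; rewrite mulf_eq0 signr_eq0 /= => /eqP ->.
Qed.
End GenericPoints.

(** * Signs of determinants *)

Section Sign.
Variable R : realType.

(** The common strict sign of a family, 0 if there is none. The empty family has sign 1, hence the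
    witnesses [t0] below. *)
Definition sg (T : finType) (P : pred T) (v : T -> R) : R :=
  if [forall t, P t ==> (0 < v t)] then 1 else
  if [forall t, P t ==> (v t < 0)] then -1 else 0.

Lemma sg_corr (T T' : finType) (P : pred T) (P' : pred T') v v' :
  (forall t, P t -> exists2 t', P' t' & v t = v' t') ->
  (forall t', P' t' -> exists2 t, P t & v t = v' t') -> sg P v = sg P' v'.
Proof.
move=> h1 h2; have H (Q : R -> bool) : [forall t, P t ==> Q (v t)] = [forall t, P' t ==> Q (v' t)].
  apply/forallP/forallP => h t; apply/implyP => Pt.
    by have [t' Pt' <-] := h2 _ Pt; have := h t'; rewrite Pt'.
  by have [t' Pt' ->] := h1 _ Pt; have := h t'; rewrite Pt'.
by rewrite /sg (H (fun r => 0 < r)) (H (fun r => r < 0)).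
Qed.

Lemma sgN (T : finType) (P : pred T) v t0 : P t0 -> sg P (fun t => - v t) = - sg P v.
Proof.
move=> P0; rewrite /sg.
have -> : [forall t, P t ==> (0 < - v t)] = [forall t, P t ==> (v t < 0)].
  by apply: eq_forallb => t; rewrite oppr_gt0.
have -> : [forall t, P t ==> (- v t < 0)] = [forall t, P t ==> (0 < v t)].
  by apply: eq_forallb => t; rewrite oppr_lt0.
case: forallP => h1; case: forallP => h2; rewrite ?opprK ?oppr0 //.
by have := h1 t0; have := h2 t0; rewrite P0 /= => /lt_trans h /h; rewrite ltxx.
Qed.

Lemma sgM (T : finType) (P : pred T) v t0 k : P t0 ->
  sg P (fun t => (-1) ^+ k * v t) = (-1) ^+ k * sg P v.
Proof.
move=> P0; elim: k v => [|k IH] v.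
  by rewrite expr0 mul1r; congr sg; apply/funext => t; rewrite mul1r.
transitivity (sg P (fun t => - ((-1) ^+ k * v t))).
  by congr sg; apply/funext => t; rewrite exprS mulN1r mulNr.
by rewrite (sgN _ P0) IH exprS mulN1r mulNr.
Qed.

Lemma sg_neq0 (T : finType) (P : pred T) v : sg P v != 0 ->
  exists2 c : R, c != 0 & forall t, P t -> 0 < c * v t.
Proof.
rewrite /sg; case: forallP => [h _|_].
  by exists 1; rewrite ?oner_eq0 // => t Pt; have := h t; rewrite Pt mul1r.
case: forallP => [h _|_]; last by rewrite eqxx.
by exists (-1); rewrite ?oppr_eq0 ?oner_eq0 // => t Pt; have := h t; rewrite Pt mulN1r oppr_gt0.
Qed.

Lemma sg_abs (T : finType) (P : pred T) v : `|sg P v| <= 1.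
Proof. by rewrite /sg; do 2?case: ifP => _; rewrite ?normrN ?normr1 ?normr0 ?ler01. Qed.

Section Plane.
Variables (T : finType) (P : pred T) (D : T -> T -> R).
Hypothesis Dasym : forall a b, P a -> P b -> D a b = - D b a.
Hypothesis Dn0 : forall a b, P a -> P b -> a != b -> D a b != 0.
Hypothesis Dplu : forall a b c d, P a -> P b -> P c -> P d -> a != b ->
  D a b * D c d - D a c * D b d + D a d * D b c = 0.

Let S j := sg [pred k | P k & k != j] (D j).

(** On the positive side of [j] the relation [0 < D a b] is the angular order; the Pluecker relation
    makes it transitive. *)
Let tr j a b c : P j -> P a -> P b -> P c -> j != a ->
  0 < D j a -> 0 < D j b -> 0 < D j c -> 0 < D a b -> 0 < D b c -> 0 < D a c.
Proof.
move=> Pj Pa Pb Pc ja h1 h2 h3 h4 h5; have := Dplu Pj Pa Pb Pc ja => e.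
have e1 : D j b * D a c = D j a * D b c + D j c * D a b by lra.
by rewrite -(pmulr_rgt0 _ h2) e1 addr_gt0 // mulr_gt0.
Qed.

Let extreme j : P j -> (exists2 k, P k & k != j) ->
  (forall k, P k -> k != j -> 0 < D j k) ->
  exists2 e, P e & e != j /\ forall k, P k -> k != e -> D e k < 0.
Proof.
move=> Pj [k0 Pk0 k0j] hj.
have [e [ein he]] : exists e, e \in enum [pred k | P k & k != j] /\
    forall k, k \in enum [pred k | P k & k != j] -> k != e -> 0 < D k e.
  have : enum [pred k | P k & k != j] != [::].
    apply/eqP => e; have : k0 \in enum [pred k | P k & k != j] by rewrite mem_enum inE Pk0.
    by rewrite e.
  have : forall k, k \in enum [pred k | P k & k != j] -> P k /\ k != j.
    by move=> k; rewrite mem_enum inE => /andP[].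
  elim: (enum _) => // a l IH hl _; have [Pa aj] := hl a (mem_head _ _).
  have [->|l0] := eqVneq l [::].
    by exists a; rewrite mem_head; split=> // k; rewrite inE => /eqP -> /eqP.
  have [|//|e [el he]] := IH; first by move=> k kl; apply: hl; rewrite inE kl orbT.
  have [Pe ej] : P e /\ e != j by apply: hl; rewrite inE el orbT.
  have [ae|ae] := eqVneq a e.
    by exists e; rewrite inE el orbT; split=> // k; rewrite inE => /orP[/eqP->|/he]; rewrite ?ae ?eqxx.
  case: (ltgtP (D a e) 0) => h; last by have := Dn0 Pa Pe ae; rewrite h eqxx.
    have h' : 0 < D e a by rewrite Dasym // oppr_gt0.
    exists a; rewrite mem_head; split=> // k; rewrite inE => /orP[/eqP-> /eqP//|kl] ka.
    have [ke|ke] := eqVneq k e; first by rewrite ke.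
    have [Pk kj] : P k /\ k != j by apply: hl; rewrite inE kl orbT.
    apply: (tr (j := j) (b := e)) => //; rewrite 1?eq_sym //; try exact: hj.
    exact: he.
  exists e; rewrite inE el orbT; split=> // k; rewrite inE => /orP[/eqP-> _|]; [exact: h|exact: he].
have /andP[Pe ej] : P e && (e != j) by move: ein; rewrite mem_enum.
exists e => //; split=> // k Pk ke; rewrite Dasym // oppr_lt0.
have [->|kj] := eqVneq k j; first by apply: hj.
by apply: he => //; rewrite mem_enum inE Pk kj.
Qed.

(** Read [D a b] as the determinant of two plane vectors. If all lie on the positive side of one of
    them, the first in angular order has sign 1, the last has sign -1, and every other one has
    vectors on both sides. *)
Lemma sum_sg_pos : (forall j, P j -> exists2 k, P k & k != j) ->
  (exists2 j, P j & forall k, P k -> k != j -> 0 < D j k) -> \sum_(j | P j) S j = 0.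
Proof.
move=> nt [j Pj hj]; have [e Pe [ej he]] := extreme Pj (nt j Pj) hj.
have Sj : S j = 1.
  rewrite /S /sg; case: forallP => // H; exfalso; apply: H => k.
  by apply/implyP => /andP[]; apply: hj.
have Se : S e = -1.
  rewrite /S /sg; case: forallP => [/(_ j)|_].
    by rewrite /= Pj eq_sym ej /= => h; have := lt_trans h (he j Pj (_ : j != e)); rewrite eq_sym ej ltxx => /(_ isT).
  by case: forallP => // H; exfalso; apply: H => k; apply/implyP => /andP[]; apply: he.
rewrite (bigD1 j) //= (bigD1 e) ?Pe //= Sj Se big1 ?addr0 ?subrr // => k /andP[/andP[Pk kj] ke].
rewrite /S /sg; case: forallP => [/(_ j)|_].
  by rewrite /= Pj eq_sym kj /= Dasym // oppr_gt0 => h; have := lt_trans h (hj k Pk kj); rewrite ltxx.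
case: forallP => // /(_ e); rewrite /= Pe eq_sym ke /= Dasym // oppr_lt0 => h.
by have := lt_trans h (he k Pk ke); rewrite ltxx.
Qed.
End Plane.

Lemma sum_sg_plane (T : finType) (P : pred T) (D : T -> T -> R) :
  (forall a b, P a -> P b -> D a b = - D b a) ->
  (forall a b, P a -> P b -> a != b -> D a b != 0) ->
  (forall a b c d, P a -> P b -> P c -> P d -> a != b ->
     D a b * D c d - D a c * D b d + D a d * D b c = 0) ->
  (forall j, P j -> exists2 k, P k & k != j) ->
  \sum_(j | P j) sg [pred k | P k & k != j] (D j) = 0.
Proof.
move=> h1 h2 h3 nt.
have [H|H] := pselect (exists2 j, P j & forall k, P k -> k != j -> 0 < D j k).
  exact: sum_sg_pos.
have [H'|H'] := pselect (exists2 j, P j & forall k, P k -> k != j -> 0 < - D j k).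
  apply/eqP; rewrite -oppr_eq0 -sumrN; apply/eqP.
  rewrite -[RHS](@sum_sg_pos T P (fun a b => - D a b)) //.
  - apply: eq_bigr => j Pj; have [k Pk kj] := nt j Pj.
    by rewrite (@sgN _ _ (D j) k) //= Pk.
  - by move=> a b Pa Pb; rewrite h1.
  - by move=> a b Pa Pb ab; rewrite oppr_eq0 h2.
  - by move=> a b c d Pa Pb Pc Pd ab; rewrite !mulrNN h3.
apply: big1 => j Pj; rewrite /sg; case: forallP => h.
  by exfalso; apply: H; exists j => // k Pk kj; have := h k; rewrite /= Pk kj.
case: forallP => h' //; exfalso; apply: H'; exists j => // k Pk kj; have := h' k.
by rewrite /= Pk kj /= oppr_gt0.
Qed.
End Sign.

(** * Determinants of lists of rows, and the form obtained by letting two rows vary *)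

Section RowDeterminants.
Variable R : realType.
Implicit Types (rows A B : seq (nat -> R)) (f g : nat -> R).

(** Rows are functions on nat, so rows can be appended and columns deleted without dependent sizes;
    [detn p] reads the first p columns. *)
Definition rnth rows a : nat -> R := nth (fun=> 0) rows a.
Definition detn p rows : R := \det (\matrix_(a < p, b < p) rnth rows a b).

Lemma detn_swap p A B f g : p = (size A + (size B).+2)%N ->
  detn p (A ++ f :: g :: B) = - detn p (A ++ g :: f :: B).
Proof.
move=> ep; have lt1 : (size A < p)%N by rewrite ep; lia.
have lt2 : ((size A).+1 < p)%N by rewrite ep; lia.
rewrite /detn; set i := Ordinal lt1; set j := Ordinal lt2.
have ij : i != j by rewrite -(inj_eq val_inj) /= ltn_eqF.
set M := (X in \det X = _); set N := (X in _ = - \det X).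
have -> : M = xrow i j N.
  apply/matrixP => a b; rewrite !mxE /rnth !nth_cat.
  have [->|ai] := eqVneq a i; first by rewrite tpermL /= ltnn subnn ltnNge leqnSn /= subSnn.
  have [->|aj] := eqVneq a j; first by rewrite tpermR /= ltnn subnn ltnNge leqnSn /= subSnn.
  rewrite tpermD 1?eq_sym //; case: ltnP => // le.
  have [c ->] : exists c, (a - size A = c.+2)%N.
    have h1 : (a : nat) <> size A by move=> e; move/eqP: ai; apply; apply: val_inj.
    have h2 : (a : nat) <> (size A).+1 by move=> e; move/eqP: aj; apply; apply: val_inj.
    exists (a - size A - 2)%N; move: le h1 h2; clear; move: (nat_of_ord a) (size A) => x y.
    by move=> *; lia.
  by [].
by rewrite xrowE det_mulmx det_perm odd_tperm ij expr1 mulN1r.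
Qed.

Lemma detn_move A f B C p : p = (size A + (size B).+1 + size C)%N ->
  detn p (A ++ f :: B ++ C) = (-1) ^+ size B * detn p (A ++ B ++ f :: C).
Proof.
elim: B A => [|g B IH] A ep; first by rewrite expr0 mul1r.
rewrite detn_swap /=; last by rewrite ep /= size_cat; lia.
rewrite -cat_rcons IH; last by rewrite size_rcons ep /=; lia.
by rewrite cat_rcons exprS mulN1r mulNr.
Qed.

(** The row operation subtracts a rank one matrix from the identity, so its determinant is 1 - u a0
    = -1. *)
Lemma detn_reflect p rows rows' a0 (u : nat -> R) : (a0 < p)%N -> u a0 = 2 ->
  (forall a b, (a < p)%N -> (b < p)%N ->
     rnth rows' a b = rnth rows a b - u a * rnth rows a0 b) ->
  detn p rows' = - detn p rows.
Proof.
move=> lt u2 h; pose i := Ordinal lt.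
pose A := \matrix_(a < p, b < p) ((a == b)%:R - u a * (b == i)%:R) : 'M[R]_p.
have -> : detn p rows' = \det (A *m \matrix_(a < p, b < p) rnth rows a b).
  rewrite /detn; congr (\det _); apply/matrixP => a b; rewrite !mxE h //.
  under eq_bigr do rewrite !mxE mulrBl.
  rewrite sumrB (bigD1 a) //= big1 => [|c ca]; last by rewrite eq_sym (negbTE ca) mul0r.
  rewrite eqxx mul1r addr0 (bigD1 i) //= big1 => [|c ci]; last by rewrite (negbTE ci) mulr0 mul0r.
  by rewrite eqxx mulr1 addr0.
rewrite det_mulmx; suff -> : \det A = -1 by rewrite mulN1r.
rewrite (expand_det_row _ i) (bigD1 i) //= big1 => [|b bi]; last first.
  by rewrite mxE eq_sym (negbTE bi) mulr0 subr0 mul0r.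
rewrite addr0 mxE !eqxx u2 mulr1 /cofactor addnn -signr_odd odd_double expr0 mul1r.
have -> : row' i (col' i A) = 1%:M.
  apply/matrixP => a b; rewrite !mxE (inj_eq lift_inj) [lift i b == i]eq_sym (negbTE (neq_lift i b)).
  by rewrite mulr0 subr0.
by rewrite det1 mulr1 -[true%:R]/(1 : R); lra.
Qed.

Lemma detn_lin p A B : p = (size A + (size B).+1)%N ->
  exists K : nat -> R, forall f, detn p (A ++ f :: B) = \sum_(b < p) f b * K b.
Proof.
move=> ep; have lt1 : (size A < p)%N by rewrite ep; lia.
pose i := Ordinal lt1; pose N := \matrix_(a < p, b < p) rnth (A ++ (fun=> 0) :: B) a b.
exists (fun b => if insub b is Some b' then cofactor N i b' else 0) => f.
rewrite /detn (expand_det_row _ i); apply: eq_bigr => b _; rewrite valK; congr (_ * _).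
  by rewrite mxE /rnth nth_cat ltnn subnn.
rewrite /cofactor; congr (_ * \det _); apply/matrixP => a c; rewrite !mxE /rnth !nth_cat.
case: ltnP => // le; have := neq_lift i a; rewrite -(inj_eq val_inj) /= => ne.
have : (size A < bump (size A) a)%N by rewrite ltn_neqAle ne le.
by rewrite -subn_gt0; case: (_ - _)%N.
Qed.

Lemma detn_row p A rows f : p = (size rows).+1 -> A = rows ->
  (exists2 a, (a < size rows)%N & forall b, (b < p)%N -> f b = rnth rows a b) -> detn p (rcons rows f) = 0.
Proof.
move=> ep _ [a lt h]; have lt1 : (a < p)%N by rewrite ep; lia.
have lt2 : (size rows < p)%N by rewrite ep.
rewrite /detn (@determinant_alternate _ _ _ (Ordinal lt1) (Ordinal lt2)) //.
  by rewrite -(inj_eq val_inj) /= ltn_eqF.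
by move=> b; rewrite !mxE /rnth !nth_rcons lt ltnn eqxx h.
Qed.

Definition ecol (k : nat) : nat -> R := fun b => (b == k)%:R.

Lemma detn_ecol p r k : size r = p -> (k < p.+1)%N ->
  detn p.+1 (rcons r (ecol k)) = (-1) ^+ (p + k) * detn p [seq (fun b => g (bump k b)) | g <- r].
Proof.
move=> sr kp; pose ik : 'I_p.+1 := Ordinal kp.
rewrite /detn (expand_det_row _ ord_max) (bigD1 ik) //= big1 => [|b bk]; last first.
  rewrite !mxE /rnth nth_rcons sr ltnn eqxx /ecol.
  by move: bk; rewrite -(inj_eq val_inj) /= => /negbTE ->; rewrite mul0r.
rewrite addr0 !mxE /rnth nth_rcons sr ltnn eqxx /ecol eqxx mul1r /cofactor /=.
congr (_ * \det _); apply/matrixP => a b; rewrite !mxE /rnth nth_rcons sr /=.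
by rewrite /bump [(p <= a)%N]leqNgt ltn_ord /= add0n ltn_ord (nth_map (fun=> 0)) // sr.
Qed.

Section TwoRows.
Variables (p : nat) (r : seq (nat -> R)).
Hypothesis sr : size r = p.
(** An alternating form on the quotient by the rows [r], which is a plane when these are
    independent; hence the Pluecker relation. *)
Definition D2 f g := detn p.+2 (r ++ [:: f; g]).

Lemma D2_asym f g : D2 f g = - D2 g f.
Proof. by rewrite /D2 detn_swap //= sr; lia. Qed.

Lemma D2_id f : D2 f f = 0.
Proof. by have := D2_asym f f => h; lra. Qed.

Lemma D2_r a g : (a < p)%N -> D2 (rnth r a) g = 0.
Proof.
move=> ap; rewrite D2_asym /D2 -[r ++ _]/(r ++ [:: g] ++ [:: rnth r a]) catA !cats1.
rewrite (@detn_row _ (rcons r g)) ?oppr0 // ?size_rcons ?sr //.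
exists a; rewrite ?size_rcons ?sr; first by lia.
by move=> b _; rewrite /rnth nth_rcons sr ap.
Qed.

Lemma D2_plucker a b c d : D2 a b != 0 ->
  D2 a b * D2 c d - D2 a c * D2 b d + D2 a d * D2 b c = 0.
Proof.
move=> ab0.
pose M := \matrix_(i < p.+2, j < p.+2) rnth (r ++ [:: a; b]) i j.
have Mu : M \in unitmx by rewrite unitmxE unitfE.
(* Coordinates of [c] in the basis [r], [a], [b]; those along [r] do not affect [D2]. *)
pose y := (\row_(j < p.+2) c j) *m invmx M.
have ey : y *m M = \row_j c j by rewrite mulmxKV.
pose ip : 'I_p.+2 := widen_ord (leqnSn p.+1) ord_max; pose iq : 'I_p.+2 := ord_max.
have key g : D2 c g = y 0 ip * D2 a g + y 0 iq * D2 b g.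
  have ee : p.+2 = (size r + (size [:: g]).+1)%N by rewrite /= sr; lia.
  have [K hK] := detn_lin ee.
  rewrite /D2 hK.
  have -> : \sum_(j < p.+2) c j * K j = \sum_(i < p.+2) y 0 i * D2 (rnth (r ++ [:: a; b]) i) g.
    transitivity (\sum_(j < p.+2) \sum_(i < p.+2) y 0 i * M i j * K j).
      apply: eq_bigr => j _; have /rowP/(_ j) := ey; rewrite [RHS]mxE => <-.
      by rewrite mxE big_distrl.
    rewrite exchange_big /=; apply: eq_bigr => i _; rewrite /D2 hK big_distrr /=.
    by apply: eq_bigr => j _; rewrite [M _ _]mxE mulrA.
  rewrite !big_ord_recr /= big1 => [|i _].
    have n1 : nth (fun=> 0) (r ++ [:: a; b]) p = a by rewrite nth_cat sr ltnn subnn.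
    have n2 : nth (fun=> 0) (r ++ [:: a; b]) p.+1 = b.
      by rewrite nth_cat sr ltnNge leqnSn /= subSnn.
    by rewrite add0r; congr (_ * D2 _ _ + _ * D2 _ _); [exact: n1|exact: n2].
  have -> : rnth (r ++ [:: a; b]) i = rnth r i by rewrite /rnth nth_cat sr ltn_ord.
  by rewrite D2_r // mulr0.
have e1 := key b; have e2 := key a.
rewrite D2_id mulr0 addr0 in e1; rewrite D2_id mulr0 add0r in e2.
rewrite (key d) [D2 a c]D2_asym e2 [D2 b c]D2_asym e1 [D2 b a]D2_asym; ring.
Qed.

Lemma D2_ecol k f : (k < p.+2)%N ->
  D2 (ecol k) f = (-1) ^+ (p + k) * detn p.+1 (rcons [seq (fun b => g (bump k b)) | g <- r] (fun b => f (bump k b))).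
Proof.
move=> kp; have p1 : (p < p.+2)%N by lia.
pose ip : 'I_p.+2 := Ordinal p1; pose ik : 'I_p.+2 := Ordinal kp.
rewrite /D2 /detn (expand_det_row _ ip) (bigD1 ik) //= big1 => [|b bk]; last first.
  rewrite !mxE /rnth nth_cat sr ltnn subnn /= /ecol.
  by move: bk; rewrite -(inj_eq val_inj) /= => /negbTE ->; rewrite mul0r.
rewrite addr0 !mxE /rnth nth_cat sr ltnn subnn /= /ecol eqxx mul1r /cofactor /=.
congr (_ * \det _); apply/matrixP => a b; rewrite !mxE /rnth nth_cat nth_rcons size_map sr /=.
rewrite /bump; have := ltn_ord a; rewrite ltnS leq_eqVlt => /orP[/eqP e|lt].
  by rewrite e leqnn ltnn eqxx add1n ltnNge leqnSn /= subSnn.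
by rewrite [(p <= a)%N]leqNgt lt /= add0n lt (nth_map (fun=> 0)) // sr.
Qed.
End TwoRows.
End RowDeterminants.

(** * Incidence numbers of simplices with cones *)

Section Incidence.
Variables (R : realType) (n : nat) (m : 'I_n -> 'I_n -> nat).
Hypothesis hm : coxeter_matrix m.
Variable th : key n -> R.
Hypothesis th0 : forall k, 0 < th k.
Hypothesis thg : generic m th.
Variable J : {set 'I_n}.
Implicit Types (w : word n) (s t : 'I_n) (ks : seq (key n)) (rho : seq 'I_n).
Local Notation act := (act (gx R m)).
Local Notation alpha := (@alpha n R).
Local Notation ev := (ev m th).
Notation "u ~ v" := (cox_eq m u v) (at level 70).

Definition key0 : key n := ([::], None).
Definition rowf ks w s : nat -> R := fun b => ev (nth key0 ks b) (act w (alpha s)).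
Definition rws ks w rho := [seq rowf ks w s | s <- rho].
(** Cramer's rule for the point of the simplex at which the roots of rho vanish: up to a common
    factor, the extra row [ecol l] yields its barycentric coordinate l, and the extra row of s
    yields the value of the root of s there. *)
Definition fam q ks w (t : ('I_q + 'I_n)%type) : nat -> R :=
  match t with inl l => ecol R l | inr s => rowf ks w s end.
Definition fpred q rho (t : ('I_q + 'I_n)%type) : bool :=
  match t with inl l => true | inr s => (s \in J) && (s \notin rho) end.
(* The intersection number (1, -1 or 0) of the simplex with vertices the points of [ks] and
   the face [s = 0 (s in rho), s > 0 (s in J, s not in rho)] of the J-chamber of [w]. *)
Definition Icp p ks w rho : R :=
  sg (@fpred p.+1 rho) (fun t : ('I_p.+1 + 'I_n)%type => detn p.+1 (rcons (rws ks w rho) (fam ks w t))).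
Definition Ic ks w rho := Icp (size rho) ks w rho.

Definition remk k ks := take k ks ++ drop k.+1 ks.

Lemma size_remk k ks : (k < size ks)%N -> size (remk k ks) = (size ks).-1.
Proof. by move=> h; rewrite size_cat size_take size_drop h; lia. Qed.

Lemma nth_remk k ks b : (k < size ks)%N -> nth key0 (remk k ks) b = nth key0 ks (bump k b).
Proof.
move=> h; rewrite nth_cat size_take h /bump; case: ltnP => hb; first by rewrite nth_take.
by rewrite nth_drop add1n addSn subnKC.
Qed.

Lemma uniq_remk k ks : uniq ks -> uniq (remk k ks).
Proof.
move=> u; apply: subseq_uniq u; rewrite -{2}(cat_take_drop k ks); apply: cat_subseq => //.
by rewrite -addn1 addnC -drop_drop; apply: drop_subseq.
Qed.

Lemma rws_ne0 p ks w rho : uniq ks -> uniq rho -> size ks = p -> size rho = p ->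
  detn p (rws ks w rho) != 0.
Proof.
move=> uk ur sk sr; case: p sk sr => [|p] sk sr; first by rewrite /detn det_mx00 oner_eq0.
have [s0 _] : exists s0 : 'I_n, True by case: rho sr {ur} => // s0; exists s0.
have -> : detn p.+1 (rws ks w rho) =
    \det (evmx m th (fun b : 'I_p.+1 => nth key0 ks b) (fun a : 'I_p.+1 => nth s0 rho a) w).
  by congr (\det _); apply/matrixP => a b; rewrite !mxE /rnth (nth_map s0) ?sr.
apply: thg => a b /eqP; rewrite nth_uniq ?sk ?sr ?ltn_ord // => /eqP; exact: val_inj.
Qed.

Lemma map_bump_rws k ks w rho : (k < size ks)%N ->
  [seq (fun b => g (bump k b)) | g <- rws ks w rho] = rws (remk k ks) w rho.
Proof.
move=> h; rewrite -map_comp; apply: eq_map => s; apply/funext => b /=.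
by rewrite /rowf nth_remk.
Qed.

Lemma rowf_bump k ks w s : (k < size ks)%N ->
  (fun b => rowf ks w s (bump k b)) = rowf (remk k ks) w s.
Proof. by move=> h; apply/funext => b; rewrite /rowf nth_remk. Qed.

Lemma ecol_bump k l : (fun b => ecol R (bump k l) (bump k b)) = ecol R l.
Proof. by apply/funext => b; rewrite /ecol (inj_eq (can_inj (bumpK k))). Qed.

Section Identity.
Variables (p : nat) (ks : seq (key n)) (w : word n) (rho : seq 'I_n).
Hypothesis uk : uniq ks.
Hypothesis ur : uniq rho.
Hypothesis sk : size ks = p.+2.
Hypothesis sr : size rho = p.
Let r := rws ks w rho.
Let sizer : size r = p. Proof. by rewrite size_map. Qed.
Let D (t t' : ('I_p.+2 + 'I_n)%type) := D2 p r (fam ks w t) (fam ks w t').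
Let P := @fpred p.+2 rho.

Let Dkl k l : k != l -> D (inl k) (inl l) != 0.
Proof.
move=> kl; rewrite /D /= D2_ecol // mulf_neq0 ?signr_eq0 //.
have [l' el] : exists l', l = lift k l' by case: (unliftP k l) kl => [l' -> _|->]; rewrite ?eqxx //; exists l'.
rewrite el /= ecol_bump map_bump_rws ?sk //.
rewrite detn_ecol ?size_map //.
rewrite mulf_neq0 ?signr_eq0 // map_bump_rws ?size_remk ?sk //.
apply: rws_ne0 => //; first by apply: uniq_remk; apply: uniq_remk.
by rewrite size_remk size_remk ?sk //; exact: (ltn_ord l').
Qed.

Let Dks k s : s \notin rho -> D (inl k) (inr s) != 0.
Proof.
move=> sr'; rewrite /D /= D2_ecol // mulf_neq0 ?signr_eq0 //.
rewrite map_bump_rws ?sk // rowf_bump ?sk // -map_rcons.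
apply: rws_ne0; rewrite ?uniq_remk ?size_remk ?sk ?size_rcons ?sr //.
by rewrite rcons_uniq sr'.
Qed.

Let Dss s t : s \notin rho -> t \notin rho -> s != t -> D (inr s) (inr t) != 0.
Proof.
move=> hs ht st; rewrite /D /= /D2 /r /rws.
have -> : map (rowf ks w) rho ++ [:: rowf ks w s; rowf ks w t] = rws ks w (rho ++ [:: s; t]).
  by rewrite /rws map_cat.
apply: rws_ne0 => //; last by rewrite size_cat sr addn2.
rewrite cat_uniq ur /= inE negb_or st /= !orbF andbT.
by rewrite !(negbTE hs, negbTE ht).
Qed.

(** In a simplex of dimension p + 1 the p equations of rho cut out, within the chamber, a segment or
    nothing. Each end lies on a facet of the simplex or on one further wall, and the two ends count
    with opposite signs. The algebraic form of this is [sum_sg_plane] for [D2]. *)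
Lemma incidence_identity :
  (-1) ^+ p * (\sum_(k < p.+2) (-1) ^+ k * Ic (remk k ks) w rho) +
  \sum_(s | (s \in J) && (s \notin rho)) Ic ks w (rcons rho s) = 0.
Proof.
have Dn0 a b : P a -> P b -> a != b -> D a b != 0.
  case: a => [k|s]; case: b => [l|t] //= => Pa Pb ab.
  - by apply: Dkl; apply: contraNneq ab => ->.
  - by apply: Dks; case/andP: Pb.
  - by rewrite /D D2_asym // oppr_eq0; apply: Dks; case/andP: Pa.
  - by apply: Dss; [case/andP: Pa|case/andP: Pb|apply: contraNneq ab => ->].
have := @sum_sg_plane R _ P D _ Dn0 _ _.
rewrite big_sumType /= big_distrr /= => H; rewrite -[RHS]H.
- congr (_ + _); [apply: eq_bigr => k _|apply: eq_bigr => s /andP[sJ hs]].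
    rewrite mulrA -exprD /Ic sr.
    rewrite -(@sgM _ _ _ _ (inl ord0)) //; apply: sg_corr => [[l|s]|[l|s]] /=.
    + move=> _; exists (inl (lift k l)); first by rewrite /= (inj_eq inl_inj) eq_sym neq_lift.
      by rewrite /D /= D2_ecol // ecol_bump map_bump_rws ?sk.
    + move=> hs; exists (inr s) => //=; first by rewrite andbT.
      by rewrite /D /= D2_ecol // rowf_bump ?sk // map_bump_rws ?sk.
    + rewrite (inj_eq inl_inj) => lk.
      have [l' el] : exists l', l = lift k l' by case: (unliftP k l) lk => [l' -> _|->]; rewrite ?eqxx //; exists l'.
      by exists (inl l') => //; rewrite /D el /= D2_ecol // ecol_bump map_bump_rws ?sk.
    + rewrite andbT => hs; exists (inr s) => //.
      by rewrite /D /= D2_ecol // rowf_bump ?sk // map_bump_rws ?sk.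
  have E f : rcons (rws ks w (rcons rho s)) f = r ++ [:: rowf ks w s; f].
    by rewrite /r /rws map_rcons -!cats1 -catA.
  rewrite /Ic size_rcons sr /Icp.
  apply: sg_corr => [[l|t]|[l|t]] /=.
  + by move=> _; exists (inl l) => //=; rewrite E.
  + rewrite mem_rcons inE negb_or => /and3P[h1 h2 h3]; exists (inr t); last by rewrite E.
    by rewrite /= h1 h3 /= (inj_eq inr_inj).
  + by move=> _; exists (inl l) => //; rewrite E.
  + rewrite (inj_eq inr_inj) => /andP[/andP[h1 h2] h3]; exists (inr t); last by rewrite E.
    by rewrite /= mem_rcons inE negb_or h1 h2 h3.
- by move=> a b _ _; apply: D2_asym.
- by move=> a b c d Pa Pb Pc Pd ab; apply: D2_plucker => //; apply: Dn0.
- move=> j Pj; have [e|e] := eqVneq j (inl ord0).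
    by exists (inl ord_max) => //; rewrite e (inj_eq inl_inj) -(inj_eq val_inj).
  by exists (inl ord0) => //; rewrite eq_sym.
Qed.
End Identity.

Lemma Ic_abs ks w rho : `|Ic ks w rho| <= 1. Proof. exact: sg_abs. Qed.

Lemma Ic_move ks w A s B : Ic ks w (rcons (A ++ B) s) = (-1) ^+ size B * Ic ks w (A ++ s :: B).
Proof.
have K f : detn (size A + size B).+2 (rcons (rws ks w (rcons (A ++ B) s)) f) =
    (-1) ^+ size B * detn (size A + size B).+2 (rcons (rws ks w (A ++ s :: B)) f).
  rewrite /rws map_rcons !map_cat map_cons -!cats1 -!catA /=.
  rewrite (@detn_move _ _ (rowf ks w s)); last by rewrite !size_map /=; lia.
  by rewrite size_map mulrA -exprD addnn -signr_odd odd_double expr0 mul1r.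
rewrite /Ic size_rcons !size_cat /= addnS.
rewrite /Icp -(@sgM _ _ _ _ (inl ord0)) //; apply: sg_corr => t ht; exists t; rewrite ?K //.
- by case: t ht => //= t /andP[-> /=]; rewrite mem_rcons inE !mem_cat !inE orbCA.
- by case: t ht => //= t /andP[-> /=]; rewrite mem_rcons inE !mem_cat !inE orbCA.
Qed.

Lemma Ic_eq ks w w' rho : w ~ w' -> Ic ks w rho = Ic ks w' rho.
Proof.
move=> h; have e s : rowf ks w s = rowf ks w' s.
  by apply/funext => b; rewrite /rowf (gact_eq hm _ h).
have er : rws ks w rho = rws ks w' rho by apply: eq_map.
rewrite /Ic /Icp er; congr sg; apply/funext => -[l|s] //=; by rewrite e.
Qed.

Lemma rowf_step ks w s t b :
  rowf ks (w ++ [:: t]) s b = rowf ks w s b - cartan (gx R m) t s * rowf ks w t b.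
Proof. by rewrite /rowf act_cat act1 co_alpha actB actZ -scaleNr evD evZ mulNr. Qed.

(** The reflection fixes the face pointwise and reverses its coorientation: a row operation of
    determinant -1. *)
Lemma Ic_step ks w rho t : t \in rho -> Ic ks (w ++ [:: t]) rho = - Ic ks w rho.
Proof.
move=> tr; rewrite /Ic /Icp -(@sgN _ _ _ _ (inl ord0)) //; congr sg; apply/funext => T.
set p := size rho; have ip : (index t rho < p)%N by rewrite index_mem.
pose u a : R := if (a < p)%N then cartan (gx R m) t (nth t rho a) else
  if T is inr s then cartan (gx R m) t s else 0.
apply: (@detn_reflect _ _ _ _ (index t rho) u); first by apply: ltnW.
  by rewrite /u ip nth_index // cartan_id.
move=> a b ap bp; rewrite /rnth !nth_rcons !size_map -/p ip.
have -> : nth (fun=> 0) (rws ks w rho) (index t rho) = rowf ks w t.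
  by rewrite (nth_map t) // nth_index.
rewrite /u; case: ltnP => // lt.
  by rewrite !(nth_map t) // rowf_step.
have -> : a == p by rewrite eqn_leq lt andbT -ltnS.
by case: T {u} => [l|s] /=; rewrite ?mul0r ?subr0 // rowf_step.
Qed.

(** The positive numbers are unnormalised barycentric coordinates of the intersection point. *)
Lemma Ic_neq0 ks w rho : Ic ks w rho != 0 ->
  exists c : nat -> R, [/\ forall l, (l < (size rho).+1)%N -> 0 < c l,
    forall s, s \in rho -> \sum_(l < (size rho).+1) c l * rowf ks w s l = 0 &
    forall s, s \in J -> s \notin rho -> 0 < \sum_(l < (size rho).+1) c l * rowf ks w s l].
Proof.
move=> /sg_neq0 [d d0 h]; set p := size rho in h *.
have ep : p.+1 = (size (rws ks w rho) + (size ([::] : seq (nat -> R))).+1)%N by rewrite size_map /= addn1.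
have [K hK] := detn_lin ep.
have E f : detn p.+1 (rcons (rws ks w rho) f) = \sum_(b < p.+1) f b * K b by rewrite -cats1 hK.
have e s : \sum_(l < p.+1) d * K l * rowf ks w s l = d * detn p.+1 (rcons (rws ks w rho) (rowf ks w s)).
  by rewrite E big_distrr; apply: eq_bigr => l _ /=; ring.
exists (fun l => d * K l); split.
- move=> l lp; have := h (inl (Ordinal lp)) isT; rewrite /= E (bigD1 (Ordinal lp)) //= big1.
    by rewrite /ecol eqxx mul1r addr0.
  by move=> b bl; rewrite /ecol; move: bl; rewrite -(inj_eq val_inj) /= => /negbTE ->; rewrite mul0r.
- move=> s sr; rewrite e (@detn_row _ _ (rws ks w rho)) ?mulr0 ?size_map //.
  exists (index s rho); rewrite ?index_mem // => b _.
  by rewrite /rnth (nth_map s) ?index_mem // nth_index.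
- by move=> s sJ sr; rewrite e; apply: (h (inr s)); rewrite /= sJ.
Qed.

Lemma ev_chamber k s : 0 < ev k (act k.1 (alpha s)).
Proof.
rewrite evE gact_rev // (bigD1 s) //= big1 => [|i si].
  by rewrite addr0 mxE !eqxx mul1r exprn_gt0.
by rewrite mxE (negbTE si) andbF mul0r.
Qed.

Lemma ev_pos k z : z != 0 -> nonneg (act (rev k.1) z) -> 0 < ev k z.
Proof.
move=> z0 h; rewrite evE.
have [i hi] : exists i, act (rev k.1) z 0 i != 0.
  apply: contrapT => H; move/eqP: z0; apply.
  rewrite -(gact_revK hm k.1 z) -[RHS](act0 (gx R m) k.1); congr act.
  apply/rowP => i; rewrite [RHS]mxE; apply/eqP/negPn/negP => hi; apply: H; by exists i.
rewrite (bigD1 i) //=; apply: ltr_pwDl; first by rewrite mulr_gt0 ?exprn_gt0 // lt0r hi h.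
by apply: sumr_ge0 => j _; rewrite mulr_ge0 // exprn_ge0 // ltW.
Qed.

Lemma Ic0 k w : w ~ k.1 -> Ic [:: k] w [::] = 1.
Proof.
move=> h; rewrite /Ic /= /Icp /sg; case: forallP => // H; exfalso; apply: H => t.
apply/implyP => _; rewrite /detn det_mx11 mxE /rnth /=; case: t => [l|s] /=.
  by rewrite /ecol ord1 ltr01.
by rewrite /rowf /= (gact_eq hm _ h) ev_chamber.
Qed.
End Incidence.

(** * Unordered sums *)

Section Sums.
Variable R : realType.
Implicit Types (T : choiceType).
Local Open Scope ereal_scope.

Lemma esum_le_inj T T' (P : set T) (Q : set T') (e : T -> T') (F : T -> \bar R) (G : T' -> \bar R) :
  set_inj P e -> (forall i, P i -> Q (e i)) -> (forall j, Q j -> 0 <= G j) ->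
  (forall i, P i -> F i <= G (e i)) -> \esum_(i in P) F i <= \esum_(j in Q) G j.
Proof.
move=> inj sub G0 le; apply: (@le_trans _ _ (\esum_(i in P) G (e i))); first exact: le_esum.
rewrite -(esum_image P e G inj) esum_mkcond [leRHS]esum_mkcond.
apply: le_esum => j _; have [h|h] := pselect ((e @` P) j).
  have Qj : Q j by case: h => i Pi <-; apply: sub.
  by rewrite !mem_set.
by rewrite (memNset h); case: ifP => // /set_mem /G0.
Qed.

Lemma esum_sub T (P Q : set T) (F : T -> \bar R) : P `<=` Q -> (forall j, Q j -> 0 <= F j) ->
  \esum_(i in P) F i <= \esum_(j in Q) F j.
Proof. by move=> sPQ F0; apply: (@esum_le_inj _ _ P Q id F F). Qed.

Lemma esum_le_seq T (D : set T) (f : T -> R) (C : R) : (forall x, D x -> (0 <= f x)%R) ->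
  (forall l : seq T, uniq l -> (forall x, x \in l -> D x) -> (\sum_(x <- l) f x <= C)%R) ->
  \esum_(x in D) (f x)%:E <= C%:E.
Proof.
move=> f0 h; apply: ge_ereal_sup => _ [A [finA AD] <-].
rewrite fsbig_finite //= sumEFin lee_fin; apply: h; first exact: fset_uniq.
by move=> x; rewrite in_fset_set // => /set_mem /AD.
Qed.

Lemma esum_seq_le T (D : set T) (f : T -> R) (C : R) : (forall x, D x -> (0 <= f x)%R) ->
  \esum_(x in D) (f x)%:E <= C%:E ->
  forall l : seq T, uniq l -> (forall x, x \in l -> D x) -> (\sum_(x <- l) f x <= C)%R.
Proof.
move=> f0 h l ul hl; rewrite -lee_fin; apply: le_trans h; apply: esum_ge.
exists [set` l]; first by split=> //; exact: finite_set_seq.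
by rewrite -sumEFin fsbig_seq.
Qed.

Lemma esumZ_le T (D : set T) (f : T -> R) (c : R) : (0 <= c)%R -> (forall x, D x -> (0 <= f x)%R) ->
  \esum_(x in D) (c * f x)%:E <= c%:E * \esum_(x in D) (f x)%:E.
Proof.
move=> c0 f0; apply: ge_ereal_sup => _ [A [finA AD] <-].
have A0 x : x \in fset_set A -> (0 <= f x)%R by rewrite in_fset_set // => /set_mem /AD /f0.
rewrite fsbig_finite //=.
have -> : \sum_(i <- fset_set A) (c * f i)%:E = c%:E * \sum_(i <- fset_set A) (f i)%:E.
  by rewrite !sumEFin -EFinM big_distrr.
apply: lee_wpmul2l; first by rewrite lee_fin.
by apply: esum_ge; exists A => //; rewrite fsbig_finite.
Qed.

Lemma esum_cover T (I : eqType) (l : seq I) (D : set T) (X : I -> set T) (F : T -> \bar R) :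
  (forall x, D x -> exists2 i, i \in l & X i x) -> (forall x, 0 <= F x) ->
  \esum_(x in D) F x <= \sum_(i <- l) \esum_(x in X i) F x.
Proof.
move=> h F0; elim: l D h => [|i l IH] D h.
  rewrite big_nil (_ : D = set0) ?esum_set0 // -subset0 => x /h [? //].
rewrite big_cons.
apply: (@le_trans _ _ (\esum_(x in D) ((if x \in X i then F x else 0) + (if x \in X i then 0 else F x)))).
  by apply: le_esum => x _; case: ifP; rewrite ?adde0 ?add0e.
rewrite esumD; [|by move=> x _; case: ifP|by move=> x _; case: ifP].
apply: leeD.
  by rewrite [leRHS]esum_mkcond esum_mkcond; apply: le_esum => x _; case: ifP => // _; case: ifP.
rewrite (_ : \esum_(x in D) _ = \esum_(x in D `&` ~` X i) F x).
  apply: IH => x [/h [j]]; rewrite inE => /orP[/eqP -> //|jl hj _]; by exists j.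
rewrite esum_mkcondr; apply: eq_esum => x _; rewrite in_setC; by case: ifP.
Qed.

Lemma esum_exchange T T' (P : set T) (Q : set T') (a : T -> T' -> \bar R) :
  (forall i j, 0 <= a i j) ->
  \esum_(i in P) \esum_(j in Q) a i j = \esum_(j in Q) \esum_(i in P) a i j.
Proof.
move=> a0; rewrite (esum_esum (J := fun=> Q)) // (esum_esum (J := fun=> P) (a := fun j i => a i j)) //.
rewrite (reindex_esum (P `*`` fun=> Q) (Q `*`` fun=> P) (fun k => (k.2, k.1))) //.
split=> [[i j] /= []//|[i j] [i' j'] _ _ /= [-> ->] //|[j i] [/= Qj Pi]].
by exists (i, j).
Qed.

(** A signed unordered sum. As [fine] sends +oo to 0, the value is meaningful under [asummable];
    rules that only swap or permute the two parts, such as [rsum_sign] and [rsum_anti], hold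
    regardless. *)
Definition rsum T (D : set T) (f : T -> R) : R :=
  (fine (\esum_(x in D) (Num.max (f x) 0)%:E) - fine (\esum_(x in D) (Num.max (- f x) 0)%:E))%R.
Definition asummable T (D : set T) (f : T -> R) := \esum_(x in D) `|f x|%:E < +oo.

Lemma esum_fin T (D : set T) (f : T -> R) : (forall x, D x -> (0 <= f x)%R) ->
  \esum_(x in D) (f x)%:E < +oo -> \esum_(x in D) (f x)%:E = (fine (\esum_(x in D) (f x)%:E))%:E.
Proof. by move=> f0 h; rewrite fineK // ge0_fin_numE // esum_ge0. Qed.

Lemma asummable_le T (D : set T) (f g : T -> R) :
  (forall x, D x -> (`|f x| <= `|g x|)%R) -> asummable D g -> asummable D f.
Proof. by move=> h; apply: le_lt_trans; apply: le_esum => x Dx; rewrite lee_fin h. Qed.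

Lemma asummableD T (D : set T) (f g : T -> R) :
  asummable D f -> asummable D g -> asummable D (fun x => (f x + g x)%R).
Proof.
move=> hf hg; apply: (@le_lt_trans _ _ (\esum_(x in D) (`|f x|%:E + `|g x|%:E))).
  by apply: le_esum => x _; rewrite -EFinD lee_fin ler_normD.
by rewrite esumD // lte_add_pinfty.
Qed.

Lemma asummableZ T (D : set T) (f : T -> R) c : asummable D f -> asummable D (fun x => (c * f x)%R).
Proof.
move=> hf; apply: (@le_lt_trans _ _ (`|c|%:E * \esum_(x in D) `|f x|%:E)).
  by under eq_esum do rewrite normrM; apply: esumZ_le.
by rewrite esum_fin // -EFinM ltry.
Qed.

Lemma asummable_sum T (D : set T) (I : Type) (l : seq I) (P : pred I) (F : I -> T -> R) :
  (forall i, P i -> asummable D (F i)) -> asummable D (fun x => (\sum_(i <- l | P i) F i x)%R).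
Proof.
move=> h; elim: l => [|i l IH].
  by rewrite /asummable esum1 // => x _; rewrite big_nil normr0.
case: (boolP (P i)) => Pi.
  rewrite (_ : (fun x => _) = (fun x => (F i x + \sum_(j <- l | P j) F j x)%R)); last first.
    by apply/funext => x; rewrite big_cons Pi.
  by apply: asummableD => //; apply: h.
by rewrite (_ : (fun x => _) = (fun x => (\sum_(j <- l | P j) F j x)%R)) //; apply/funext => x; rewrite big_cons (negbTE Pi).
Qed.

(** Any splitting into summable nonnegative parts gives the same value as the canonical one;
    additivity is reduced to this. *)
Lemma rsum_diff T (D : set T) (f g h : T -> R) :
  (forall x, D x -> (0 <= g x)%R) -> (forall x, D x -> (0 <= h x)%R) ->
  asummable D g -> asummable D h -> (forall x, D x -> f x = g x - h x)%R ->
  rsum D f = (fine (\esum_(x in D) (g x)%:E) - fine (\esum_(x in D) (h x)%:E))%R.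
Proof.
move=> g0 h0 sg sh e.
have ng x : D x -> (`|g x| = g x)%R by move=> /g0; exact: ger0_norm.
have nh x : D x -> (`|h x| = h x)%R by move=> /h0; exact: ger0_norm.
have sg' : \esum_(x in D) (g x)%:E < +oo.
  by move: sg; rewrite /asummable; under eq_esum do rewrite ng //.
have sh' : \esum_(x in D) (h x)%:E < +oo.
  by move: sh; rewrite /asummable; under eq_esum do rewrite nh //.
have sp : \esum_(x in D) (Num.max (f x) 0)%:E < +oo.
  apply: le_lt_trans sg'; apply: le_esum => x Dx; rewrite lee_fin ge_max g0 // andbT e //.
  by rewrite gerBl h0.
have sn : \esum_(x in D) (Num.max (- f x) 0)%:E < +oo.
  apply: le_lt_trans sh'; apply: le_esum => x Dx; rewrite lee_fin ge_max h0 // andbT e //.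
  by rewrite opprB gerBl g0.
have p0 x : D x -> (0 <= Num.max (f x) 0)%R by move=> _; rewrite le_max lexx orbT.
have n0 x : D x -> (0 <= Num.max (- f x) 0)%R by move=> _; rewrite le_max lexx orbT.
have : \esum_(x in D) ((Num.max (f x) 0)%:E + (h x)%:E) = \esum_(x in D) ((Num.max (- f x) 0)%:E + (g x)%:E).
  apply: eq_esum => x Dx; rewrite -!EFinD e //; congr EFin.
  by rewrite opprB /Num.max !subr_lt0; case: ltgtP; move=> *; lra.
rewrite !esumD //; try (by move=> x Dx; rewrite lee_fin; auto).
rewrite (esum_fin p0 sp) (esum_fin h0 sh') (esum_fin n0 sn) (esum_fin g0 sg') /= -!EFinD => -[].
rewrite /rsum /=; lra.
Qed.

Lemma rsumD T (D : set T) (f g : T -> R) : asummable D f -> asummable D g ->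
  rsum D (fun x => f x + g x)%R = (rsum D f + rsum D g)%R.
Proof.
have mp (u : R) : (0 <= Num.max u 0)%R by rewrite le_max lexx orbT.
have ml (u : R) : (Num.max u 0 <= `|u|)%R by rewrite ge_max normr_ge0 ler_norm.
have mlN (u : R) : (Num.max (- u) 0 <= `|u|)%R by rewrite ge_max normr_ge0 -normrN ler_norm.
have me (u : R) : (u = Num.max u 0 - Num.max (- u) 0)%R.
  by rewrite /Num.max oppr_lt0; case: ltgtP => h; lra.
move=> sf sg.
have s1 u : asummable D u -> asummable D (fun x => Num.max (u x) 0)%R.
  by apply: asummable_le => x _; rewrite ger0_norm.
have s2 u : asummable D u -> asummable D (fun x => Num.max (- u x) 0)%R.
  by apply: asummable_le => x _; rewrite ger0_norm.
rewrite (@rsum_diff _ D _ (fun x => Num.max (f x) 0 + Num.max (g x) 0)%R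
   (fun x => Num.max (- f x) 0 + Num.max (- g x) 0)%R); first last.
- by move=> x _; rewrite [in LHS](me (f x)) [in LHS](me (g x)); lra.
- by apply: asummableD; apply: s2.
- by apply: asummableD; apply: s1.
- by move=> x _; rewrite addr_ge0.
- by move=> x _; rewrite addr_ge0.
have fn u : asummable D u -> \esum_(x in D) (Num.max (u x) 0)%:E \is a fin_num.
  move=> su; rewrite ge0_fin_numE ?esum_ge0 // => [|x _]; last by rewrite lee_fin.
  by apply: le_lt_trans su; apply: le_esum => x _; rewrite lee_fin.
have fn' u : asummable D u -> \esum_(x in D) (Num.max (- u x) 0)%:E \is a fin_num.
  move=> su; rewrite ge0_fin_numE ?esum_ge0 // => [|x _]; last by rewrite lee_fin.
  by apply: le_lt_trans su; apply: le_esum => x _; rewrite lee_fin.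
under eq_esum do rewrite EFinD.
under [in X in (_ - X)%R]eq_esum do rewrite EFinD.
rewrite !esumD; try (by move=> x _; rewrite lee_fin).
rewrite !fineD; try (by apply: fn); try (by apply: fn').
rewrite /rsum; lra.
Qed.

Lemma eq_rsum T (D : set T) (f g : T -> R) : (forall x, D x -> f x = g x) -> rsum D f = rsum D g.
Proof. by move=> h; rewrite /rsum; congr (fine _ - fine _)%R; apply: eq_esum => x Dx; rewrite h. Qed.

Lemma rsum0 T (D : set T) (f : T -> R) : (forall x, D x -> f x = 0%R) -> rsum D f = 0%R.
Proof.
move=> h; rewrite /rsum !esum1 ?subrr // => x /h ->; by rewrite ?oppr0 maxxx.
Qed.

Lemma rsumN T (D : set T) (f : T -> R) : rsum D (fun x => - f x)%R = (- rsum D f)%R.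
Proof. by rewrite /rsum opprB; under [in X in (_ - X)%R]eq_esum do rewrite opprK. Qed.

Lemma rsum_sum T (D : set T) (I : Type) (l : seq I) (P : pred I) (F : I -> T -> R) :
  (forall i, P i -> asummable D (F i)) ->
  rsum D (fun x => \sum_(i <- l | P i) F i x)%R = (\sum_(i <- l | P i) rsum D (F i))%R.
Proof.
move=> h; elim: l => [|i l IH].
  by rewrite big_nil; apply: rsum0 => x _; rewrite big_nil.
rewrite big_cons; case: (boolP (P i)) => Pi.
  rewrite -IH -rsumD; [|exact: h|exact: asummable_sum].
  by apply: eq_rsum => x _; rewrite big_cons Pi.
by rewrite -IH; apply: eq_rsum => x _; rewrite big_cons (negbTE Pi).
Qed.

Lemma rsum_sign T (D : set T) (f : T -> R) k :
  rsum D (fun x => (-1) ^+ k * f x)%R = ((-1) ^+ k * rsum D f)%R.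
Proof.
elim: k => [|k IH]; first by rewrite expr0 mul1r; apply: eq_rsum => x _; rewrite mul1r.
rewrite exprS mulN1r mulNr -IH -rsumN; apply: eq_rsum => x _; by rewrite ?exprS ?mulN1r ?mulNr.
Qed.

Lemma rsumZ T (D : set T) (f : T -> R) c : asummable D f ->
  rsum D (fun x => c * f x)%R = (c * rsum D f)%R.
Proof.
move=> sf.
have pos (d : R) (g : T -> R) : (0 <= d)%R -> (forall x, 0 <= g x)%R -> asummable D g ->
    fine (\esum_(x in D) (d * g x)%:E) = (d * fine (\esum_(x in D) (g x)%:E))%R.
  move=> d0 g0 sg; have sg' : \esum_(x in D) (g x)%:E < +oo.
    by move: sg; rewrite /asummable; under eq_esum do rewrite ger0_norm //.
  have sdg : \esum_(x in D) (d * g x)%:E < +oo.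
    by apply: (le_lt_trans (esumZ_le _ _)) => //; rewrite esum_fin // -EFinM ltry.
  have [->|dn0] := eqVneq d 0%R; first by rewrite mul0r esum1 // => x _; rewrite mul0r.
  apply/eqP; rewrite eq_le; apply/andP; split.
    rewrite -lee_fin EFinM -!esum_fin //; try (by move=> x _; rewrite ?mulr_ge0).
    exact: esumZ_le.
  have dp : (0 < d)%R by rewrite lt0r dn0.
  rewrite -ler_pdivlMl // -lee_fin EFinM -!esum_fin //; try (by move=> x _; rewrite ?mulr_ge0).
  have -> : \esum_(x in D) (g x)%:E = \esum_(x in D) (d^-1 * (d * g x))%:E.
    by apply: eq_esum => x _; rewrite mulKf.
  by apply: esumZ_le; rewrite ?invr_ge0 // => x _; rewrite mulr_ge0.
have mp (u : R) : (0 <= Num.max u 0)%R by rewrite le_max lexx orbT.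
have s1 : asummable D (fun x => Num.max (f x) 0)%R.
  by apply: asummable_le sf => x _; rewrite ger0_norm // ge_max normr_ge0 ler_norm.
have s2 : asummable D (fun x => Num.max (- f x) 0)%R.
  by apply: asummable_le sf => x _; rewrite ger0_norm // ge_max normr_ge0 -normrN ler_norm.
have P (d : R) : (0 <= d)%R -> rsum D (fun x => d * f x)%R = (d * rsum D f)%R.
  move=> d0; rewrite /rsum mulrBr -!pos //; congr (fine _ - fine _)%R; apply: eq_esum => x _.
    by rewrite maxr_pMr // mulr0.
  by rewrite maxr_pMr // mulr0 mulrN.
have [c0|c0] := leP 0%R c; first exact: P.
rewrite -[c]opprK mulNr -P ?oppr_ge0 ?ltW // -rsumN; apply: eq_rsum => x _.
by rewrite mulNr.
Qed.

Lemma rsum_anti T (D : set T) (f : T -> R) (e : T -> T) : set_bij D D e ->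
  (forall x, D x -> f (e x) = - f x)%R -> rsum D f = 0%R.
Proof.
move=> be h; rewrite /rsum (reindex_esum D D e _ be); apply/eqP; rewrite subr_eq0; apply/eqP.
by congr fine; apply: eq_esum => x Dx; rewrite h.
Qed.

Lemma rsum_abs T (D : set T) (f : T -> R) : asummable D f ->
  (`|rsum D f|%:E <= \esum_(x in D) `|f x|%:E).
Proof.
move=> sf.
have mp (u : R) : (0 <= Num.max u 0)%R by rewrite le_max lexx orbT.
have l1 : \esum_(x in D) (Num.max (f x) 0)%:E <= \esum_(x in D) `|f x|%:E.
  by apply: le_esum => x _; rewrite lee_fin ge_max normr_ge0 ler_norm.
have l2 : \esum_(x in D) (Num.max (- f x) 0)%:E <= \esum_(x in D) `|f x|%:E.
  by apply: le_esum => x _; rewrite lee_fin ge_max normr_ge0 -normrN ler_norm.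
have n1 : (0 <= fine (\esum_(x in D) (Num.max (f x) 0)%:E))%R by rewrite fine_ge0 // esum_ge0 // => x _; rewrite lee_fin.
have n2 : (0 <= fine (\esum_(x in D) (Num.max (- f x) 0)%:E))%R by rewrite fine_ge0 // esum_ge0 // => x _; rewrite lee_fin.
have eA := esum_fin (fun x (_ : D x) => normr_ge0 (f x)) sf.
have eP := esum_fin (fun x (_ : D x) => mp (f x)) (le_lt_trans l1 sf).
have eN := esum_fin (fun x (_ : D x) => mp (- f x)%R) (le_lt_trans l2 sf).
rewrite eA eP lee_fin in l1; rewrite eA eN lee_fin in l2.
rewrite eA lee_fin /rsum ler_norml; apply/andP; split; lra.
Qed.
End Sums.

(** * Kernel estimates *)

Ltac nonneg_tac := repeat first [assumption
  | match goal with H : forall _, is_true (0 <= _) |- _ => solve [apply: H] end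
  | solve [apply: ltW; assumption] | exact: ler0n | apply: mulr_ge0 | apply: exprn_ge0 ].

Lemma sum_le_inj (R : realType) (T T' : eqType) (l : seq T) (l' : seq T') (e : T -> T')
    (F : T -> R) (G : T' -> R) :
  uniq l -> uniq l' -> {in l &, injective e} -> (forall x, x \in l -> e x \in l') ->
  (forall y, y \in l' -> 0 <= G y) -> (forall x, x \in l -> F x <= G (e x)) ->
  \sum_(x <- l) F x <= \sum_(y <- l') G y.
Proof.
move=> ul ul' inj sub G0 le; apply: (@le_trans _ _ (\sum_(y <- map e l) G y)).
  by rewrite big_map !big_seq; apply: ler_sum.
have u2 : uniq (map e l) by rewrite map_inj_in_uniq.
have sub2 : {subset map e l <= l'} by move=> y /mapP [x xl ->]; apply: sub.
have pe : perm_eq l' (map e l ++ [seq y <- l' | y \notin map e l]).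
  apply: uniq_perm => //.
    rewrite cat_uniq u2 filter_uniq // andbT /=; apply/hasPn => y; by rewrite mem_filter => /andP[].
  move=> y; rewrite mem_cat mem_filter; case: (boolP (y \in map e l)) => //= /sub2 -> //.
rewrite (perm_big _ pe) /= big_cat /= lerDl big_seq sumr_ge0 // => y.
by rewrite mem_filter => /andP[_ /G0].
Qed.

Lemma short_words n L : exists l : seq (word n), forall w, (size w <= L)%N -> w \in l.
Proof.
exists (flatten [seq [seq tval t | t <- enum {: k.-tuple 'I_n}] | k <- iota 0 L.+1]) => w h.
apply/flatten_mapP; exists (size w); first by rewrite mem_iota.
by apply/mapP; exists (in_tuple w) => //; rewrite mem_enum.
Qed.

(** Convexity: on [0, 1] the power lies below its chord. *)
Lemma bernoulli2 (R : realType) N (x : R) : 0 <= x <= 1 -> (1 + x) ^+ N <= 1 + (2 ^+ N - 1) * x.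
Proof.
move=> /andP[x0 x1]; elim: N => [|N IH]; first by rewrite !expr0 subrr mul0r addr0.
rewrite exprS; apply: (@le_trans _ _ ((1 + x) * (1 + (2 ^+ N - 1) * x))).
  by apply: ler_wpM2l => //; lra.
have h : 1 <= 2 ^+ N :> R by rewrite exprn_ege1 //; lra.
have h2 : (2 ^+ N - 1) * (x * x) <= (2 ^+ N - 1) * x.
  by apply: ler_wpM2l; [lra|rewrite ler_piMl].
have -> : (1 + x) * (1 + (2 ^+ N - 1) * x) = 1 + 2 ^+ N * x + (2 ^+ N - 1) * (x * x) by ring.
rewrite exprS; lra.
Qed.

Section Kernel.
Variables (R : realType) (n : nat) (m : 'I_n -> 'I_n -> nat) (q : 'I_n -> R).
Hypothesis hm : coxeter_matrix m.
Hypothesis hq : multiparameter m q.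
Variable J : {set 'I_n}.
Hypothesis hR : in_R m J q.
Implicit Types (u v w x y : word n).
Notation "u ~ v" := (cox_eq m u v) (at level 70).
Local Notation len := (len m).
Local Notation nf := (nf m).
Local Notation qe := (qe m q).

Lemma wtE (C : set (word n)) w0 : C w0 ->
  exists w, [/\ C w, size w = minlen C & wt q C = qword q w].
Proof.
move=> Cw; have [[w h1 h2] _] := minlenP Cw.
have : exists z, [set z : R | exists w, C w /\ size w = minlen C /\ z = qword q w] z.
  by exists (qword q w), w.
by move=> /(@xgetPex _ 0) [w' [a [b c]]]; exists w'; split.
Qed.

Lemma wt_cls u : wt q (cls m u) = qe u.
Proof.
have [w [h1 h2 ->]] := @wtE (cls m u) u (cox_refl m u).
rewrite (qe_eq q h1) (qe_reduced hm hq) // /reduced h2 -/(len u) (len_eq h1) //.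
Qed.

Definition WJ : set (word n) := [set u | Wset m u /\ inW m J u].

Lemma WJ_finite : (\esum_(u in WJ) (qe u)%:E < +oo)%E.
Proof.
apply: le_lt_trans hR.2; apply: (@esum_le_inj _ _ _ _ _ (cls m)).
- move=> u v /set_mem [Wu _] /set_mem [Wv _] e; apply: (Wset_inj Wu Wv).
  have : cls m v v by exact: cox_refl.
  by rewrite -e.
- by move=> u [_ [u' ou e]]; exists u' => //; apply: cls_eq; apply: cox_sym.
- by move=> C [u _ <-]; rewrite wt_cls lee_fin ltW // qe_gt0.
- by move=> u _; rewrite wt_cls.
Qed.

Let A := fine (\esum_(u in WJ) (qe u)%:E)%E.

Lemma WJ_sum l : uniq l -> (forall u, u \in l -> WJ u) -> \sum_(u <- l) qe u <= A.
Proof.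
apply: (@esum_seq_le _ _ WJ qe) => [u _|]; first by rewrite ltW // qe_gt0.
rewrite esum_fin //; [by move=> u _; rewrite ltW // qe_gt0|exact: WJ_finite].
Qed.

(** A finite partial sum within 1/4 of the total leaves at most 1/4 for each longer length. *)
Lemma tail_small : exists2 N, (0 < N)%N & forall l, uniq l ->
  (forall u, u \in l -> WJ u /\ len u = N) -> \sum_(u <- l) qe u <= 4^-1.
Proof.
have [l0 [ul0 hl0 gt]] : exists l, [/\ uniq l, forall u, u \in l -> WJ u & A - 4^-1 < \sum_(u <- l) qe u].
  apply: contrapT => H.
  have : (\esum_(u in WJ) (qe u)%:E <= (A - 4^-1)%:E)%E.
    apply: esum_le_seq => [u _|l ul hl]; first by rewrite ltW // qe_gt0.
    by rewrite leNgt; apply/negP => h; apply: H; exists l.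
  rewrite esum_fin; [|by move=> u _; rewrite ltW // qe_gt0|exact: WJ_finite].
  rewrite lee_fin -/A; lra.
exists (\max_(u <- l0) len u).+1 => // l ul hl.
have := @WJ_sum (l0 ++ l); rewrite big_cat /= => H.
have h : \sum_(i <- l0) qe i + \sum_(i <- l) qe i <= A.
  apply: H => [|u]; last by rewrite mem_cat => /orP[/hl0|/hl[]].
  rewrite cat_uniq ul0 ul andbT /=; apply/hasPn => u /hl [_ e]; apply/negP => /= ul0'.
  have := @leq_bigmax_seq _ l0 xpredT len u ul0' isT; rewrite e; lia.
lra.
Qed.

(** Elements of length at least N factor as a shorter one times one of length N. The latter have
    total weight at most 1/4, or 1/2 after dilation by r, so long elements account for at most half
    of the dilated sum. *)
Lemma margin : exists2 r : R, 1 < r & exists2 C : R, 0 <= C &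
  forall l, uniq l -> (forall u, u \in l -> WJ u) -> \sum_(u <- l) qe u * r ^+ len u <= C.
Proof.
(* This choice of r gives r^N <= 2 by [bernoulli2]. *)
have [N N0 hN] := tail_small; pose r : R := 1 + (2 ^+ N)^-1.
have p2 : 0 < (2 : R) ^+ N by rewrite exprn_gt0.
have p2' : 1 <= (2 : R) ^+ N by rewrite exprn_ege1 //; lra.
have r1 : 1 < r by rewrite /r ltrDl invr_gt0.
have r0 : 0 <= r by lra.
have rN : r ^+ N <= 2.
  apply: (@le_trans _ _ (1 + (2 ^+ N - 1) * (2 ^+ N)^-1)).
    by apply: bernoulli2; rewrite invr_ge0 ltW //= invf_le1.
  have : 0 < ((2 : R) ^+ N)^-1 by rewrite invr_gt0.
  by rewrite mulrBl mulfV ?gt_eqF // => ?; lra.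
have A0 : 0 <= A by have := @WJ_sum [::] isT; rewrite big_nil; apply.
exists r => //; exists (4 * A) => [|l ul hl]; first by lra.
(* The sum S runs over a finite ball, which contains the left factors of its elements; being finite,
   it can be absorbed in S <= 2A + S / 2. *)
pose M := (\max_(u <- l) len u).+1.
have bP K : exists2 bs, uniq bs & forall u, (u \in bs) <-> WJ u /\ (len u <= K)%N.
  have [ws hws] := short_words n K.
  exists (undup [seq u <- ws | `[< WJ u /\ (len u <= K)%N >]]) => [|u]; first exact: undup_uniq.
  rewrite mem_undup mem_filter; split=> [/andP[/asboolP //]|h]; apply/andP; split; first exact/asboolP.
  by apply: hws; case: h => -[e _] h; rewrite -e size_nf.
have [bl ubl blP] := bP M; have [bN ubN bNP] := bP N.
have sp u : exists vb : word n * word n, WJ u -> (N <= len u)%N ->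
    [/\ WJ vb.1, WJ vb.2, len vb.2 = N, len u = (len vb.1 + N)%N & u ~ vb.1 ++ vb.2].
  have [[Wu [u0 o0 e0]]|h] := pselect (WJ u); last by exists ([::], [::]).
  have [u' [e1 o1 red]] := reduced_over R hm o0.
  set j := (size u' - N)%N; exists (nf (take j u'), nf (drop j u')) => _ lN /=.
  have e : u ~ take j u' ++ drop j u' by rewrite cat_take_drop; apply: cox_trans e1.
  have lu : len u = size u' by rewrite (len_eq e) cat_take_drop; apply/eqP.
  rewrite -[u' in reduced m u'](cat_take_drop j) in red.
  have /eqP l1 := reduced_catl red; have /eqP l2 := reduced_catr red.
  rewrite size_takel in l1; last by rewrite /j leq_subr.
  rewrite size_drop in l2.
  have : over J (take j u' ++ drop j u') by rewrite cat_take_drop.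
  rewrite /over all_cat => /andP[ov1 ov2].
  split.
  - by split; [exact: Wset_nf|exists (take j u') => //; apply: cox_nfl].
  - by split; [exact: Wset_nf|exists (drop j u') => //; apply: cox_nfl].
  - by rewrite (len_eq (cox_nfl m _)) l2 /j subKn // -lu.
  - by rewrite (len_eq (cox_nfl m _)) l1 lu /j subnK // -lu.
  - by apply: (cox_trans e); apply: cox_cat; apply: cox_nf.
have [f hf] := choice sp.
pose g u := qe u * r ^+ len u.
have g0 u : 0 <= g u by rewrite mulr_ge0 ?exprn_ge0 // ltW // qe_gt0.
set S := \sum_(u <- bl) g u.
have S0 : 0 <= S by apply: sumr_ge0 => u _; apply: g0.
have S1 : \sum_(u <- bl | (len u < N)%N) g u <= 2 * A.
  apply: (@le_trans _ _ (\sum_(u <- [seq u <- bl | (len u < N)%N]) qe u * 2)).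
    rewrite big_filter; apply: ler_sum => u h; rewrite ler_wpM2l ?(ltW (qe_gt0 hq u)) //.
    by apply: le_trans rN; rewrite ler_weXn2l ?(ltW r1) // ltnW.
  rewrite -mulr_suml mulrC ler_pM2l //; apply: WJ_sum; first exact: filter_uniq.
  by move=> u; rewrite mem_filter => /andP[_ /blP []].
have S2 : \sum_(u <- bl | ~~ (len u < N)%N) g u <= S * (4^-1 * 2).
  pose bN' := [seq u <- bN | len u == N].
  apply: (@le_trans _ _ (\sum_(p <- allpairs pair bl bN') g p.1 * (qe p.2 * 2))).
    rewrite -big_filter; apply: (@sum_le_inj _ _ _ _ _ f).
    - exact: filter_uniq.
    - by apply: allpairs_uniq; rewrite ?filter_uniq // => -[a b] [a' b'] _ _ /= [-> ->].
    - move=> u v; rewrite !mem_filter -!leqNgt => /andP[lu /blP [Wu _]] /andP[lv /blP [Wv _]] e.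
      have [_ _ _ _ eu] := hf u Wu lu; have [_ _ _ _ ev] := hf v Wv lv.
      by apply: (Wset_inj Wu.1 Wv.1); apply: (cox_trans eu); rewrite e; apply: cox_sym.
    - move=> u; rewrite mem_filter -leqNgt => /andP[lu /blP [Wu Lu]].
      have [W1 W2 l2 l1 eu] := hf u Wu lu; apply/allpairsP; exists (f u); split => //.
      + by apply/blP; split => //; apply: leq_trans Lu; rewrite l1 leq_addr.
      + by rewrite mem_filter l2 eqxx; apply/bNP; split => //; rewrite l2.
      + by case: (f u).
    - move=> p _; apply: mulr_ge0 => //; apply: mulr_ge0 => //; exact: ltW (qe_gt0 hq _).
    - move=> u; rewrite mem_filter -leqNgt => /andP[lu /blP [Wu Lu]].
      have [W1 W2 l2 l1 eu] := hf u Wu lu.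
      rewrite /g (qe_eq q eu) (qe_cat hm hq); last by rewrite -(len_eq eu) l1 l2.
      rewrite l1 exprD mulrACA ler_wpM2l ?mulr_ge0 ?exprn_ge0 ?(ltW (qe_gt0 hq _)) //.
      by rewrite ler_wpM2l // ltW // qe_gt0.
  rewrite big_allpairs /= /S mulr_suml; apply: ler_sum => u _.
  rewrite -mulr_sumr ler_wpM2l // -mulr_suml ler_wpM2r //; apply: hN; first exact: filter_uniq.
  by move=> v; rewrite mem_filter => /andP[/eqP lv /bNP []].
have SS : S <= 4 * A.
  have : S = \sum_(u <- bl | (len u < N)%N) g u + \sum_(u <- bl | ~~ (len u < N)%N) g u.
    by rewrite /S (bigID (fun u => (len u < N)%N)).
  lra.
apply: le_trans SS; apply: (@sum_le_inj _ _ _ _ _ id) => // u ul'.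
by apply/blP; split; [exact: hl|rewrite /M; apply: ltnW; rewrite ltnS; exact: (leq_bigmax_seq u)].
Qed.

Variable L : nat.
(* Up to errors of length at most [L], [w] is a prefix of [x]. *)
Definition Kr w x := exists w0 x1, [/\ (len (rev w ++ w0) <= L)%N, (len (rev x ++ x1) <= L)%N,
  ple m w0 x1 & same m J w0 x1].

(** The hypotheses of Schur's test. In a row, x is w times an element of [W_J] up to bounded errors,
    with weights and lengths nearly multiplying, so [margin] applies. In a column, w is nearly a
    prefix of x, and [interval_sum] applies with ratio 1 / rho. *)
Lemma kernel_bounds : exists2 rho : R, 1 < rho & exists C1 C2 : R,
  [/\ 0 <= C1, 0 <= C2,
   forall w l, uniq l -> (forall x, x \in l -> Wset m x /\ Kr w x) ->
    \sum_(x <- l) qe x * rho ^+ len x <= C1 * (qe w * rho ^+ len w) &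
   forall x l, uniq l -> (forall w, w \in l -> Wset m w /\ Kr w x) ->
    \sum_(w <- l) rho ^+ len w <= C2 * rho ^+ len x].
Proof.
have [rho r1 [C C0 hC]] := margin.
have r0 : 0 < rho by lra.
have [F [fx [fxC fxm fxo]]] := finite_model hm.
have ri : 0 <= rho^-1 < 1 by rewrite invr_ge0 (ltW r0) invf_lt1.
have [D D0 hD] := interval_sum hm fxC fxm fxo ri.
have [ws0 hws0] := short_words n L; pose ws := undup [seq w <- ws0 | (len w <= L)%N].
have hws w : (len w <= L)%N -> nf w \in ws by move=> h; rewrite mem_undup mem_filter (len_eq (cox_nfl m _)) h hws0 // size_nf.
have wsL w : w \in ws -> (len w <= L)%N by rewrite mem_undup mem_filter => /andP[].
have uws : uniq ws by apply: undup_uniq.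
have K1 := qK_ge1 hq; have K0 : 0 <= qK q by lra.
have rr a b : (a <= b)%N -> rho ^+ a <= rho ^+ b by move=> h; rewrite ler_weXn2l // ltW.
have rp a : 0 <= rho ^+ a by rewrite exprn_ge0 // ltW.
have qp u : 0 <= qe u by rewrite ltW // qe_gt0.
(* The triple holds the two bounded errors and the middle factor in [W_J]; together with w it
   determines x, so a sum over x is at most a sum over triples. *)
have dec w x : exists abc : word n * word n * word n, Kr w x ->
   [/\ abc.1.1 \in ws, abc.1.2 \in ws, WJ abc.2, x ~ w ++ abc.1.1 ++ abc.2 ++ rev abc.1.2 &
     qe x * rho ^+ len x <= (qK q ^+ L * qK q ^+ L * (rho ^+ L * rho ^+ L)) * (qe w * rho ^+ len w) * (qe abc.2 * rho ^+ len abc.2)].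
  have [[w0 [x1 [l1 l2 pl sm]]]|h] := pselect (Kr w x); last by exists ([::], [::], [::]).
  exists (nf (rev w ++ w0), nf (rev x ++ x1), nf (rev w0 ++ x1)) => _ /=.
  have e1 : w ++ nf (rev w ++ w0) ~ w0.
    apply: (cox_trans (cox_catl w (cox_nfl m _))); exact: cox_ple_mul.
  have e2 : w0 ++ nf (rev w0 ++ x1) ~ x1.
    apply: (cox_trans (cox_catl _ (cox_nfl m _))); exact: cox_ple_mul.
  have e3 : x ~ x1 ++ rev (nf (rev x ++ x1)).
    have e : rev (nf (rev x ++ x1)) ~ rev x1 ++ x.
      by have := cox_rev hm (cox_nfl m (rev x ++ x1)); rewrite rev_cat revK.
    apply: cox_sym; apply: (cox_trans (cox_catl _ e)); exact: cox_ple_mul.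
  have qb (u v : word n) : (len (rev u ++ v) <= L)%N -> qe v <= qK q ^+ L * qe u.
    move=> h; have e : v ~ u ++ nf (rev u ++ v).
      apply: cox_sym; apply: (cox_trans (cox_catl u (cox_nfl m _))); exact: cox_ple_mul.
    rewrite (qe_eq q e); apply: (le_trans (qe_bound hm hq _ _)); rewrite ler_wpM2r //.
    by rewrite ler_weXn2l // size_nf.
  have lb (u v : word n) : (len (rev u ++ v) <= L)%N -> rho ^+ len v <= rho ^+ L * rho ^+ len u.
    move=> h; rewrite -exprD; apply: rr.
    rewrite -(len_eq (cox_ple_mul hm u v)); apply: (leq_trans (len_cat m _ _)).
    by rewrite addnC leq_add2r.
  have l2' : (len (rev x1 ++ x) <= L)%N by rewrite -(len_rev hm) rev_cat revK.
  split; [exact: hws|exact: hws| |  | ].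
  - by split; [exact: Wset_nf|apply: inW_eq sm; exact: cox_nf].
  - apply: (cox_trans e3); rewrite !catA; apply: cox_catr; apply: cox_sym.
    by apply: cox_trans e2; apply: cox_catr.
  - rewrite (len_eq (cox_nfl m _)) (qe_eq q (cox_nfl m _)).
    apply: (@le_trans _ _ ((qK q ^+ L * qe x1) * (rho ^+ L * rho ^+ len x1))).
      by apply: ler_pM => //; [exact: qb|exact: lb].
    rewrite (qe_ple hm hq pl) pl exprD.
    have h : qe w0 * rho ^+ len w0 <= (qK q ^+ L * qe w) * (rho ^+ L * rho ^+ len w).
      by apply: ler_pM => //; [exact: qb|exact: lb].
    set E := qe (rev w0 ++ x1); set E' := rho ^+ len (rev w0 ++ x1).
    have E0 : 0 <= qK q ^+ L * rho ^+ L * (E * E') by rewrite /E'; nonneg_tac; apply: qp.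
    have := ler_wpM2l E0 h; congr (_ <= _); ring.
exists rho => //.
pose N : R := (size ws)%:R.
pose Q := qK q ^+ L * qK q ^+ L * (rho ^+ L * rho ^+ L).
have Q0 : 0 <= Q by rewrite /Q !mulr_ge0 ?exprn_ge0 // ltW.
have N0 : 0 <= N by rewrite ler0n.
exists (N * (N * (Q * C))), (N * (N * (rho ^+ L * rho ^+ L * D))); split.
- by nonneg_tac.
- by nonneg_tac.
- move=> w l ul hl; have [e he] := choice (dec w).
  pose lu := undup [seq (e x).2 | x <- l].
  apply: (@le_trans _ _ (\sum_(p <- allpairs pair (allpairs pair ws ws) lu) Q * (qe w * rho ^+ len w) * (qe p.2 * rho ^+ len p.2))).
    apply: (@sum_le_inj _ _ _ _ _ e) => //.
    - apply: allpairs_uniq; [|exact: undup_uniq|by move=> -[a b] [a' b'] _ _ /= [-> ->]].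
      by apply: allpairs_uniq => // -[a b] [a' b'] _ _ /= [-> ->].
    - move=> x y /hl [Wx Kx] /hl [Wy Ky] exy; apply: (Wset_inj Wx Wy).
      have [_ _ _ ex _] := he x Kx; have [_ _ _ ey _] := he y Ky.
      by apply: (cox_trans ex); rewrite exy; apply: cox_sym.
    - move=> x xl; have [_ Kx] := hl x xl; have [h1 h2 _ _ _] := he x Kx.
      apply/allpairsP; exists (e x); split; last by case: (e x).
        by apply/allpairsP; exists (e x).1; split => //; case: (e x) => -[].
      by rewrite mem_undup; apply/mapP; exists x.
    - by move=> p _; nonneg_tac.
    - by move=> x /hl [_ Kx]; have [_ _ _ _] := he x Kx.
  rewrite big_allpairs /=; have h : \sum_(u <- lu) qe u * rho ^+ len u <= C.
    apply: hC; first exact: undup_uniq.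
    by move=> u; rewrite mem_undup => /mapP [x /hl [_ Kx] ->]; have [_ _ ? _ _] := he x Kx.
  under eq_bigr do rewrite -mulr_sumr.
  rewrite big_const_seq count_predT iter_addr addr0 size_allpairs -[leLHS]mulr_natl natrM -/N.
  have -> : N * (N * (Q * C)) * (qe w * rho ^+ len w) = N * N * (Q * (qe w * rho ^+ len w) * C) by ring.
  by apply: ler_wpM2l; [nonneg_tac|apply: ler_wpM2l => //; nonneg_tac].
- move=> x l ul hl.
  have dec2 w : exists abc : word n * word n * word n, Kr w x ->
     [/\ abc.1.1 \in ws, abc.1.2 \in ws, Wset m abc.2, w ~ abc.2 ++ abc.1.1 & ple m abc.2 (x ++ abc.1.2)].
    have [[w0 [x1 [l1 l2 pl sm]]]|h] := pselect (Kr w x); last by exists ([::], [::], [::]).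
    exists (nf (rev w0 ++ w), nf (rev x ++ x1), nf w0) => _ /=; split.
    + by apply: hws; rewrite -(len_rev hm) rev_cat revK.
    + exact: hws.
    + exact: Wset_nf.
    + apply: cox_sym; apply: (cox_trans (cox_cat (cox_nfl m _) (cox_nfl m _))); exact: cox_ple_mul.
    + apply: (ple_eq hm (cox_nf m w0) _ pl).
      apply: cox_sym; apply: (cox_trans (cox_catl x (cox_nfl m _))); exact: cox_ple_mul.
  have [e he] := choice dec2; pose lu := undup [seq (e w).2 | w <- l].
  (* The enlarged sum runs over all triples of a product list; those that do not encode a prefix
     contribute 0. *)
  pose G (p : word n * word n * word n) : R :=
    if `[< ple m p.2 (x ++ p.1.2) >] then rho ^+ L * rho ^+ len p.2 else 0.
  have G0 p : 0 <= G p by rewrite /G; case: ifP => // _; rewrite mulr_ge0.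
  apply: (@le_trans _ _ (\sum_(p <- allpairs pair (allpairs pair ws ws) lu) G p)).
    apply: (@sum_le_inj _ _ _ _ _ e) => //.
    - apply: allpairs_uniq; [|exact: undup_uniq|by move=> -[a b] [a' b'] _ _ /= [-> ->]].
      by apply: allpairs_uniq => // -[a b] [a' b'] _ _ /= [-> ->].
    - move=> y z /hl [Wx Kx] /hl [Wy Ky] exy; apply: (Wset_inj Wx Wy).
      have [_ _ _ ex _] := he y Kx; have [_ _ _ ey _] := he z Ky.
      by apply: (cox_trans ex); rewrite exy; apply: cox_sym.
    - move=> w wl; have [_ Kw] := hl w wl; have [h1 h2 _ _ _] := he w Kw.
      apply/allpairsP; exists (e w); split; last by case: (e w).
        by apply/allpairsP; exists (e w).1; split => //; case: (e w) => -[].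
      by rewrite mem_undup; apply/mapP; exists w.
    - move=> w /hl [_ Kw]; have [h1 h2 _ h4 h5] := he w Kw; rewrite /G.
      case: asboolP => // _; rewrite -exprD; apply: rr; rewrite (len_eq h4).
      by apply: (leq_trans (len_cat m _ _)); rewrite addnC leq_add2r wsL.
  have h a b : b \in ws -> \sum_(w <- lu) G ((a, b), w) <= rho ^+ L * rho ^+ L * D * rho ^+ len x.
    move=> bw; rewrite /G -big_mkcond /= -mulr_sumr -!mulrA ler_wpM2l //.
    apply: (@le_trans _ _ (rho ^+ len (x ++ b) * \sum_(w <- [seq w <- lu | `[< ple m w (x ++ b) >]]) rho^-1 ^+ (len (x ++ b) - len w))).
      rewrite big_filter mulr_sumr; apply: ler_sum => w /asboolP pl.
      have hl' : (len w <= len (x ++ b))%N by rewrite pl leq_addr.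
      by rewrite -{1}(subnK hl') exprD exprVn mulrAC mulfV ?mul1r // expf_neq0 // gt_eqF.
    apply: (@le_trans _ _ (rho ^+ len (x ++ b) * D)).
      rewrite ler_wpM2l //; apply: hD; first by rewrite filter_uniq ?undup_uniq.
      move=> w; rewrite mem_filter mem_undup => /andP[/asboolP pl /mapP [y /hl [_ Ky] ey]]; split => //.
      by rewrite ey; have [] := he y Ky.
    rewrite [D * _]mulrC mulrA ler_wpM2r // -exprD; apply: rr.
    by apply: (leq_trans (len_cat m _ _)); rewrite addnC leq_add2r wsL.
  rewrite big_allpairs /= big_allpairs /=.
  apply: (@le_trans _ _ (\sum_(a <- ws) \sum_(b <- ws) (rho ^+ L * rho ^+ L * D * rho ^+ len x))).
    apply: ler_sum => a _; rewrite [leLHS]big_seq [leRHS]big_seq.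
    by apply: ler_sum => b /(h a).
  rewrite !big_const_seq !count_predT !iter_addr !addr0 -[leLHS]mulr_natl -[X in _ * X <= _]mulr_natl -/N.
  by rewrite !mulrA.
Qed.
End Kernel.

Lemma cauchy_schwarz_seq (R : realType) (T : Type) (l : seq T) (f a : T -> R) : (forall x, 0 < a x) ->
  (\sum_(x <- l) `|f x|) ^+ 2 <= (\sum_(x <- l) a x) * (\sum_(x <- l) f x ^+ 2 / a x).
Proof.
move=> a0; elim: l => [|x l IH]; first by rewrite !big_nil expr0n /= mul0r.
rewrite !big_cons; move: IH.
have : 0 <= \sum_(x <- l) `|f x| by apply: sumr_ge0.
have : 0 <= \sum_(x <- l) a x by apply: sumr_ge0 => y _; apply: ltW.
have : 0 <= \sum_(x <- l) f x ^+ 2 / a x by apply: sumr_ge0 => y _; rewrite divr_ge0 ?sqr_ge0 // ltW.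
set S := \sum_(_ <- _) _; set A := \sum_(_ <- _) _; set B := \sum_(_ <- _) _ => S0 A0 B0 IH.
have y2 : f x ^+ 2 = a x * (f x ^+ 2 / a x) by rewrite mulrCA mulfV ?mulr1 // gt_eqF.
have ax := a0 x; have z0 : 0 <= f x ^+ 2 / a x by rewrite divr_ge0 ?sqr_ge0 // ltW.
set y := `|f x|; have yy : y ^+ 2 = f x ^+ 2 by rewrite real_normK // num_real.
have y0 : 0 <= y by exact: normr_ge0.
set z := f x ^+ 2 / a x in y2 z0 *.
suff h : 2 * B * y <= A * z + a x * S.
  have -> : (y + B) ^+ 2 = y ^+ 2 + 2 * B * y + B ^+ 2 by ring.
  rewrite yy y2; have -> : (a x + A) * (z + S) = a x * z + (A * z + a x * S) + A * S by ring.
  by lra.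
rewrite -ler_sqr ?nnegrE; [|by rewrite !mulr_ge0|by rewrite addr_ge0 // mulr_ge0 // ltW].
have -> : (2 * B * y) ^+ 2 = 4 * (B ^+ 2) * (y ^+ 2) by ring.
rewrite yy y2; apply: (@le_trans _ _ (4 * (A * S) * (a x * z))).
  by apply: ler_wpM2r; [nonneg_tac|apply: ler_wpM2l].
rewrite -subr_ge0; have := sqr_ge0 (A * z - a x * S); congr (_ <= _); ring.
Qed.

(** Cauchy-Schwarz with weight p h bounds the square of a row sum of f by a row sum of p h times
    [B w]; exchanging the summations and the column hypothesis bound the sum of h w [B w]. *)
Lemma schur (R : realType) (T : choiceType) (W : set T) (K : T -> T -> Prop) (p h : T -> R) (C1 C2 : R) :
  (forall x, 0 < p x) -> (forall x, 0 < h x) -> 0 <= C1 -> 0 <= C2 ->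
  (forall w l, uniq l -> (forall x, x \in l -> W x /\ K w x) -> \sum_(x <- l) p x * h x <= C1 * (p w * h w)) ->
  (forall x l, uniq l -> (forall w, w \in l -> W w /\ K w x) -> \sum_(w <- l) h w <= C2 * h x) ->
  forall f : T -> R, (\esum_(x in W) (f x ^+ 2 / p x)%:E < +oo)%E ->
  (forall w, W w -> asummable [set x | W x /\ K w x] f) /\
  (forall g : T -> R, (forall w, W w -> (`|g w|%:E <= \esum_(x in [set x | W x /\ K w x]) `|f x|%:E)%E) ->
    (\esum_(w in W) (g w ^+ 2 / p w)%:E < +oo)%E).
Proof.
move=> p0 h0 C10 C20 row col f hf.
have a0 x : 0 < p x * h x by rewrite mulr_gt0.
pose D w : set T := [set x | W x /\ K w x].
pose F x := f x ^+ 2 / (p x * h x).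
have F0 x : 0 <= F x by rewrite /F divr_ge0 ?sqr_ge0 // ltW.
pose B w : \bar R := (\esum_(x in D w) (F x)%:E)%E.
have Fp x : f x ^+ 2 / p x = h x * F x.
  have px := lt0r_neq0 (p0 x); have hx := lt0r_neq0 (h0 x); rewrite /F; field; by rewrite px hx.
have EX : (\esum_(w in W) (h w)%:E * B w <= C2%:E * \esum_(x in W) (f x ^+ 2 / p x)%:E)%E.
  pose k (w x : T) : R := if `[< K w x >] then h w * F x else 0.
  have k0 w x : 0 <= k w x by rewrite /k; case: ifP => // _; rewrite mulr_ge0 // ltW.
  apply: (@le_trans _ _ (\esum_(w in W) \esum_(x in W) (k w x)%:E)%E).
    apply: le_esum => w _; rewrite /B.
    have -> : (\esum_(x in D w) (F x)%:E = \esum_(x in W) (if `[< K w x >] then F x else 0)%:E)%E.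
      rewrite esum_mkcond [RHS]esum_mkcond; apply: eq_esum => x _.
      rewrite /D; case: ifP => [/set_mem [Wx Kx]|Dx]; case: ifP => // Wx'.
      - by case: asboolP.
      - by case/negP: (negbT Wx'); apply/mem_set.
      - case: asboolP => // Kx; case/negP: (negbT Dx); apply/mem_set; split => //; exact: set_mem Wx'.
    have hw : 0 < h w := h0 w.
    rewrite (_ : (\esum_(x in W) (k w x)%:E)%E = (\esum_(x in W) ((h w)%:E * (if `[< K w x >] then F x else 0)%:E))%E); last first.
      by apply: eq_esum => x _; rewrite -EFinM /k; case: ifP; rewrite ?mulr0.
    rewrite -lee_pdivlMl // -[leRHS]/(_ * _)%E.
    have le1 : (\esum_(x in W) (if `[< K w x >] then F x else 0)%:E = \esum_(x in W) ((h w)^-1 * (h w * (if `[< K w x >] then F x else 0)))%:E)%E.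
      by apply: eq_esum => x _; rewrite mulKf ?lt0r_neq0.
    rewrite le1; apply: le_trans (esumZ_le _ _) _ => //; first by rewrite invr_ge0 ltW.
    by move=> x _; case: ifP => _; rewrite ?mulr0 // mulr_ge0 // ltW.
  rewrite esum_exchange; last by move=> i j; rewrite lee_fin.
  apply: (@le_trans _ _ (\esum_(x in W) (C2 * (f x ^+ 2 / p x))%:E)%E); last first.
    by apply: esumZ_le => // x _; rewrite divr_ge0 ?sqr_ge0 // ltW.
  apply: le_esum => x Wx; apply: esum_le_seq => // l ul hl.
  rewrite /k -big_mkcond /= -mulr_suml Fp mulrA ler_wpM2r // -big_filter.
  apply: col; first exact: filter_uniq.
  by move=> w; rewrite mem_filter => /andP[/asboolP Kw /hl].
have Bfin w : W w -> (B w < +oo)%E.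
  move=> Ww; have : ((h w)%:E * B w < +oo)%E.
    apply: (@le_lt_trans _ _ (\esum_(w in W) (h w)%:E * B w)%E).
      rewrite -[leLHS](@esum_set1 _ _ w (fun w => (h w)%:E * B w)%E).
        by apply: esum_sub => [y -> //|y _]; rewrite mule_ge0 ?lee_fin ?(ltW (h0 _)) // esum_ge0 // => x _; rewrite lee_fin.
      by rewrite mule_ge0 ?lee_fin ?(ltW (h0 _)) // esum_ge0 // => x _; rewrite lee_fin.
    apply: (le_lt_trans EX); rewrite esum_fin // -?EFinM ?ltry // => x _.
    by rewrite divr_ge0 ?sqr_ge0 // ltW.
  have : (0 <= B w)%E by apply: esum_ge0 => x _; rewrite lee_fin.
  case: (B w) => [b|//|//] _; first by move=> _; exact: ltry.
  by rewrite gt0_muley // lte_fin.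
have TB w : W w -> (\esum_(x in D w) `|f x|%:E <= (Num.sqrt (C1 * (p w * h w) * fine (B w)))%:E)%E.
  move=> Ww; apply: esum_le_seq => // l ul hl.
  have s0 : 0 <= \sum_(x <- l) `|f x| by apply: sumr_ge0.
  rewrite -[leLHS]ger0_norm // -sqrtr_sqr; apply: ler_wsqrtr.
  apply: (le_trans (cauchy_schwarz_seq l f a0)); apply: ler_pM.
  - by apply: sumr_ge0 => x _; apply: ltW.
  - by apply: sumr_ge0 => x _; apply: F0.
  - exact: row.
  - apply: (@esum_seq_le _ _ (D w) F) => //; rewrite -esum_fin // ; exact: Bfin.
split=> [w Ww|g hg]; first by apply: (le_lt_trans (TB w Ww)); rewrite ltry.
apply: (@le_lt_trans _ _ (\esum_(w in W) (C1 * (h w * fine (B w)))%:E)%E).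
  apply: le_esum => w Ww; rewrite lee_fin ler_pdivrMr //.
  have := le_trans (hg w Ww) (TB w Ww); rewrite lee_fin => le.
  have fB : 0 <= fine (B w) by rewrite fine_ge0 // esum_ge0 // => x _; rewrite lee_fin.
  have le2 : `|g w| ^+ 2 <= Num.sqrt (C1 * (p w * h w) * fine (B w)) ^+ 2 by rewrite ler_sqr ?nnegrE ?sqrtr_ge0.
  rewrite real_normK ?num_real // sqr_sqrtr in le2; last by rewrite !mulr_ge0 // ltW.
  by apply: le_trans le2 _; rewrite le_eqVlt; apply/orP; left; apply/eqP; ring.
apply: (@le_lt_trans _ _ (C1%:E * \esum_(w in W) (h w * fine (B w))%:E)%E).
  apply: esumZ_le => // w Ww; rewrite mulr_ge0 ?(ltW (h0 _)) // fine_ge0 // esum_ge0 // => x _; by rewrite lee_fin.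
have e : (\esum_(w in W) (h w * fine (B w))%:E = \esum_(w in W) (h w)%:E * B w)%E.
  apply: eq_esum => w Ww; rewrite EFinM fineK // ge0_fin_numE ?Bfin //.
  by apply: esum_ge0 => x _; rewrite lee_fin.
have : (\esum_(w in W) (h w)%:E * B w < +oo)%E.
  apply: (le_lt_trans EX); rewrite esum_fin // -?EFinM ?ltry // => x _.
  by rewrite divr_ge0 ?sqr_ge0 // ltW.
rewrite -e => hh; rewrite esum_fin // -?EFinM ?ltry // => w Ww.
by rewrite mulr_ge0 ?(ltW (h0 _)) // fine_ge0 // esum_ge0 // => x _; rewrite lee_fin.
Qed.

(** * Support of the incidence numbers *)

Section Count.
Variables (R : realType) (n : nat) (m : 'I_n -> 'I_n -> nat).
Hypothesis hm : coxeter_matrix m.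
Implicit Types (w x y : word n) (z : 'rV[R]_n).
Local Notation act := (act (gx R m)).
Local Notation alpha := (@alpha n R).

Fixpoint invl w : seq 'rV[R]_n :=
  if w is s :: w' then alpha s :: [seq act [:: s] z | z <- invl w'] else [::].

Lemma size_invl w : size (invl w) = size w.
Proof. by elim: w => //= s w IH; rewrite size_map IH. Qed.

Lemma inversion_invl w z : inversion m w z -> z \in invl w.
Proof.
move=> [rz z0 h]; have [w1 [s [w2 [-> ->]]]] := inversion_walk hm rz z0 h.
elim: w1 {h rz z0} => [|t w1 IH] /=; first by rewrite act_nil inE eqxx.
by rewrite inE; apply/orP; right; apply/mapP; exists (act w1 (alpha s)) => //; rewrite -act_cat.
Qed.

Lemma reduced_invl w : reduced m w -> uniq (invl w) /\ forall z, z \in invl w -> inversion m w z.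
Proof.
elim: w => [|s w IH] // red; have [u1 h1] := IH (reduced_catr (u := [:: s]) red).
have asc : nonneg (act (rev w) (alpha s)).
  apply: (ascent_nonneg hm); have -> : rev w ++ [:: s] = rev (s :: w) by rewrite rev_cons cats1.
  by rewrite !(len_rev hm) (eqP red) (eqP (reduced_catr (u := [:: s]) red)).
have ass z : act [:: s] (act [:: s] z) = z by rewrite -act_cat act_ss.
have nota z : z \in invl w -> z <> alpha s.
  move=> /h1 [_ _ h2] e; rewrite e in h2.
  by have /eqP := nonneg_anti asc h2; rewrite (negbTE (act_alpha_neq0 hm _ _)).
split=> [/=|z /=].
  rewrite map_inj_uniq ?u1 ?andbT => [|z z' e]; last by rewrite -(ass z) e ass.
  apply/mapP => -[z zl e]; have [_ z0 _] := h1 z zl.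
  have e2 : z = - alpha s by rewrite -(ass z) -e act1_alpha.
  have := z0 s; rewrite e2 !mxE !eqxx /=; lra.
rewrite inE => /orP[/eqP ->|/mapP [y yl ->]].
  split; [exact: root_alpha|exact: nonneg_alpha|].
  by rewrite rev_cons -cats1 act_cat act1_alpha actN opprK.
have [ry y0 yn] := h1 y yl; split; first exact: root_act.
  apply: contrapT => nn; apply: (nota y yl).
  apply: (root_flip hm) => //; apply: (root_nonnegN hm) => //; exact: root_act.
by rewrite rev_cons -cats1 act_cat ass.
Qed.

(** Length counts inversions, and a word has at most as many inversions as letters. *)
Lemma inversion_count y (xs : seq (word n)) :
  (forall z, inversion m y z -> exists2 x, x \in xs & inversion m x z) ->
  (len m y <= \sum_(x <- xs) size x)%N.
Proof.
move=> H; have [y' e red] := reduced_ex m y.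
have [u h] := reduced_invl red; rewrite (len_eq e) (eqP red) -size_invl.
have -> : (\sum_(x <- xs) size x = size (flatten [seq invl x | x <- xs]))%N.
  by rewrite size_flatten /shape -map_comp sumnE big_map; apply: eq_bigr => x _; rewrite /= size_invl.
apply: uniq_leq_size => // z /h /(inversion_eq hm (cox_sym e)) /H [x xl /inversion_invl zx].
by apply/flatten_mapP; exists x.
Qed.
End Count.

Section Support.
Variables (R : realType) (n : nat) (m : 'I_n -> 'I_n -> nat).
Hypothesis hm : coxeter_matrix m.
Variable th : key n -> R.
Hypothesis th0 : forall k, 0 < th k.
Variables (J V : {set 'I_n}).
Hypothesis VJ : V \subset J.
Implicit Types (u v w x y : word n) (s t : 'I_n) (ks : seq (key n)) (z : 'rV[R]_n).
Local Notation act := (act (gx R m)).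
Local Notation alpha := (@alpha n R).
Local Notation same := (same m).
Local Notation len := (len m).
Notation "u ~ v" := (cox_eq m u v) (at level 70).

(** [P] is evaluation at the point where the simplex of [ks] meets the open face of type [V] of the
    J-chamber of [w]; [pt_keys] expresses that this point is a positive combination of points
    interior to the chambers of the keys. *)
Record supp_point ks w (P : 'rV[R]_n -> R) : Prop := SuppPoint {
  ptD : forall z z', P (z + z') = P z + P z';
  pt_sum : forall (c : 'I_n -> R) (F : 'I_n -> 'rV[R]_n) (Q : pred 'I_n),
    P (\sum_(i | Q i) c i *: F i) = \sum_(i | Q i) c i * P (F i);
  pt0 : forall s, s \in V -> P (act w (alpha s)) = 0;
  pt_gt0 : forall s, s \in J -> s \notin V -> 0 < P (act w (alpha s));
  pt_keys : forall z, z != 0 -> (forall k, k \in ks -> nonneg (act (rev k.1) z)) -> 0 < P z }.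

Lemma supp_point_ex ks w : size ks = #|V|.+1 -> Ic m th J ks w (enum V) != 0 ->
  exists P, supp_point ks w P.
Proof.
move=> sk /Ic_neq0 [c [c0 h1 h2]]; rewrite -cardE in c0 h1 h2.
exists (fun z => \sum_(l < #|V|.+1) c l * ev m th (nth (key0 n) ks l) z); split.
- by move=> z z'; rewrite -big_split; apply: eq_bigr => l _; rewrite evD mulrDr.
- move=> d F Q; under eq_bigr do rewrite ev_sum mulr_sumr.
  rewrite exchange_big; apply: eq_bigr => i _; rewrite mulr_sumr; apply: eq_bigr => l _.
  by rewrite mulrCA.
- by move=> s sV; apply: h1; rewrite mem_enum.
- by move=> s sJ sV; apply: h2 => //; rewrite mem_enum.
- move=> z z0 h; have pos (l : 'I_#|V|.+1) : 0 < c l * ev m th (nth (key0 n) ks l) z.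
    by rewrite mulr_gt0 ?c0 //; apply: (ev_pos hm th0) => //; apply: h; rewrite mem_nth // sk.
  by rewrite (bigD1 ord0) //; apply: ltr_pwDl; [exact: (pos ord0)|apply: sumr_ge0 => l _; apply: ltW; exact: pos].
Qed.

Lemma supp_point_supp ks w P z : supp_point ks w P -> suppin V z -> P (act w z) = 0.
Proof.
move=> h sz; rewrite (suppin_decomp sz) act_sum.
under eq_bigr do rewrite actZ.
by rewrite (pt_sum h) big1 // => s sV; rewrite (pt0 h) ?mulr0.
Qed.

(** An element of [W_V] changes a simple root outside [V] by a combination of [V], which [P] kills
    after transport by [w]. *)
Lemma supp_point_same ks w w' P : same V w w' -> supp_point ks w P -> supp_point ks w' P.
Proof.
move=> sm h; have e z : act w' z = act w (act (rev w ++ w') z).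
  by rewrite -act_cat (gact_eq hm _ (cox_ple_mul hm w w')).
split; [exact: ptD h|exact: pt_sum h| | |exact: pt_keys h].
  by move=> s sV; rewrite e (supp_point_supp h) //; apply: (act_suppin hm sm); apply: suppin_alpha.
move=> s sJ sV; rewrite e.
set y := act (rev w ++ w') (alpha s); have -> : y = alpha s + (y - alpha s) by rewrite addrC subrK.
rewrite actD (ptD h) [X in _ + X](supp_point_supp h) ?addr0 ?(pt_gt0 h) // => j jV.
by rewrite mxE [X in _ + X]mxE /y (act_inW_coord hm _ sm jV) subrr.
Qed.

Lemma supp_point_neg ks w P z : supp_point ks w P -> suppin J (act (rev w) z) ->
  nonneg (- act (rev w) z) -> P z <= 0.
Proof.
move=> h sz nz; set a := act (rev w) z in sz nz *.
have ez : P z = \sum_(s in J) a 0 s * P (act w (alpha s)).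
  rewrite -{1}(gact_revK hm w z) -/a {1}(suppin_decomp sz) act_sum.
  by under eq_bigr do rewrite actZ; rewrite (pt_sum h).
have a0 s : a 0 s <= 0 by have := nz s; rewrite mxE oppr_ge0.
have t0 s : s \in J -> a 0 s * P (act w (alpha s)) <= 0.
  move=> sJ; have [sV|sV] := boolP (s \in V); first by rewrite (pt0 h) ?mulr0.
  by rewrite mulr_le0_ge0 // ltW // (pt_gt0 h).
by rewrite ez; exact: sumr_le0.
Qed.

(** A root vanishing at the point is not positive on all key chambers, so a positive one is an
    inversion of a key. This bounds the lengths in [w W_V], hence [W_V] is finite. *)
Lemma Ic_spherical ks w : size ks = #|V|.+1 -> Ic m th J ks w (enum V) != 0 -> spherical m V.
Proof.
move=> sk /(supp_point_ex sk) [P hP].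
pose xs := w :: [seq k.1 | k <- ks]; pose N := (\sum_(x <- xs) size x)%N.
have bound u : over V u -> (len u <= len w + N)%N.
  move=> ou; have le : (len (w ++ u) <= N)%N.
    apply: (inversion_count hm (R := R)) => z iz.
    have [iw|niw] := pselect (inversion m w z); first by exists w => //; rewrite inE eqxx.
    have [rz z0 nz] := iz.
    have pw : nonneg (act (rev w) z).
      have [//|h] := root_sign hm (root_act (rev w) rz); by case: niw.
    have sz := separating_supp hm (same_cat hm w (over_inW m ou)) rz pw nz.
    have Pz : P z = 0 by rewrite -(gact_revK hm w z) (supp_point_supp hP).
    apply: contrapT => H.
    have : 0 < P z.
      apply: (pt_keys hP); first exact: root_neq0 rz.
      move=> k kks; have [//|h] := root_sign hm (root_act (rev k.1) rz); case: H.
      by exists k.1 => //; rewrite inE; apply/orP; right; apply: map_f.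
    by rewrite Pz ltxx.
  have := len_cat m (rev w) (w ++ u); rewrite (len_rev hm).
  have -> : len (rev w ++ w ++ u) = len u.
    by apply: len_eq; rewrite catA; have := cox_catr u (cox_revcat hm w).
  by move=> h; apply: (leq_trans h); rewrite leq_add2l.
have [l hl] := short_words n (len w + N).
apply: (@sub_finite_set _ _ (cls m @` [set` l])); last first.
  by apply: finite_image; apply: finite_seq.
move=> C [u ou <-]; exists (nf m u); first by rewrite /= hl // size_nf bound.
by apply: cls_eq; apply: cox_nfl.
Qed.

(** Take w0 shortest in [w W_V] and x1 longest in [x W_U]. A positive root negative at w0 but not at
    x1 is positive on all key chambers, the apex included since it is minimal in its coset; yet it
    is nonpositive at the point, which lies in the closed J-chamber of w0. *)
Lemma Ic_kernel ks w x (U : {set 'I_n}) L : size ks = #|V|.+1 -> Ic m th J ks w (enum V) != 0 ->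
  U \subset J -> spherical m U -> same J w x ->
  (forall k, k \in ks -> same U x k.1 \/
     same J x k.1 /\ (forall s, s \in J -> nonneg (act k.1 (alpha s)))) ->
  (forall (T : {set 'I_n}) u, spherical m T -> inW m T u -> (len u <= L)%N) ->
  Kr m J L w x.
Proof.
move=> sk hI UJ sU swx hk hL; have sV := Ic_spherical sk hI.
have [P hP] := supp_point_ex sk hI.
have [w0 sw hw0] := min_coset R hm V w; have [x1 sx hx1] := max_coset R hm x sU.
have hP0 := supp_point_same sw hP.
have s01 : same J w0 x1.
  apply: (same_trans hm (same_sym hm (same_sub VJ sw))); apply: (same_trans hm swx).
  exact: same_sub sx.
exists w0, x1; split=> //; [exact: hL sw|exact: hL sx|].
apply: (inversion_ple hm (R := R)) => z iz; have [rz z0 nz] := iz; apply: contrapT => nix.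
have pos y : (inversion m y z -> inversion m x1 z) -> nonneg (act (rev y) z).
  move=> hy; have [//|h] := root_sign hm (root_act (rev y) rz); by case: nix; apply: hy.
have px := pos x1 id.
have sz := separating_supp' hm (same_sym hm s01) rz px nz.
have Pz := supp_point_neg hP0 sz nz.
have : 0 < P z.
  apply: (pt_keys hP); first exact: root_neq0 rz.
  move=> k kks; apply: pos => ik; have [h|[h1 h2]] := hk k kks.
    apply: (max_coset_inv hm _ hx1 ik); exact: (same_trans hm (same_sym hm sx) h).
  apply: (min_coset_inv hm _ h2 ik); apply: (same_trans hm (same_sym hm h1)); exact: same_sub sx.
by rewrite ltNge Pz.
Qed.

(** [g] maps the span of [V] into that of [U]; equal dimensions make this onto, so the inverse maps
    [U] back. *)
Lemma suppin_dim (U : {set 'I_n}) g : #|U| = #|V| ->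
  (forall s, s \in V -> suppin U (act g (alpha s))) ->
  forall t, t \in U -> suppin V (act (rev g) (alpha t)).
Proof.
move=> cUV H t tU.
pose E (T : {set 'I_n}) : 'M[R]_(#|T|, n) := rowsub (@enum_val _ (mem T)) 1%:M.
have EE T : E T *m (E T)^T = 1%:M.
  apply/matrixP => i j; rewrite !mxE (bigD1 (enum_val i)) //= !mxE eqxx mul1r big1 => [|k ki].
    by rewrite addr0 (inj_eq enum_val_inj) eq_sym.
  by rewrite !mxE eq_sym (negbTE ki) mul0r.
have rE T : \rank (E T) = #|T|.
  by apply/eqP; apply/row_freeP; exists (E T)^T.
have sE T (z : 'rV[R]_n) : (z <= E T)%MS <-> suppin T z.
  split=> [/submxP [D ->] j jT|h].
    rewrite mxE big1 // => i _; rewrite !mxE; case: eqP => [e|]; rewrite ?mulr0 //.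
    by rewrite -e enum_valP in jT.
  rewrite (suppin_decomp h); apply: summx_sub => s sT; apply: scalemx_sub.
  have -> : alpha s = row (enum_rank_in sT s) (E T).
    by apply/rowP => j; rewrite !mxE enum_rankK_in // eqxx eq_sym.
  exact: row_sub.
have M1 : wmx (gx R m) g *m wmx (gx R m) (rev g) = 1%:M.
  by apply/row_matrixP => i; rewrite !rowE mulmxA -!actE (gact_rev hm) mulmx1.
have uM : wmx (gx R m) g \in unitmx by case: (mulmx1_unit M1).
set A := E V *m wmx (gx R m) g.
have AU : (A <= E U)%MS.
  apply/row_subP => i; apply/sE; rewrite row_mul.
  have -> : row i (E V) = alpha (enum_val i).
    by apply/rowP => j; rewrite !mxE eqxx eq_sym.
  by rewrite -actE; apply: H; apply: enum_valP.
have rA : \rank A = \rank (E U) by rewrite mxrankMfree ?row_free_unit // !rE.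
have [_ eq] := mxrank_leqif_eq AU; rewrite rA eqxx in eq.
have /andP[_ UA] : (A == E U)%MS by rewrite -eq.
have : (alpha t <= A)%MS by apply: submx_trans UA; apply/sE; apply: suppin_alpha.
move=> /submxP [D e]; apply/sE; rewrite actE e /A -!mulmxA M1 mulmx1; exact: submxMl.
Qed.

(** Without an apex all vertices lie in the coset [x W_U], where coordinates outside [U] are
    constant. A root with such a coordinate nonzero has one sign at all vertices and cannot vanish
    at the point; so [V] is carried into [U], and onto it by dimension. *)
Lemma Ic_local ks w x (U : {set 'I_n}) : size ks = #|V|.+1 -> Ic m th J ks w (enum V) != 0 ->
  #|U| = #|V| -> U \subset J -> same J w x -> (forall k, k \in ks -> same U x k.1) ->
  U = V /\ same V x w.
Proof.
move=> sk hI cUV UJ swx hk; have [P hP] := supp_point_ex sk hI.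
have gV s : s \in V -> suppin U (act (rev x ++ w) (alpha s)).
  move=> sV; apply: contrapT => H; pose z := act w (alpha s).
  have rz : is_root m z by exists w, s.
  have [j jU zj] : exists2 j, j \notin U & act (rev x) z 0 j != 0.
    apply: contrapT => H2; apply: H => j jU; rewrite act_cat; apply/eqP/negPn/negP => h.
    by apply: H2; exists j.
  have kj k : k \in ks -> act (rev k.1) z 0 j = act (rev x) z 0 j.
    move=> /hk sm; rewrite -(act_inW_coord hm (act (rev x) z) (same_sym hm sm) jU).
    by rewrite act_cat (gact_revK hm).
  have Pz : P z = 0 by apply: (pt0 hP).
  have PN : P (- z) = 0.
    have := ptD hP z (- z); rewrite subrr Pz add0r => <-.
    by have := ptD hP 0 0; rewrite addr0 => /eqP; rewrite -subr_eq0 opprD addNKr oppr_eq0 => /eqP.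
  have z0 : z != 0 by apply: root_neq0 rz.
  have zN0 : - z != 0 by rewrite oppr_eq0.
  have [p|p|p] := ltrgt0P (act (rev x) z 0 j); last by rewrite p eqxx in zj.
    have : 0 < P z.
      apply: (pt_keys hP) => // k kks; apply: (root_pos1 hm (j := j)); first exact: root_act.
      by rewrite kj.
    by rewrite Pz ltxx.
  have : 0 < P (- z).
    apply: (pt_keys hP) => // k kks; apply: (root_pos1 hm (j := j)).
      by apply: root_act; apply: rootN.
    by rewrite actN mxE kj // oppr_gt0.
  by rewrite PN ltxx.
(* The aim is that this shortest element is trivial: the sign argument puts any inversion of it in
   the span of [U], while its inverse keeps [U] positive. *)
have [g sg hg] := min_coset R hm V (rev x ++ w).
have gV' s : s \in V -> suppin U (act g (alpha s)).
  move=> sV; have e : act g (alpha s) = act (rev x ++ w) (act (rev (rev x ++ w) ++ g) (alpha s)).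
    by rewrite -act_cat (gact_eq hm _ (cox_ple_mul hm _ g)).
  have h2 : suppin V (act (rev (rev x ++ w) ++ g) (alpha s)).
    by apply: (act_suppin hm sg); apply: suppin_alpha.
  rewrite e (suppin_decomp h2) act_sum => j jU; rewrite summxE big1 // => t tV.
  by rewrite actZ mxE (gV t tV j jU) mulr0.
have gU := suppin_dim cUV gV'.
have gUpos t : t \in U -> nonneg (act (rev g) (alpha t)).
  move=> tU; have rt : is_root m (act (rev g) (alpha t)) by exists (rev g), t.
  have [//|h] := root_sign hm rt.
  have h2 := nonneg_act_supp (suppinN (gU t tU)) h hg.
  rewrite actN (gact_revK hm) in h2.
  by have := h2 t; rewrite !mxE !eqxx /= oppr_ge0 ler10.
pose w' := x ++ g.
have sww' : same V w w'.
  apply: (same_trans hm (y := x ++ (rev x ++ w))).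
    by apply: same_eq => //; apply: cox_sym; apply: cox_ple_mul.
  apply: inW_eq sg; have -> : rev (x ++ (rev x ++ w)) = rev (rev x ++ w) ++ rev x by rewrite rev_cat.
  rewrite /w' -catA; apply: cox_catl.
  by rewrite catA; apply: cox_sym; have := cox_catr g (cox_revcat hm x).
have hP' := supp_point_same sww' hP.
have swx' : same J x w' by apply: (same_trans hm (same_sym hm swx)); apply: same_sub sww'.
have ginv z : inversion m g z -> inversion m [::] z.
  move=> [rz z0 nz]; exfalso; pose y := act x z.
  have ry : is_root m y by apply: root_act.
  have exy : act (rev x) y = z by rewrite (gact_rev hm).
  have ewy : act (rev w') y = act (rev g) z by rewrite rev_cat act_cat exy.
  have py : nonneg (act (rev x) y) by rewrite exy.
  have ny : nonneg (- act (rev w') y) by rewrite ewy.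
  have sz := separating_supp' hm swx' ry py ny.
  have Py := supp_point_neg hP' sz ny.
  have zU : suppin U z.
    apply: contrapT => H.
    have [j jU zj] : exists2 j, j \notin U & z 0 j != 0.
      apply: contrapT => H2; apply: H => j jU; apply/eqP/negPn/negP => h.
      by apply: H2; exists j.
    have : 0 < P y.
      apply: (pt_keys hP); first exact: root_neq0 ry.
      move=> k /hk sm; apply: (root_pos1 hm (j := j)); first exact: root_act.
      have -> : act (rev k.1) y 0 j = z 0 j.
        by rewrite /y -act_cat; exact: (act_inW_coord hm z (same_sym hm sm) jU).
      by rewrite lt_neqAle eq_sym zj z0.
    by rewrite ltNge Py.
  have h := nonneg_act_supp zU z0 gUpos.
  have /eqP := nonneg_anti h nz; rewrite (negbTE (root_neq0 hm _)) //; exact: root_act.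
have g1 : g ~ [::].
  apply: (len0 (m := m)); have := inversion_ple hm (R := R) ginv; rewrite /ple len_nil; lia.
have UV : U = V.
  apply/eqP; rewrite eqEcard cUV leqnn andbT; apply/fintype.subsetP => t tU; apply/negPn/negP => tV.
  have := gU t tU t tV; rewrite (gact_eq hm _ (cox_rev hm g1)) act_nil !mxE !eqxx => /eqP.
  by rewrite oner_eq0.
split=> //; apply: (same_trans hm _ (same_sym hm sww')).
by apply: same_eq => //; rewrite /w' -{1}[x]cats0; apply: cox_catl; apply: cox_sym.
Qed.
End Support.

(** * Oriented flags *)

Section SumSeq.
Variables (R : realType) (n : nat).
Implicit Types (F G : seq 'I_n -> R) (p : seq 'I_n).

(** All sequences are summed, repetitions included; the factor [eps] discards those that are not
    flags. *)
Fixpoint sumseq i F : R :=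
  if i is i'.+1 then \sum_s sumseq i' (fun p => F (s :: p)) else F [::].

Lemma eq_sumseq i F G : (forall p, size p = i -> F p = G p) -> sumseq i F = sumseq i G.
Proof.
elim: i F G => [|i IH] F G h /=; first exact: h.
by apply: eq_bigr => s _; apply: IH => p sp; apply: h; rewrite /= sp.
Qed.

Lemma sumseq_sum i (I : Type) (r : seq I) (P : pred I) (F : I -> seq 'I_n -> R) :
  sumseq i (fun p => \sum_(j <- r | P j) F j p) = \sum_(j <- r | P j) sumseq i (F j).
Proof.
elim: i F => //= i IH F; under eq_bigr do rewrite IH.
by rewrite exchange_big.
Qed.

Lemma sumseqZ i c F : sumseq i (fun p => c * F p) = c * sumseq i F.
Proof.
elim: i F => //= i IH F; rewrite mulr_sumr; apply: eq_bigr => s _; exact: IH.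
Qed.

Lemma sumseq0 i F : (forall p, size p = i -> F p = 0) -> sumseq i F = 0.
Proof.
move=> h; rewrite (eq_sumseq (G := fun p => 0 * F p)) ?sumseqZ ?mul0r // => p sp.
by rewrite h // mulr0.
Qed.

Lemma sumseq_swap i j F : (j.+1 < i)%N ->
  (forall A s t B, size A = j -> F (A ++ s :: t :: B) = - F (A ++ t :: s :: B)) -> sumseq i F = 0.
Proof.
elim: i j F => [|i IH] [|j] F // ji h.
  case: i ji {IH} => // i _ /=.
  set X := \sum_s _; suff : X = - X by move=> ?; lra.
  rewrite {1}/X exchange_big -sumrN; apply: eq_bigr => s _; rewrite -sumrN; apply: eq_bigr => t _.
  rewrite -mulN1r -sumseqZ; apply: eq_sumseq => p _; by rewrite mulN1r (h [::] _ _ p).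
by rewrite /= big1 // => s _; apply: (IH j) => // A u t B sA; apply: (h (s :: A)); rewrite /= sA.
Qed.

Lemma sumseq_le i F G : (forall p, size p = i -> F p <= G p) -> sumseq i F <= sumseq i G.
Proof.
elim: i F G => [|i IH] F G h /=; first exact: h.
by apply: ler_sum => s _; apply: IH => p sp; apply: h; rewrite /= sp.
Qed.

Lemma sumseq_abs i F : `|sumseq i F| <= sumseq i (fun p => `|F p|).
Proof.
elim: i F => //= i IH F; apply: (le_trans (ler_norm_sum _ _ _)); apply: ler_sum => s _; exact: IH.
Qed.

Lemma sumseq_const i c : sumseq i (fun=> c) = n%:R ^+ i * c.
Proof.
elim: i => [|i IH] /=; first by rewrite expr0 mul1r.
by rewrite IH sumr_const card_ord exprS -mulrA -[LHS]mulr_natl.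
Qed.
End SumSeq.

(** * Signs of flags and of the boundary operator *)

Section Orientation.
Variables (R : realType) (n : nat) (J : {set 'I_n}).
Implicit Types (p A B : seq 'I_n) (s t : 'I_n) (U V : {set 'I_n}).

Definition sset p : {set 'I_n} := [set t | t \in p]%SET.

(** A list encodes the flag of the letter sets of its tails, the head being the element added last.
    The sign is that of the permutation sorting the list. *)
Fixpoint eps p : R := if p is s :: p'
  then if (s \notin p') && (s \in J) then (-1) ^+ count (fun t : 'I_n => (t < s)%N) p' * eps p' else 0
  else 1.

Lemma sset_cons s p : sset (s :: p) = (s |: sset p)%SET.
Proof. by apply/setP => t; rewrite !inE. Qed.

Lemma sset_swap A s t B : sset (A ++ s :: t :: B) = sset (A ++ t :: s :: B).
Proof. by apply/setP => u; rewrite !inE !mem_cat !inE; congr orb; rewrite orbCA. Qed.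

Lemma card_sset p : uniq p -> #|sset p| = size p.
Proof. by move=> /card_uniqP <-; apply: eq_card => t; rewrite !inE. Qed.

Lemma eps_ne0 p : eps p != 0 -> uniq p /\ sset p \subset J.
Proof.
elim: p => [|s p IH] /=; first by split=> //; apply/fintype.subsetP => t; rewrite !inE.
case: ifP => [/andP[sp sJ]|]; last by rewrite eqxx.
rewrite mulf_eq0 negb_or => /andP[_ /IH [u sub]]; rewrite sp u; split=> //.
by rewrite sset_cons finset.subUset finset.sub1set sJ.
Qed.

Lemma eps_abs p : `|eps p| <= 1.
Proof.
elim: p => [|s p IH] /=; first by rewrite normr1.
by case: ifP => _; rewrite ?normr0 // normrM normrX normrN1 expr1n mul1r.
Qed.

Lemma eps_swap A s t B : eps (A ++ s :: t :: B) = - eps (A ++ t :: s :: B).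
Proof.
elim: A => [|a A IH] /=; last first.
  have -> : (a \notin A ++ s :: t :: B) = (a \notin A ++ t :: s :: B).
    by rewrite !mem_cat !inE; congr (~~ (_ || _)); rewrite orbCA.
  have -> : count (fun t : 'I_n => (t < a)%N) (A ++ s :: t :: B) = count (fun t : 'I_n => (t < a)%N) (A ++ t :: s :: B).
    by rewrite !count_cat /=; congr addn; rewrite addnCA.
  by case: ifP => _; rewrite ?oppr0 // IH mulrN.
rewrite !inE [t == s]eq_sym.
have [->|st] := eqVneq s t; first by rewrite /= oppr0.
case: (s \in B) => /=; first by case: (_ && _); rewrite ?mulr0 oppr0.
case: (t \in B) => /=; first by case: (s \in J); rewrite ?mulr0 oppr0.
case: (s \in J); last by case: (t \in J); rewrite ?mulr0 oppr0.
case: (t \in J); last by rewrite ?mulr0 oppr0.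
rewrite /= !exprD; move: st; rewrite -val_eqE /=.
by case: ltngtP => //= _ _; rewrite ?expr0 ?expr1; ring.
Qed.

Definition ddJ (b : {set 'I_n} -> word n -> R) U x : R :=
  \sum_(s | (s \in J) && (s \notin U)) (-1) ^+ pos s (s |: U)%SET * b (s |: U)%SET x.

(** Summing over the element added last gives the boundary, because [pos] and [eps] count the same
    smaller elements. *)
Lemma eps_top b p x : \sum_s eps (s :: p) * b (sset (s :: p)) x = eps p * ddJ b (sset p) x.
Proof.
have [e0|e0] := eqVneq (eps p) 0.
  by rewrite e0 mul0r big1 // => s _ /=; case: ifP => _; rewrite ?e0 ?mulr0 mul0r.
have [u _] := eps_ne0 e0.
rewrite /ddJ mulr_sumr [RHS]big_mkcond; apply: eq_bigr => s _ /=.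
rewrite sset_cons inE andbC; case: ifP => // _; last by rewrite mul0r.
have -> : pos s (s |: sset p)%SET = count (fun t : 'I_n => (t < s)%N) p.
  rewrite /pos -size_filter -(card_sset (filter_uniq _ u)); apply: eq_card => t.
  by rewrite !inE mem_filter andbC; case: eqP => [->|] //=; rewrite ltnn.
ring.
Qed.

(** [pos] is the place where [s] enters the sorted list; this relates the sign of the boundary to
    that of [Ic_move], up to (-1)^|U|. *)
Lemma enum_setU1 s U : s \notin U -> exists A B,
  [/\ enum U = A ++ B, enum (s |: U)%SET = A ++ s :: B & size A = pos s (s |: U)%SET].
Proof.
move=> sU; pose r (a b : 'I_n) := (a < b)%N.
have tr : transitive r by move=> a b c; apply: ltn_trans.
have ir : irreflexive r by move=> a; apply: ltnn.
have so (T : {set 'I_n}) : sorted r (enum T).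
  have : sorted r (enum 'I_n).
    by have := iota_ltn_sorted 0 n; rewrite -val_enum_ord sorted_map.
  by rewrite {2}/enum_mem -enumT; apply: sorted_filter.
have se : s \in enum (s |: U)%SET by rewrite mem_enum setU11.
have eU : enum U = [seq t <- enum (s |: U)%SET | t != s].
  rewrite /enum_mem -filter_predI; apply: eq_filter => t /=; rewrite !inE.
  by case: eqP => [->|] //=; rewrite (negbTE sU).
have := so (s |: U)%SET; have := enum_uniq (s |: U)%SET.
rewrite /pos (_ : #|_| = count (fun t : 'I_n => (t < s)%N) (enum (s |: U)%SET)); last first.
  rewrite -size_filter cardE; congr size; rewrite /enum_mem -filter_predI; apply: eq_filter => t /=.
  by rewrite !inE andbC.
move: eU; case/splitPr: se => A B eU uE; rewrite (sorted_pairwise tr) pairwise_cat /= => /and4P[h _ h2 _].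
move: h; rewrite allrel_consr => /andP[h1 _].
exists A, B; split=> //.
  move: uE; rewrite cat_uniq /= negb_or => /and3P[_ /andP[sA _] /andP[sB _]].
  rewrite eU filter_cat /= eqxx /=; congr (_ ++ _); apply/all_filterP; apply/allP => t tl.
    by apply: contraNneq sA => <-.
  by apply: contraNneq sB => <-.
rewrite count_cat /= ltnn add0n.
have -> : count (fun t : 'I_n => (t < s)%N) A = size A by apply/eqP; rewrite -all_count.
rewrite (_ : count _ B = 0%N) ?addn0 //; apply/eqP; rewrite -leqn0 leqNgt -has_count.
by apply/hasPn => t /(allP h2); rewrite /r /= -leqNgt => /ltnW.
Qed.
End Orientation.

(** * The cone construction *)

Section Admissible.
Variables (R : realType) (n : nat) (m : 'I_n -> 'I_n -> nat) (q : 'I_n -> R).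
Hypothesis hm : coxeter_matrix m.
Hypothesis hq : multiparameter m q.
Local Notation qe := (qe m q).
Implicit Types (f g : word n -> R) (b : {set 'I_n} -> word n -> R).

Definition l2 f := (\esum_(x in Wset m) (f x ^+ 2 / qe x)%:E < +oo)%E.

Let nnt f x : 0 <= f x ^+ 2 / qe x.
Proof. by rewrite divr_ge0 ?sqr_ge0 // ltW // qe_gt0. Qed.

Lemma l2_le f g : (forall x, Wset m x -> `|f x| <= `|g x|) -> l2 g -> l2 f.
Proof.
move=> h; apply: le_lt_trans; apply: le_esum => x Wx; rewrite lee_fin.
apply: ler_wpM2r; first by rewrite invr_ge0 ltW // qe_gt0.
by rewrite -[f x ^+ 2]real_normK ?num_real // -[g x ^+ 2]real_normK ?num_real // ler_sqr ?nnegrE // h.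
Qed.

Lemma l2Z c f : l2 f -> l2 (fun x => c * f x).
Proof.
move=> h; apply: (@le_lt_trans _ _ ((c ^+ 2)%:E * \esum_(x in Wset m) (f x ^+ 2 / qe x)%:E)%E).
  under eq_esum do rewrite exprMn -mulrA.
  by apply: esumZ_le; rewrite ?sqr_ge0.
by rewrite esum_fin // -EFinM ltry.
Qed.

Lemma l2D f g : l2 f -> l2 g -> l2 (fun x => f x + g x).
Proof.
move=> hf hg; have := lte_add_pinfty (l2Z 2 hf) (l2Z 2 hg); rewrite -esumD; [|by move=> x _; rewrite lee_fin; exact: (nnt (fun x => 2 * f x))|by move=> x _; rewrite lee_fin; exact: (nnt (fun x => 2 * g x))].
apply: le_lt_trans; apply: le_esum => x _; rewrite -EFinD lee_fin -mulrDl.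
apply: ler_wpM2r; first by rewrite invr_ge0 ltW // qe_gt0.
rewrite !exprMn; have := sqr_ge0 (f x - g x); have := sqr_ge0 (f x); have := sqr_ge0 (g x).
by move: (f x) (g x) => a c; rewrite !expr2 => ? ? ?; nra.
Qed.

Lemma l2_sum (I : Type) (r : seq I) (P : pred I) (F : I -> word n -> R) :
  (forall i, P i -> l2 (F i)) -> l2 (fun x => \sum_(i <- r | P i) F i x).
Proof.
move=> h; elim: r => [|i r IH].
  by rewrite /l2 esum1 // => x _; rewrite big_nil expr0n mul0r.
case: (boolP (P i)) => Pi.
  apply: l2_le (l2D (h i Pi) IH) => x _; by rewrite big_cons Pi.
by apply: l2_le IH => x _; rewrite big_cons (negbTE Pi).
Qed.

(** The class of chains used from here on, with all types at once: right [W_V]-invariance, spherical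
    support, square summability for 1 / q. *)
Record Adm b : Prop := MkAdm {
  adm_inv : forall V x y, same m V x y -> b V x = b V y;
  adm_sph : forall V x, b V x != 0 -> spherical m V;
  adm_l2 : forall V, l2 (b V) }.

Lemma Adm_dd J b : Adm b -> Adm (ddJ J b).
Proof.
move=> [h1 h2 h3]; split.
- move=> V x y sm; apply: eq_bigr => s _; congr (_ * _); apply: h1.
  by apply: same_sub sm; apply: finset.subsetUr.
- move=> V x nz; apply: contrapT => H; move/eqP: nz; apply; apply: big1 => s _.
  have [->|/h2 sp] := eqVneq (b (s |: V)%SET x) 0; first by rewrite mulr0.
  by case: H; apply: sub_spherical sp; apply: finset.subsetUr.
- by move=> V; apply: l2_sum => s _; apply: l2Z.
Qed.

(** A single cell as a chain, the test case that fixes the scalar in [HH_false]. *)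
Lemma Adm_indicator V w : spherical m V ->
  Adm (fun U x => if (U == V) && `[< same m V w x >] then 1 else 0).
Proof.
move=> sV; split.
- move=> U x y; have [-> sm|//] := eqVneq U V; rewrite /=; congr (if _ then _ else _).
  apply: asbool_equiv_eq; split=> h; first exact: (same_trans hm h sm).
  exact: (same_trans hm h (same_sym hm sm)).
- by move=> U x; have [->|_] := eqVneq U V; rewrite ?eqxx.
- move=> U; have [l hl] := spherical_reps sV.
  pose l' := undup [seq nf m (w ++ u) | u <- l].
  pose g := (fun x => if x \in l' then 1 else 0 : R).
  apply: (@l2_le _ g) => [x Wx|].
    have [_|_] := eqVneq U V; last by rewrite normr0.
    case: asboolP => [sm|_] /=; last by rewrite normr0.
    rewrite /g mem_undup; case: ifP => // /negbT /negP; case.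
    have [v vl e] := hl _ sm; apply/mapP; exists v => //.
    rewrite -[LHS]Wx; apply: nf_eq; apply: cox_sym; apply: cox_trans (cox_ple_mul hm w x).
    by apply: cox_catl; apply: cox_sym.
  apply: (@le_lt_trans _ _ (\sum_(x <- l') (qe x)^-1)%:E); last by rewrite ltry.
  apply: esum_le_seq => [x _|r ur hr]; first exact: nnt.
  rewrite (eq_bigr (fun x => if x \in l' then (qe x)^-1 else 0)); last first.
    by move=> x _; rewrite /g; case: ifP => _; rewrite ?expr1n ?mul1r // expr0n mul0r.
  rewrite -big_mkcond -big_filter; apply: (@sum_le_inj _ _ _ _ _ id) => //.
  + exact: filter_uniq.
  + exact: undup_uniq.
  + by move=> x; rewrite mem_filter => /andP[].
  + by move=> x _; rewrite invr_ge0 ltW // qe_gt0.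
Qed.
End Admissible.

Lemma esum_le_supp (R : realType) (T : choiceType) (D E : set T) (F G : T -> R) :
  (forall x, 0 <= F x) -> (forall x, 0 <= G x) -> (forall x, D x -> F x != 0 -> E x /\ F x <= G x) ->
  (\esum_(x in D) (F x)%:E <= \esum_(x in E) (G x)%:E)%E.
Proof.
move=> F0 G0 h; rewrite esum_mkcond [leRHS]esum_mkcond; apply: le_esum => x _.
case: ifP => [/set_mem Dx|_]; last by case: ifP; rewrite ?lee_fin.
have [->|/(h x Dx) [Ex le]] := eqVneq (F x) 0; first by case: ifP; rewrite ?lee_fin.
by rewrite mem_set // lee_fin.
Qed.

Lemma rsum_single (R : realType) (T : choiceType) (D : set T) (f : T -> R) a : D a ->
  (forall x, D x -> x != a -> f x = 0) -> rsum D f = f a.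
Proof.
move=> Da h.
have E (g : T -> R) : (forall x, 0 <= g x) -> (forall x, D x -> x != a -> g x = 0) ->
    (\esum_(x in D) (g x)%:E = (g a)%:E)%E.
  move=> g0 hg; rewrite -[RHS](@esum_set1 _ _ a (fun x => (g x)%:E)) ?lee_fin //.
  rewrite esum_mkcond [RHS]esum_mkcond; apply: eq_esum => x _.
  have [->|xa] := eqVneq x a; first by rewrite !mem_set.
  rewrite [in RHS]memNset; last by move=> e; rewrite e eqxx in xa.
  by case: ifP => // /set_mem Dx; rewrite hg.
rewrite /rsum !E; [|by move=> x; rewrite le_max lexx orbT| | by move=> x; rewrite le_max lexx orbT|].
- by rewrite /=; case: (leP (f a) 0) => h1; case: (leP (- f a) 0) => h2; lra.
- by move=> x Dx xa; rewrite h // oppr0 maxxx.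
- by move=> x Dx xa; rewrite h // maxxx.
Qed.

Section Core.
Variables (R : realType) (n : nat) (m : 'I_n -> 'I_n -> nat) (q : 'I_n -> R).
Hypothesis hm : coxeter_matrix m.
Hypothesis hq : multiparameter m q.
Variable th : key n -> R.
Hypothesis th0 : forall k, 0 < th k.
Hypothesis thg : generic m th.
Variable J : {set 'I_n}.
Hypothesis hR : in_R m J q.
Implicit Types (u v w x y : word n) (s t : 'I_n) (p : seq 'I_n) (U V : {set 'I_n}) (ks : seq (key n)).
Implicit Types (b : {set 'I_n} -> word n -> R).
Local Notation act := (act (gx R m)).
Local Notation alpha := (@alpha n R).
Local Notation same := (same m).
Local Notation len := (len m).
Local Notation nf := (nf m).
Local Notation Ic := (Ic m th J).
Local Notation eps := (eps R J).
Local Notation ddJ := (ddJ J).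
Local Notation Adm := (Adm m q).
Notation "u ~ v" := (cox_eq m u v) (at level 70).

(* Barycentres of cells are replaced by the generic points of the keys [kc U x]; the apex
   [kb x] of the cone lies in the minimal chamber of [x W_J]. *)
Definition crep U x : word n := xget [::] (coset m x U).
Definition brep x : word n :=
  xget [::] [set y | same J x y /\ forall s, s \in J -> nonneg (act y (alpha s))].

Lemma crep_same U x : same U x (crep U x).
Proof.
have : exists y, coset m x U y by exists x; rewrite coset_same //; apply: same_refl.
by move=> /(@xgetPex _ [::]); rewrite {1}coset_same.
Qed.
Lemma crep_eq U x y : same U x y -> crep U x = crep U y.
Proof. by move=> /(coset_eqP hm) e; rewrite /crep e. Qed.
Lemma brepP x : same J x (brep x) /\ forall s, s \in J -> nonneg (act (brep x) (alpha s)).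
Proof.
have [y h1 h2] := min_coset R hm J x.
have : exists y, [set y | same J x y /\ forall s, s \in J -> nonneg (act y (alpha s))] y by exists y.
by move=> /(@xgetPex _ [::]).
Qed.
Lemma brep_eq x y : same J x y -> brep x = brep y.
Proof.
move=> sm; rewrite /brep; congr xget; apply/seteqP; split=> z /= [h1 h2]; split=> //.
  exact: (same_trans hm (same_sym hm sm) h1).
exact: (same_trans hm sm h1).
Qed.

Definition kc U x : key n := (crep U x, Some U).
Definition kb x : key n := (brep x, None).
(** The vertices of the flag simplex, from the cell of type [sset p] down to the vertex of empty
    type. *)
Fixpoint pts x p : seq (key n) :=
  kc (sset p) x :: (if p is s :: p' then pts x p' else [::]).
Definition base (f : bool) x := if f then [:: kb x] else [::].

Lemma size_pts x p : size (pts x p) = (size p).+1.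
Proof. by elim: p => //= s p ->. Qed.

Lemma mem_pts x p k : k \in pts x p -> exists2 U, k = kc U x & U \subset sset p.
Proof.
elim: p => [|s p IH] /=; first by rewrite inE => /eqP ->; exists (sset [::]).
rewrite inE => /orP[/eqP ->|/IH [U -> sub]]; first by exists (sset (s :: p)).
by exists U => //; apply: (fintype.subset_trans sub); rewrite sset_cons finset.subsetUr.
Qed.

Lemma uniq_pts x p (f : bool) : uniq p -> uniq (base f x ++ pts x p).
Proof.
move=> u; suff h : uniq (pts x p).
  by case: f => //=; rewrite h andbT; apply/negP => /mem_pts [U].
elim: p u => //= s p IH /andP[sp u]; rewrite IH // andbT; apply/negP => /mem_pts [U [_ <-]].
by move=> /fintype.subsetP /(_ s); rewrite !inE eqxx (negbTE sp) => /(_ isT).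
Qed.

Lemma mem_remk k ks z : z \in remk k ks -> z \in ks.
Proof. by rewrite mem_cat => /orP[/mem_take|/mem_drop]. Qed.

(** [f] doubles as a number: the apex, if present, is vertex 0, so the top cell is vertex [f]. *)
Lemma remk_top (f : bool) x s p : remk f (base f x ++ pts x (s :: p)) = base f x ++ pts x p.
Proof. by case: f; rewrite /remk /= ?drop0. Qed.

Lemma remk_base (f : bool) j x p : remk (f + j) (base f x ++ pts x p) = base f x ++ remk j (pts x p).
Proof. by case: f. Qed.

(** Once an interior cell is dropped, the order of the two letters around it is forgotten. *)
Lemma remk_mid x A s t B :
  remk (size A).+1 (pts x (A ++ s :: t :: B)) = remk (size A).+1 (pts x (A ++ t :: s :: B)).
Proof.
elim: A => [|a A IH] /=.
  by rewrite /remk /= !drop0 (sset_swap [::]).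
rewrite -[LHS]/(kc _ x :: remk (size A).+1 _) -[RHS]/(kc _ x :: remk (size A).+1 _) IH.
by rewrite !sset_cons sset_swap.
Qed.

(** Without the vertex of empty type, all remaining types contain the last letter s, and such cells
    do not see right multiplication by s. *)
Lemma remk_last x y p s : same [set s]%SET x y ->
  remk (size p).+1 (pts x (rcons p s)) = remk (size p).+1 (pts y (rcons p s)).
Proof.
move=> sm.
have K U : s \in U -> kc U x = kc U y.
  by move=> sU; rewrite /kc; congr (_, _); apply: crep_eq; apply: same_sub sm; rewrite finset.sub1set.
elim: p => [|a p IH] /=; first by rewrite /remk /= K // !inE.
rewrite -[LHS]/(kc _ x :: remk (size p).+1 _) -[RHS]/(kc _ y :: remk (size p).+1 _) IH K //.
by rewrite !inE mem_rcons inE eqxx orbT.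
Qed.

Definition Dm w : set (word n) := [set x | Wset m x /\ same J w x].

Lemma spherical_uniform_bound : exists L, forall (T : {set 'I_n}) u, spherical m T -> inW m T u -> (len u <= L)%N.
Proof.
have h (T : {set 'I_n}) : exists L, spherical m T -> forall u, inW m T u -> (len u <= L)%N.
  have [/spherical_bound [L hL]|nT] := pselect (spherical m T); first by exists L.
  by exists 0%N.
have [f hf] := choice h; exists (\max_T f T)%N => T u sT iu.
by apply: (leq_trans (hf T sT u iu)); exact: leq_bigmax.
Qed.

Definition good_keys V p x ks := size ks = #|V|.+1 /\
  forall k, k \in ks -> same (sset p) x k.1 \/ k = kb x.

(** A nonzero term forces [Kr w x] by [Ic_kernel] and the sum is at most G x, so [schur] applies.
    The coefficients [a] are left general so that [Fr_last] can select flags by their last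
    letter. *)
Lemma core_bound b i V (ks : seq 'I_n -> word n -> seq (key n)) (a : word n -> word n -> seq 'I_n -> R) :
  Adm b -> V \subset J -> (forall w x p, `|a w x p| <= 1) ->
  (forall w x p, size p = i -> a w x p != 0 -> sset p \subset J /\ good_keys V p x (ks p x)) ->
  let f w x := sumseq i (fun p => a w x p * b (sset p) x * Ic (ks p x) w (enum V)) in
  (forall w, Wset m w -> asummable (Dm w) (f w)) /\ l2 m q (fun w => rsum (Dm w) (f w)).
Proof.
move=> Ab VJ a1 ha f.
have [L hL] := spherical_uniform_bound.
have [rho r1 [C1 [C2 [C10 C20 row col]]]] := kernel_bounds hm hq hR L.
have r0 : 0 < rho by lra.
pose G x := n%:R ^+ i * \sum_(T : {set 'I_n}) `|b T x|.
have G0 x : 0 <= G x by rewrite mulr_ge0 ?exprn_ge0 ?ler0n // sumr_ge0.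
have lG : l2 m q G.
  apply: (@l2Z _ _ _ _ hq _ (fun x => \sum_(T : {set 'I_n}) `|b T x|)).
  apply: (@l2_sum _ _ _ _ hq _ _ _ (fun T x => `|b T x|)) => T _; apply: (l2_le hq (g := b T)) => [x _|]; last exact: adm_l2.
  by rewrite normr_id.
have [sc1 sc2] := @schur R (word n : choiceType) (Wset m) (Kr m J L) (qe m q) (fun x => rho ^+ len x) C1 C2
  (qe_gt0 hq) (fun x => exprn_gt0 (len x) r0) C10 C20 row col G lG.
have fle w x : Dm w x -> f w x != 0 -> Kr m J L w x /\ `|f w x| <= G x.
  move=> [Wx sm] nz; split.
    apply: contrapT => H; move/eqP: nz; apply; apply: sumseq0 => p sp.
    apply/eqP/negPn/negP; rewrite !mulf_eq0 !negb_or => /andP[/andP[na nb] nI]; apply: H.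
    have [pJ [sk hk]] := ha w x p sp na.
    apply: (Ic_kernel hm th0 VJ sk nI pJ (adm_sph Ab nb) sm _ hL) => k /hk [h|->]; [by left|right].
    exact: brepP.
  apply: (le_trans (sumseq_abs _ _)); rewrite /G -sumseq_const; apply: sumseq_le => p sp.
  rewrite !normrM; apply: (@le_trans _ _ `|b (sset p) x|).
    have := Ic_abs m th J (ks p x) w (enum V); have := a1 w x p => h1 h2.
    rewrite -[leRHS]mul1r -[leRHS]mulr1; apply: ler_pM => //; exact: ler_wpM2r.
  by rewrite (bigD1 (sset p)) //= lerDl sumr_ge0.
have ab w : (\esum_(x in Dm w) `|f w x|%:E <= \esum_(x in [set x | Wset m x /\ Kr m J L w x]) `|G x|%:E)%E.
  apply: esum_le_supp => // x Dx; rewrite normr_eq0 => /(fle w x Dx) [h1 h2]; split; first by case: Dx.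
  by rewrite [leRHS]ger0_norm.
have as1 w : Wset m w -> asummable (Dm w) (f w) by move=> Ww; apply: (le_lt_trans (ab w)); apply: sc1.
split=> //; apply: sc2 => w Ww; apply: le_trans (ab w); apply: rsum_abs; exact: as1.
Qed.

(** The sign of len x alternates under x -> x s and makes the last vertex cancel; the sign of len w
    compensates [Ic_step]. *)
Definition sgn w x p : R := (-1) ^+ (len x + len w) * eps p.

Lemma sgn_abs w x p : `|sgn w x p| <= 1.
Proof. by rewrite /sgn normrM normrX normrN1 expr1n mul1r eps_abs. Qed.

Lemma sgn_ne0 w x p : sgn w x p != 0 -> uniq p /\ sset p \subset J.
Proof. by rewrite /sgn mulf_eq0 negb_or => /andP[_ /eps_ne0]. Qed.

Definition Fr (f : bool) k i b V w x : R :=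
  sumseq i (fun p => sgn w x p * b (sset p) x * Ic (remk k (base f x ++ pts x p)) w (enum V)).
Definition Fx (f : bool) i b V w x : R :=
  sumseq i (fun p => sgn w x p * b (sset p) x * Ic (base f x ++ pts x p) w (enum V)).
(* For [f = true] the coned, for [f = false] the unconed transform of the chain [b]: each
   flag simplex is intersected with the dual faces of all chambers of its J-coset. *)
Definition HH (f : bool) i b V w : R := rsum (Dm w) (Fx f i b V w).

Lemma mem_base_pts (f : bool) x p k : k \in base f x ++ pts x p -> same (sset p) x k.1 \/ k = kb x.
Proof.
rewrite mem_cat => /orP[|/mem_pts [U -> sub]]; first by case: f => //=; rewrite inE => /eqP; right.
by left; apply: same_sub sub _; apply: crep_same.
Qed.

Lemma Fx_bound (f : bool) i b V : Adm b -> V \subset J -> #|V| = (i + f)%N ->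
  (forall w, Wset m w -> asummable (Dm w) (Fx f i b V w)) /\ l2 m q (HH f i b V).
Proof.
move=> Ab VJ cV; apply: (core_bound (ks := fun p x => base f x ++ pts x p) (a := sgn)) => //.
  exact: sgn_abs.
move=> w x p sp /sgn_ne0 [u sub]; split=> //; split=> [|k]; last exact: mem_base_pts.
by rewrite size_cat size_pts sp; case: f cV => /= ->; lia.
Qed.

Lemma Ic_dd ks w U : uniq ks -> size ks = #|U|.+2 ->
  \sum_(s | (s \in J) && (s \notin U)) (-1) ^+ pos s (s |: U)%SET * Ic ks w (enum (s |: U)%SET)
   = - \sum_(k < #|U|.+2) (-1) ^+ k * Ic (remk k ks) w (enum U).
Proof.
move=> uk sk; have sr : size (enum U) = #|U| by rewrite -cardE.
have := incidence_identity thg J w uk (enum_uniq U) sk sr.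
set X := \sum_(k < _) _; set Y := \sum_(s | _) _ => e.
suff -> : \sum_(s | (s \in J) && (s \notin U)) (-1) ^+ pos s (s |: U)%SET * Ic ks w (enum (s |: U)%SET)
     = (-1) ^+ #|U| * Y.
  apply/eqP; rewrite -addr_eq0; apply/eqP.
  have := congr1 (fun z => (-1) ^+ #|U| * z) e; rewrite mulr0 mulrDr mulrA -exprD addnn -signr_odd odd_double mul1r.
  by rewrite addrC.
rewrite /Y mulr_sumr; apply: eq_big => [s|s /andP[sJ sU]]; first by rewrite mem_enum.
have [A [B [e1 e2 e3]]] := enum_setU1 sU.
rewrite e2 e1 Ic_move mulrA -exprD; congr (_ * _).
rewrite -sr e1 size_cat -e3 -signr_odd -[RHS]signr_odd; congr (_ ^+ nat_of_bool _).
by rewrite !oddD; case: (odd _); case: (odd _).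
Qed.

Lemma Fx_dd (f : bool) i b U w x : #|U|.+1 = (i + f)%N ->
  \sum_(s | (s \in J) && (s \notin U)) (-1) ^+ pos s (s |: U)%SET * Fx f i b (s |: U)%SET w x
   = - \sum_(k < #|U|.+2) (-1) ^+ k * Fr f k i b U w x.
Proof.
move=> cU; rewrite /Fx /Fr; under eq_bigr do rewrite -sumseqZ; rewrite -sumseq_sum.
under [X in _ = - X]eq_bigr do rewrite -sumseqZ.
rewrite -sumseq_sum -[RHS]mulN1r -sumseqZ; apply: eq_sumseq => p sp.
have [e0|/sgn_ne0 [u sub]] := eqVneq (sgn w x p) 0.
  by rewrite !big1 ?mulr0 // => s _; rewrite e0 !mul0r mulr0.
under eq_bigr do rewrite mulrCA; rewrite -mulr_sumr.
rewrite Ic_dd; [|exact: uniq_pts|by rewrite size_cat size_pts sp; case: f cU => /=; lia].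
rewrite mulrN mulN1r; congr (- _); rewrite mulr_sumr; apply: eq_bigr => k _; by rewrite mulrCA.
Qed.

Lemma Fr_base i b V w x : Fr true 0 i b V w x = Fx false i b V w x.
Proof. by apply: eq_sumseq => p _; rewrite /remk /= drop0. Qed.

Lemma Fr_top (f : bool) i b V w x : Fr f f i.+1 b V w x = Fx f i (ddJ b) V w x.
Proof.
rewrite /Fr /= -sumseq_sum; apply: eq_sumseq => p _.
under eq_bigr do rewrite -/(pts x (_ :: p)) remk_top.
rewrite -mulr_suml; congr (_ * _); rewrite /sgn -mulrA -eps_top mulr_sumr.
by apply: eq_bigr => s _; rewrite mulrA.
Qed.

Lemma Fr_mid (f : bool) j i b V w x : (j.+1 < i)%N -> Fr f (f + j.+1) i b V w x = 0.
Proof.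
move=> ji; apply: (sumseq_swap ji) => A s t B sA.
rewrite !remk_base -sA remk_mid sset_swap /sgn eps_swap.
by rewrite mulrN !mulNr.
Qed.

Lemma Dm_bij w s : s \in J -> set_bij (Dm w) (Dm w) (fun x => nf (x ++ [:: s])).
Proof.
move=> sJ; have oJ : inW m J [:: s] by apply: over_inW; rewrite /over /= sJ.
have inv x : Wset m x -> nf (nf (x ++ [:: s]) ++ [:: s]) = x.
  move=> Wx; rewrite -[RHS]Wx; apply: nf_eq; apply: cox_trans (catss hm x s).
  by apply: cox_catr; apply: cox_nfl.
have st x : Dm w x -> Dm w (nf (x ++ [:: s])).
  move=> [Wx sm]; split; first exact: Wset_nf.
  apply: (same_trans hm sm); apply: (same_trans hm (same_cat hm x oJ)); apply: same_eq => //.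
  exact: cox_nf.
split=> //.
- by move=> x y /set_mem [Wx _] /set_mem [Wy _] e; rewrite -(inv x Wx) e inv.
- by move=> x Dx; exists (nf (x ++ [:: s])); [exact: st|apply: inv; case: Dx].
Qed.

Lemma Fr_last (f : bool) i b V w : Adm b -> V \subset J -> #|V|.+1 = (i.+1 + f)%N -> Wset m w ->
  asummable (Dm w) (Fr f (f + i.+1) i.+1 b V w) /\ rsum (Dm w) (Fr f (f + i.+1) i.+1 b V w) = 0.
Proof.
move=> Ab VJ cV Ww.
pose ks p x := remk (f + i.+1) (base f x ++ pts x p).
(* Flags are grouped by last letter so that x -> x s acts on each group; the default of [last] is
   never taken, as p is nonempty. *)
pose a s w x p : R := (if last s p == s then 1 else 0) * sgn w x p.
pose Fl s x := sumseq i.+1 (fun p => a s w x p * b (sset p) x * Ic (ks p x) w (enum V)).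
have gk w' x p : size p = i.+1 -> sgn w' x p != 0 -> sset p \subset J /\ good_keys V p x (ks p x).
  move=> sp /sgn_ne0 [u sub]; split=> //; split=> [|k /mem_remk]; last exact: mem_base_pts.
  rewrite size_remk size_cat size_pts sp; case: f cV {ks Fl} => /=; lia.
have aFl s : asummable (Dm w) (Fl s).
  have := @core_bound b i.+1 V ks (a s) Ab VJ => H; apply: (H _ _).1 => //.
    move=> w' x p; rewrite /a normrM; case: ifP => _; last by rewrite normr0 mul0r.
    by rewrite normr1 mul1r sgn_abs.
  move=> w' x p sp; rewrite /a mulf_eq0 negb_or => /andP[_]; exact: gk.
have E x : Fr f (f + i.+1) i.+1 b V w x = \sum_s Fl s x.
  rewrite /Fl -sumseq_sum; apply: eq_sumseq => -[|t p] // _.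
  rewrite /a -!mulr_suml /= (bigD1 (last t p)) //= eqxx big1 ?addr0 ?mul1r // => s ns.
  by rewrite eq_sym (negbTE ns).
split; first by rewrite (funext E); apply: asummable_sum.
rewrite (eq_rsum (g := fun x => \sum_s Fl s x)) // rsum_sum // big1 // => s _.
have [sJ|sJ] := boolP (s \in J); last first.
  apply: rsum0 => x _; apply: sumseq0 => p sp; rewrite /a.
  have [e|_] := eqVneq (last s p) s; last by rewrite !mul0r.
  have [->|/sgn_ne0 [_ /fintype.subsetP sub]] := eqVneq (sgn w x p) 0; first by rewrite mulr0 !mul0r.
  case/negP: sJ; apply: sub; rewrite inE -[in X in X \in _]e.
  by case: p sp {e} => //= t p _; rewrite mem_last.
apply: (rsum_anti (e := fun x => nf (x ++ [:: s]))); first exact: Dm_bij.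
move=> x [Wx sm]; rewrite -mulN1r -sumseqZ; apply: eq_sumseq => p sp.
rewrite /a; have [e|_] := eqVneq (last s p) s; last by rewrite !mul0r mulr0.
have [p' ep] : exists p', p = rcons p' s.
  by case/lastP: p sp e => // p' t _; rewrite last_rcons => <-; exists p'.
have sp' : size p' = i by move: sp; rewrite ep size_rcons => -[].
set y := nf (x ++ [:: s]).
have sxy : same [set s]%SET x y.
  apply: (same_trans hm (same_cat hm x (u := [:: s]) _)); first by apply: over_inW; rewrite /over /= inE eqxx.
  by apply: same_eq => //; apply: cox_nf.
have -> : b (sset p) y = b (sset p) x.
  symmetry; apply: (adm_inv Ab); apply: same_sub sxy.
  by rewrite finset.sub1set inE ep mem_rcons inE eqxx.
have -> : ks p y = ks p x.
  have rl := remk_last p' (same_sym hm sxy); rewrite sp' in rl.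
  rewrite /ks !remk_base ep rl; congr (_ ++ _).
  case: (f) => //=; congr [:: (_, _)]; apply: brep_eq; apply: same_sym => //.
  by apply: same_sub sxy; rewrite finset.sub1set.
have -> : sgn w y p = - sgn w x p.
  rewrite /sgn -mulNr; congr (_ * _); rewrite !exprD -mulNr; congr (_ * _).
  rewrite -signr_odd -[in RHS]signr_odd (len_eq (cox_nfl m _)) !odd_len size_cat oddD /=.
  by case: (odd _) => /=; rewrite ?expr0 ?expr1 ?opprK.
by rewrite !(mulrN, mulNr, mul1r).
Qed.

(* Interior vertices of a flag cancel under exchanging two neighbouring letters, the last
   vertex cancels under right multiplication by the last letter. *)
Lemma HH_dd (f : bool) i b U w : Adm b -> U \subset J -> #|U|.+1 = (i.+1 + f)%N -> Wset m w ->
  ddJ (HH f i.+1 b) U w =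
  - ((if f then HH false i.+1 b U w else 0) + (-1) ^+ f * HH f i (ddJ b) U w).
Proof.
move=> Ab UJ cU Ww; rewrite /ddJ /HH.
have UsJ s : (s \in J) && (s \notin U) -> (s |: U)%SET \subset J /\ #|(s |: U)%SET| = (i.+1 + f)%N.
  by move=> /andP[sJ sU]; rewrite finset.subUset finset.sub1set sJ UJ cardsU1 sU add1n.
under eq_bigr do rewrite -rsum_sign.
rewrite -rsum_sum; last first.
  by move=> s hs; apply: asummableZ; have [h1 h2] := UsJ s hs; apply: (Fx_bound Ab h1 h2).1.
rewrite (eq_rsum (fun x _ => Fx_dd b w x cU)) rsumN; congr (- _).
have [aL rL] := Fr_last Ab UJ cU Ww.
have adT : asummable (Dm w) (Fx f i (ddJ b) U w).
  by apply: (Fx_bound _ UJ _).1 => //; [exact: Adm_dd|case: f cU {aL rL UsJ} => /=; lia].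
case: f cU aL rL adT {UsJ} => cU aL rL adT.
- have cU' : #|U| = i.+1 by move: cU => /=; lia.
  have aF : asummable (Dm w) (Fx false i.+1 b U w).
    by apply: (Fx_bound Ab UJ _).1 => //; rewrite cU' addn0.
  rewrite (eq_rsum (g := fun x => Fx false i.+1 b U w x + ((-1) * Fx true i (ddJ b) U w x +
     (-1) ^+ i.+2 * Fr true (true + i.+1) i.+1 b U w x))); last first.
    move=> x _; rewrite cU' big_ord_recl big_ord_recl big_ord_recr /= expr0 mul1r Fr_base.
    rewrite big1 ?add0r => [|k _]; last by rewrite (Fr_mid true (j := k)) ?mulr0 // ltnS.
    by rewrite /bump /= expr1 (Fr_top true).
  rewrite rsumD //; last by apply: asummableD; apply: asummableZ.
  rewrite rsumD; [|exact: asummableZ|exact: asummableZ].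
  by rewrite rsum_sign rL mulr0 addr0 rsumZ // expr1.
have cU' : #|U| = i by move: cU => /=; lia.
rewrite (eq_rsum (g := fun x => Fx false i (ddJ b) U w x +
     (-1) ^+ i.+1 * Fr false (false + i.+1) i.+1 b U w x)); last first.
  move=> x _; rewrite cU' big_ord_recl big_ord_recr /= expr0 mul1r (Fr_top false).
  by rewrite big1 ?add0r => [|k _]; last by rewrite (Fr_mid false (j := k)) ?mulr0 // ltnS.
rewrite rsumD //; last exact: asummableZ.
by rewrite rsum_sign rL mulr0 addr0 expr0 mul1r add0r.
Qed.

Definition ind V w : {set 'I_n} -> word n -> R :=
  fun U x => if (U == V) && `[< same V w x >] then 1 else 0.

(** By [Ic_local] only flags ending in the cell of [w] and [V] contribute, so [b] enters through a
    single value. *)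
Lemma Fx_local i b V w x : Adm b -> V \subset J -> #|V| = i -> same J w x ->
  Fx false i b V w x = b V w * Fx false i (ind V w) V w x.
Proof.
move=> Ab VJ cV sm; rewrite /Fx -sumseqZ; apply: eq_sumseq => p sp.
have [->|/sgn_ne0 [u sub]] := eqVneq (sgn w x p) 0; first by rewrite !mul0r mulr0.
have [->|nI] := eqVneq (Ic (base false x ++ pts x p) w (enum V)) 0; first by rewrite !mulr0.
have sk : size (base false x ++ pts x p) = #|V|.+1 by rewrite size_pts sp cV.
have cp : #|sset p| = #|V| by rewrite card_sset // sp cV.
have hk k : k \in base false x ++ pts x p -> same (sset p) x k.1.
  by move=> /mem_pts [U -> sU]; apply: same_sub sU _; apply: crep_same.
have [-> sxw] := Ic_local hm th0 VJ sk nI cp sub sm hk.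
rewrite /ind eqxx asboolT /=; last exact: same_sym.
by rewrite (adm_inv Ab sxw) mulr1 [_ * b V w]mulrC mulrA.
Qed.

Lemma same0 x y : same finset.set0 x y -> x ~ y.
Proof.
move=> /(sameP hm) [[|t u]]; first by rewrite cats0.
by rewrite /over /= inE.
Qed.

Lemma ddJ_single (X : {set 'I_n} -> word n -> R) U s w : s \in J -> s \notin U ->
  (forall t, t \in J -> t != s -> t \notin U -> X (t |: U)%SET w = 0) ->
  ddJ X U w = (-1) ^+ pos s (s |: U)%SET * X (s |: U)%SET w.
Proof.
move=> sJ sU h; rewrite /ddJ (bigD1 s) ?sJ //= big1 ?addr0 // => t /andP[/andP[tJ tU] ts].
by rewrite h ?mulr0.
Qed.

(* The unconed transform is local, hence a multiple of [b]; the multiple is found by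
   comparing boundaries of the indicator of a single cell. *)
Lemma HH_false i b V w : Adm b -> V \subset J -> #|V| = i -> Wset m w ->
  HH false i b V w = (-1) ^+ i * b V w.
Proof.
elim: i b V w => [|i IH] b V w Ab VJ cV Ww.
  have Dw : Dm w w by split=> //; apply: same_refl.
  rewrite expr0 mul1r /HH (rsum_single Dw) => [|x [Wx sm] xw].
    have V0 : V = finset.set0 by apply: cards0_eq.
    have s0 : sset ([::] : seq 'I_n) = finset.set0 by apply/setP => t; rewrite !inE.
    rewrite /Fx /= /sgn /= s0 V0 enum_set0 (Ic0 hm th0) /=; last by apply: same0; apply: crep_same.
    by rewrite addnn -signr_odd odd_double expr0 !mul1r mulr1.
  rewrite (Fx_local Ab) // /Fx /= /ind.
  case: asboolP => [sw|_]; last by rewrite andbF mulr0 mul0r mulr0.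
  rewrite (cards0_eq cV) in sw; case/eqP: xw; exact: Wset_inj Wx Ww (cox_sym (same0 sw)).
have Z b' (T : {set 'I_n}) : Adm b' -> T \subset J -> #|T| = i.+1 -> b' T w = 0 -> HH false i.+1 b' T w = 0.
  by move=> Ab' TJ cT e; apply: rsum0 => x [Wx sm]; rewrite (Fx_local Ab') // e mul0r.
have [e|nz] := eqVneq (b V w) 0; first by rewrite (Z b) // e mulr0.
have sV := adm_sph Ab nz; have A1 := Adm_indicator hm hq w sV; rewrite -/(ind V w) in A1.
have b1 : ind V w V w = 1 by rewrite /ind eqxx asboolT //; apply: same_refl.
have [a1 _] := Fx_bound (f := false) A1 VJ (etrans cV (esym (addn0 _))).
have -> : HH false i.+1 b V w = b V w * HH false i.+1 (ind V w) V w.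
  by rewrite /HH -rsumZ; [apply: eq_rsum => x [_ sm]; exact: Fx_local|exact: a1].
rewrite mulrC; congr (_ * _).
have [s sV'] : exists s, s \in V by apply/card_gt0P; rewrite cV.
pose U := (V :\ s)%SET; have eV : (s |: U)%SET = V by apply: finset.setD1K.
have sU : s \notin U by rewrite !inE eqxx.
have sJ : s \in J by apply: (fintype.subsetP VJ).
have UJ : U \subset J by apply: fintype.subset_trans VJ; rewrite -eV finset.subsetUr.
have cU : #|U| = i by move: cV; rewrite -eV cardsU1 sU => -[].
have tV t : t != s -> t \notin U -> (t |: U)%SET != V.
  move=> ts tU; apply/eqP => e; case/negP: tU; rewrite !inE ts -e setU11 //.
(* At the type U = V - s both boundaries reduce to the term of V, so the scalar in degree i + 1 is
   minus the one in degree i. *)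
have := @HH_dd false i (ind V w) U w A1 UJ _ Ww; rewrite cU addn0 => /(_ erefl).
rewrite add0r expr0 mul1r (IH _ _ _ (Adm_dd hq _ A1)) //.
rewrite !(@ddJ_single _ U s w) ?eV ?b1 ?mulr1 //.
- have s1 : (-1) ^+ pos s V != 0 :> R by rewrite signr_eq0.
  by rewrite mulrC -mulNr => /(mulIf s1) ->; rewrite exprS mulN1r.
- by move=> t _ ts tU; rewrite /ind (negbTE (tV t ts tU)).
- move=> t tJ ts tU; apply: (Z _ _ A1); first by rewrite finset.subUset finset.sub1set tJ.
    by rewrite cardsU1 tU cU.
  by rewrite /ind (negbTE (tV t ts tU)).
Qed.

(** For t in [V], right multiplication by t changes both the length sign and, by [Ic_step], the
    intersection number. *)
Lemma HH_same (f : bool) i b V w w' : V \subset J -> same V w w' -> HH f i b V w = HH f i b V w'.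
Proof.
move=> VJ /(sameP hm) [u ou e].
have Deq v v' : same J v v' -> Dm v = Dm v'.
  move=> sm; apply/seteqP; split=> x [Wx sx]; split=> //; last exact: (same_trans hm sm sx).
  exact: (same_trans hm (same_sym hm sm) sx).
have E v v' : v ~ v' -> HH f i b V v = HH f i b V v'.
  move=> h; rewrite /HH (Deq v v'); last exact: same_eq.
  apply: eq_rsum => x _; apply: eq_sumseq => p _; by rewrite /sgn (len_eq h) (Ic_eq hm _ _ _ _ h).
have stp v t : t \in V -> HH f i b V (v ++ [:: t]) = HH f i b V v.
  move=> tV; rewrite /HH (Deq (v ++ [:: t]) v); last first.
    apply: same_sym => //; apply: same_cat => //; apply: over_inW.
    by rewrite /over /= andbT; apply: (fintype.subsetP VJ).
  apply: eq_rsum => x _; apply: eq_sumseq => p _; rewrite Ic_step ?mem_enum //.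
  have -> : sgn (v ++ [:: t]) x p = - sgn v x p.
    rewrite /sgn -mulNr; congr (_ * _); rewrite !exprD -mulrN; congr (_ * _).
    rewrite -signr_odd -[in RHS]signr_odd !odd_len size_cat oddD /=.
    by case: (odd _) => /=; rewrite ?expr0 ?expr1 ?opprK.
  by rewrite !(mulrN, mulNr) opprK.
rewrite -(E _ _ e); elim/last_ind: u ou {e} => [|u t IH]; first by rewrite cats0.
rewrite /over all_rcons => /andP[/= tV ou].
by rewrite -cats1 catA (stp (w ++ u) t tV); apply: IH.
Qed.

(** In [HH_dd] for the cone, the term with [ddJ b] vanishes on cycles and the unconed term is
    (-1)^(i+1) b by [HH_false]; the factor (-1)^i in [c] makes the result b. *)
Lemma core_exact i b : Adm b -> (forall (V : {set 'I_n}) x, b V x != 0 -> #|V| = i.+1) ->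
  (forall (T : {set 'I_n}) x, T \subset J -> ddJ b T x = 0) ->
  exists c, [/\ Adm c, forall (V : {set 'I_n}) x, c V x != 0 -> V \subset J /\ #|V| = i.+2 &
    forall (V : {set 'I_n}) x, V \subset J -> ddJ c V x = b V x].
Proof.
move=> Ab sb cy.
pose c V x := if (V \subset J) && (#|V| == i.+2) then (-1) ^+ i * HH true i.+1 b V (nf x) else 0.
have cE V x : (V \subset J) && (#|V| == i.+2) -> c V x = (-1) ^+ i * HH true i.+1 b V (nf x).
  by rewrite /c => ->.
have c0 V x : ~~ ((V \subset J) && (#|V| == i.+2)) -> c V x = 0.
  by rewrite /c => /negbTE ->.
move: c cE c0 => c cE c0.
exists c; split; [split| | ].
- move=> V x y sm.
  have snf : same V (nf x) (nf y).
    apply: (same_trans hm (same_eq hm V (cox_nfl m x))).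
    exact: (same_trans hm sm (same_eq hm V (cox_nf m y))).
  have [h|h] := boolP ((V \subset J) && (#|V| == i.+2)); last by rewrite !c0.
  have /andP[VJ _] := h; rewrite (cE _ _ h) (cE _ _ h).
  by rewrite (HH_same true i.+1 b VJ snf).
- move=> V x; have [h|h] := boolP ((V \subset J) && (#|V| == i.+2)); last by rewrite c0 // eqxx.
  have /andP[VJ /eqP cV] := h; rewrite (cE _ _ h).
  rewrite mulf_eq0 negb_or => /andP[_ nz]; apply: contrapT => nV; move/eqP: nz; apply.
  apply: rsum0 => y [Wy sm]; apply: sumseq0 => p sp.
  have [->|nI] := eqVneq (Ic (base true y ++ pts y p) (nf x) (enum V)) 0; first by rewrite mulr0.
  case: nV; apply: (Ic_spherical hm th0 _ nI); by rewrite /= size_pts sp cV.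
- move=> V; have [h|h] := boolP ((V \subset J) && (#|V| == i.+2)); last first.
    by rewrite /l2 esum1 // => x _; rewrite c0 // expr0n mul0r.
  have /andP[VJ /eqP cV] := h.
  have hl : l2 m q (HH true i.+1 b V) by apply: (Fx_bound (f := true) Ab VJ _).2; rewrite cV addn1.
  apply: (l2_le hq) (l2Z hq ((-1) ^+ i) hl) => x Wx; by rewrite (cE _ _ h) Wx.
- move=> V x nz; have [h|h] := boolP ((V \subset J) && (#|V| == i.+2)).
    by have /andP[VJ /eqP cV] := h.
  by rewrite c0 // eqxx in nz.
- move=> U x UJ; have [cU|cU] := eqVneq #|U| i.+1; last first.
    have -> : b U x = 0 by apply/eqP/negPn/negP => /sb e; rewrite e eqxx in cU.
    rewrite /ddJ big1 // => s /andP[_ sU]; rewrite c0 ?mulr0 //.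
    by rewrite cardsU1 sU add1n eqSS (negbTE cU) andbF.
  have -> : b U x = b U (nf x) by apply: (adm_inv Ab); apply: same_eq => //; apply: cox_nf.
  have -> : ddJ c U x = (-1) ^+ i * ddJ (HH true i.+1 b) U (nf x).
    rewrite /ddJ mulr_sumr; apply: eq_bigr => s /andP[sJ sU].
    rewrite cE 1?mulrCA //.
    by rewrite finset.subUset finset.sub1set sJ UJ cardsU1 sU cU eqxx.
  rewrite (HH_dd Ab UJ _ (Wset_nf m x)); last by rewrite cU addn1.
  have -> : HH true i (ddJ b) U (nf x) = 0.
    apply: rsum0 => y _; apply: sumseq0 => p _.
    have [->|/sgn_ne0 [_ sub]] := eqVneq (sgn (nf x) y p) 0; first by rewrite !mul0r.
    by rewrite cy // mulr0 mul0r.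
  rewrite mulr0 addr0 (HH_false Ab UJ cU (Wset_nf m x)) exprS mulN1r mulNr opprK mulrA -exprD addnn.
  by rewrite -signr_odd odd_double mul1r.
Qed.
End Core.

(** * Exactness for intervals of types *)

Section Exactness.
Variables (R : realType) (n : nat) (m : 'I_n -> 'I_n -> nat) (q : 'I_n -> R).
Hypothesis hm : coxeter_matrix m.
Hypothesis hq : multiparameter m q.
Local Notation Adm := (Adm m q).
Implicit Types (b c e f : {set 'I_n} -> word n -> R) (U V T J : {set 'I_n}) (s t u : 'I_n) (x : word n).
Local Open Scope set_scope.
Local Notation disj A B := (fintype.disjoint (mem A) (mem B)).

Definition lincomb (a1 : R) b (a2 : R) f : {set 'I_n} -> word n -> R := fun V x => (a1 * b V x + a2 * f V x)%R.
Definition restrict (P : pred {set 'I_n}) b : {set 'I_n} -> word n -> R := fun V x => if P V then b V x else 0%R.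

Lemma Adm_lincomb (a1 a2 : R) b f : Adm b -> Adm f -> Adm (lincomb a1 b a2 f).
Proof.
move=> [h1 h2 h3] [g1 g2 g3]; split.
- by move=> V x y sm; rewrite /lincomb (h1 V x y sm) (g1 V x y sm).
- move=> V x; rewrite /lincomb; have [->|/h2 //] := eqVneq (b V x) 0%R.
  have [->|/g2 //] := eqVneq (f V x) 0%R; by rewrite !mulr0 addr0 eqxx.
- by move=> V; apply: (l2D hq); apply: (l2Z hq).
Qed.

Lemma Adm_restrict P b : Adm b -> Adm (restrict P b).
Proof.
move=> [h1 h2 h3]; split.
- by move=> V x y sm; rewrite /restrict (h1 V x y sm).
- by move=> V x; rewrite /restrict; case: ifP; rewrite ?eqxx // => _ /h2.
- by move=> V; apply: (l2_le hq) (h3 V) => x _; rewrite /restrict; case: ifP; rewrite ?normr0.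
Qed.

Lemma Adm0 : Adm (fun _ _ => 0%R).
Proof.
split=> [//|V x|V]; first by rewrite eqxx.
by rewrite /l2 esum1 // => x _; rewrite expr0n mul0r.
Qed.

Lemma ddJ_lincomb J (a1 a2 : R) b f T x :
  ddJ J (lincomb a1 b a2 f) T x = (a1 * ddJ J b T x + a2 * ddJ J f T x)%R.
Proof.
rewrite /ddJ !mulr_sumr -big_split; apply: eq_bigr => s _ /=; rewrite /lincomb; ring.
Qed.

(** The complex for u + J is a mapping cone of two J-complexes, on the types with and without u;
    [Ex_link] and [Ex_join] rest on this splitting. *)
Lemma ddJ_setU1 u J b T x : u \notin J -> ddJ (u |: J) b T x =
  ((if u \notin T then (-1) ^+ pos u (u |: T) * b (u |: T) x else 0) + ddJ J b T x)%R.
Proof.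
move=> uJ; rewrite /ddJ; have [uT|uT] := boolP (u \in T) => /=.
  rewrite add0r; apply: eq_bigl => s; rewrite !inE.
  by have [->|//] := eqVneq s u; rewrite uT (negbTE uJ).
rewrite (bigD1 u) /=; last by rewrite !inE eqxx.
congr (_ + _)%R; apply: eq_bigl => s; rewrite !inE.
by have [->|_] := eqVneq s u; rewrite ?(negbTE uJ) ?andbF ?andbT.
Qed.

Lemma pos_setU1 s t T : s != t -> s \notin T -> pos t (s |: T) = ((s < t)%N + pos t T)%N.
Proof.
move=> st sT; rewrite /pos.
have -> : [set x in s |: T | (x < t)%N] =
    if (s < t)%N then s |: [set x in T | (x < t)%N] else [set x in T | (x < t)%N].
  by apply/setP => x; case: ifP => h; rewrite !inE; have [->|] := eqVneq x s; rewrite ?h ?andbF //= (negbTE sT).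
by case: ifP => h; rewrite ?cardsU1 ?inE ?(negbTE sT).
Qed.

Lemma ddJ_ddJ J b T x : ddJ J (ddJ J b) T x = 0%R.
Proof.
pose G s t : R := if [&& s \in J, s \notin T, t \in J, t \notin T & s != t] then
  ((-1) ^+ (pos s (s |: T) + pos t (t |: (s |: T))) * b (t |: (s |: T)) x)%R else 0%R.
have -> : ddJ J (ddJ J b) T x = (\sum_s \sum_t G s t)%R.
  rewrite /ddJ big_mkcond; apply: eq_bigr => s _; rewrite /G; case: (boolP (s \in J)) => sJ /=; last by rewrite big1.
  case: (boolP (s \in T)) => sT /=; first by rewrite big1.
  rewrite mulr_sumr big_mkcond; apply: eq_bigr => t _; rewrite !inE negb_or [t == s]eq_sym.
  by case: (t \in J) => //=; case: (t \in T); rewrite ?andbF //=; case: (s == t) => //=; rewrite mulrA exprD.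
set X := (\sum_s _)%R; suff : (X = - X)%R by move=> ?; lra.
rewrite {1}/X exchange_big -sumrN; apply: eq_bigr => s _; rewrite -sumrN; apply: eq_bigr => t _.
rewrite /G.
have -> : [&& t \in J, t \notin T, s \in J, s \notin T & t != s] = [&& s \in J, s \notin T, t \in J, t \notin T & s != t].
  by rewrite [t == s]eq_sym; case: (t \in J); case: (t \in T); case: (s \in J); case: (s \in T).
case: ifP => [|_]; last by rewrite oppr0.
move=> /and5P[_ sT _ tT st]; have ts : t != s by rewrite eq_sym.
have p0 (a : 'I_n) (A : {set 'I_n}) : a \notin A -> pos a (a |: A) = pos a A.
  by move=> aA; rewrite /pos; apply: eq_card => z; rewrite !inE; have [->|] := eqVneq z a; rewrite ?ltnn ?andbF.
have sT' : s \notin t |: T by rewrite !inE negb_or st.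
have tT' : t \notin s |: T by rewrite !inE negb_or ts.
rewrite (p0 _ _ sT) (p0 _ _ tT) (p0 _ _ sT') (p0 _ _ tT') (pos_setU1 ts tT) (pos_setU1 st sT).
rewrite finset.setUCA -mulNr; congr (_ * _)%R; rewrite !exprD.
move: st; rewrite -val_eqE /= => st.
by case: ltngtP st => //= _ _; rewrite ?expr0 ?expr1; ring.
Qed.

(** The degree [d] is |V| itself, not counted relative to [U]. *)
Definition suppz U J d b := forall V x, ~~ [&& U \subset V, V \subset U :|: J & #|V| == d] -> b V x = 0%R.

(* Exactness in degree [d] of the complex of chains on the types [V], [U <= V <= U + J]. *)
Definition Ex U J d := forall b, Adm b -> suppz U J d b ->
  (forall T x, U \subset T -> T \subset U :|: J -> ddJ J b T x = 0%R) ->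
  exists c, [/\ Adm c, suppz U J d.+1 c &
    forall V x, U \subset V -> V \subset U :|: J -> ddJ J c V x = b V x].

Lemma Ex_core J d : in_R m J q -> (0 < d)%N -> Ex finset.set0 J d.
Proof.
case: d => // i hR _ b Ab sb cy; have [th th0 thg] := exists_generic R hm.
rewrite finset.set0U in cy *.
have nb V x : b V x != 0%R -> #|V| = i.+1.
  by move=> nz; apply/eqP; apply: contraNT nz => h; rewrite sb // (negbTE h) !andbF.
have [c [Ac sc dc]] := core_exact hm hq th0 thg hR Ab nb (fun T x => cy T x (finset.sub0set T)).
exists c; split=> // [V x|V x _]; last exact: dc.
rewrite finset.set0U finset.sub0set /=; apply: contraNeq => /sc [-> ->]; by rewrite eqxx.
Qed.

Lemma subset_notin u U J V : u \notin U -> u \notin J -> u \in V -> ~~ (V \subset U :|: J).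
Proof.
move=> uU uJ uV; apply/negP => /fintype.subsetP /(_ u uV); by rewrite inE (negbTE uU) (negbTE uJ).
Qed.

Lemma subset_setU1l u U J V : u \notin V -> (V \subset u |: (U :|: J)) = (V \subset U :|: J).
Proof.
move=> uV; apply/fintype.subsetP/fintype.subsetP => h s sV; have := h s sV; rewrite !inE.
  by have [e|] := eqVneq s u; first by rewrite -e sV in uV.
by move=> ->; rewrite orbT.
Qed.

(** The connecting map: the part [e] of the boundary of [b] on types without u is a cycle, filled by
    some [f] there. Then b - f is a cycle of the larger complex, and the part with u of its filling
    fills [b]. *)
Lemma Ex_link u U J d : u \notin U -> u \notin J ->
  Ex U (u |: J) d.+1 -> Ex U J d -> Ex (u |: U) J d.+1.
Proof.
move=> uU uJ E1 E2 b Ab sb cy.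
have eQ : (u |: U) :|: J = U :|: (u |: J) by rewrite finset.setUCA finset.setUA.
have eQ' : U :|: (u |: J) = u |: (U :|: J) by rewrite finset.setUCA.
have b0 V x : u \notin V -> b V x = 0%R.
  by move=> uV; rewrite sb // finset.subUset finset.sub1set (negbTE uV).
pose e := restrict (fun T => (u \notin T) && (U \subset T) && (T \subset U :|: J)) (ddJ (u |: J) b).
have Dbu T x : u \in T -> U \subset T -> T \subset U :|: (u |: J) -> ddJ (u |: J) b T x = 0%R.
  by move=> uT UT TQ; rewrite ddJ_setU1 // uT /= add0r cy // ?eQ // finset.subUset finset.sub1set uT.
have Ae : Adm e by apply: Adm_restrict; apply: Adm_dd.
have ecyc T x : U \subset T -> T \subset U :|: J -> ddJ J e T x = 0%R.
  move=> UT TQ; have uT : u \notin T by apply: contraL TQ; apply: subset_notin.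
  have := ddJ_ddJ (u |: J) b T x; rewrite ddJ_setU1 // uT Dbu ?mulr0 ?add0r.
  - move=> h; rewrite -[RHS]h; apply: eq_bigr => s /andP[sJ sT]; congr (_ * _)%R.
    rewrite /e /restrict !inE negb_or uT andbT.
    have -> : (u != s) by apply: contraNneq uJ => ->.
    have -> : U \subset s |: T by apply: (fintype.subset_trans UT); apply: finset.subsetUr.
    by rewrite finset.subUset finset.sub1set inE sJ orbT TQ.
  - by rewrite finset.setU11.
  - by apply: (fintype.subset_trans UT); apply: finset.subsetUr.
  - by rewrite eQ'; apply: finset.setUS.
have [f [Af sf df]] : exists f, [/\ Adm f, suppz U J d.+1 f &
    forall V x, U \subset V -> V \subset U :|: J -> ddJ J f V x = e V x].
  apply: E2 => // V x; rewrite /e /restrict; case: ifP => // /andP[/andP[uV UV] VQ].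
  rewrite UV VQ /= => cV; apply: big1 => s /andP[_ sV]; rewrite sb ?mulr0 //.
  by rewrite cardsU1 sV add1n eqSS (negbTE cV) !andbF.
have fu V x : u \in V -> f V x = 0%R.
  by move=> uV; rewrite sf // (negbTE (subset_notin uU uJ uV)) andbF.
have [c [Ac sc dc]] : exists c, [/\ Adm c, suppz U (u |: J) d.+2 c &
    forall V x, U \subset V -> V \subset U :|: (u |: J) -> ddJ (u |: J) c V x = lincomb 1 b (-1) f V x].
  apply: E1; first exact: Adm_lincomb.
    move=> V x h; rewrite /lincomb sb ?sf ?mulr0 ?addr0 //.
      apply: contraNN h => /and3P[-> VQ ->]; rewrite andbT /= eQ'.
      by apply: (fintype.subset_trans VQ); apply: finset.subsetUr.
    apply: contraNN h => /and3P[+ VQ ->]; rewrite finset.subUset => /andP[_ ->]; by rewrite -eQ VQ.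
  move=> T x UT TQ; rewrite ddJ_lincomb mul1r mulN1r.
  have [uT|uT] := boolP (u \in T).
    rewrite Dbu // add0r; apply/eqP; rewrite oppr_eq0; apply/eqP; apply: big1 => s _.
    by rewrite fu ?mulr0 // inE uT orbT.
  have TQ' : T \subset U :|: J by rewrite -(subset_setU1l _ _ uT) -eQ'.
  rewrite [X in (_ - X)%R]ddJ_setU1 // uT fu ?finset.setU11 // mulr0 add0r df //.
  by rewrite /e /restrict uT UT TQ' subrr.
exists (restrict (fun V => u \in V) c); split; first exact: Adm_restrict.
  move=> V x h; rewrite /restrict; case: ifP => // uV; apply: sc; apply: contraNN h.
  by move=> /and3P[UV VQ ->]; rewrite finset.subUset finset.sub1set uV UV eQ VQ.
move=> V x; rewrite finset.subUset finset.sub1set => /andP[uV UV]; rewrite eQ => VQ.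
have := dc V x UV VQ; rewrite ddJ_setU1 // uV /= add0r /lincomb fu // mulr0 addr0 mul1r => <-.
by apply: eq_bigr => s _; rewrite /restrict inE uV orbT.
Qed.

(** Fill the part of [b] on types with u; subtracting the full boundary of that filling leaves a
    cycle on types without u. *)
Lemma Ex_join u U J d : u \notin U -> u \notin J -> Ex U J d -> Ex (u |: U) J d -> Ex U (u |: J) d.
Proof.
move=> uU uJ E1 E2 b Ab sb cy.
have eQ : (u |: U) :|: J = U :|: (u |: J) by rewrite finset.setUCA finset.setUA.
have eQ' : U :|: (u |: J) = u |: (U :|: J) by rewrite finset.setUCA.
have [c1 [A1 s1 d1]] : exists c, [/\ Adm c, suppz (u |: U) J d.+1 c &
    forall V x, u |: U \subset V -> V \subset (u |: U) :|: J -> ddJ J c V x = restrict (fun V => u \in V) b V x].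
  apply: E2; first exact: Adm_restrict.
    move=> V x h; rewrite /restrict; case: ifP => // uV; apply: sb; apply: contraNN h.
    by move=> /and3P[UV VQ ->]; rewrite finset.subUset finset.sub1set uV UV eQ VQ.
  move=> T x; rewrite finset.subUset finset.sub1set => /andP[uT UT]; rewrite eQ => TQ.
  have := cy T x UT TQ; rewrite ddJ_setU1 // uT /= add0r => h; rewrite -[RHS]h.
  by apply: eq_bigr => s _; rewrite /restrict inE uT orbT.
have c10 V x : u \notin V -> c1 V x = 0%R.
  by move=> uV; rewrite s1 // finset.subUset finset.sub1set (negbTE uV).
pose b0 := restrict (fun V => U \subset V) (lincomb 1 b (-1) (ddJ (u |: J) c1)).
have b0u V x : u \in V -> V \subset U :|: (u |: J) -> b0 V x = 0%R.
  move=> uV VQ; rewrite /b0 /restrict; case: ifP => // UV.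
  by rewrite /lincomb ddJ_setU1 // uV /= add0r d1 ?eQ // ?finset.subUset ?finset.sub1set ?uV // /restrict uV mul1r mulN1r subrr.
have A0 : Adm b0 by apply: Adm_restrict; apply: Adm_lincomb => //; apply: Adm_dd.
have [c0 [Ac0 s0 d0]] : exists c, [/\ Adm c, suppz U J d.+1 c &
    forall V x, U \subset V -> V \subset U :|: J -> ddJ J c V x = b0 V x].
  apply: E1 => //.
    move=> V x h; have [UV|UV] := boolP (U \subset V); last by rewrite /b0 /restrict (negbTE UV).
    have [VQ|VQ] := boolP (V \subset U :|: (u |: J)); last first.
      rewrite /b0 /restrict UV /lincomb sb ?(negbTE VQ) ?andbF // mulr0 add0r.
      rewrite [ddJ _ _ _ _]big1 ?mulr0 // => s _; rewrite s1 ?mulr0 // eQ.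
      have -> : (s |: V \subset U :|: (u |: J)) = false by rewrite finset.subUset (negbTE VQ) andbF.
      by rewrite andbF.
    have [uV|uV] := boolP (u \in V); first exact: b0u.
    have VQ' : V \subset U :|: J by rewrite -(subset_setU1l _ _ uV) -eQ'.
    rewrite UV VQ' /= in h; rewrite /b0 /restrict UV /lincomb sb ?(negbTE h) ?andbF // mulr0 add0r.
    rewrite [ddJ _ _ _ _]big1 ?mulr0 // => s /andP[_ sV]; rewrite s1 ?mulr0 //.
    by rewrite cardsU1 sV add1n eqSS (negbTE h) !andbF.
  move=> T x UT TQ; have uT : u \notin T by apply: contraL TQ; apply: subset_notin.
  have TQ' : T \subset U :|: (u |: J) by rewrite eQ'; apply: (fintype.subset_trans TQ); apply: finset.subsetUr.
  have e1 : ddJ (u |: J) b0 T x = ddJ J b0 T x.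
    rewrite ddJ_setU1 // uT b0u ?mulr0 ?add0r ?finset.setU11 // finset.subUset TQ' andbT finset.sub1set !inE eqxx orbT //.
  rewrite -e1.
  have -> : ddJ (u |: J) b0 T x = ddJ (u |: J) (lincomb 1 b (-1) (ddJ (u |: J) c1)) T x.
    apply: eq_bigr => s _; congr (_ * _)%R; rewrite /b0 /restrict.
    by rewrite (fintype.subset_trans UT (finset.subsetUr _ _)).
  by rewrite ddJ_lincomb cy // ddJ_ddJ !mulr0 addr0.
have c0u V x : u \in V -> c0 V x = 0%R.
  by move=> uV; rewrite s0 // (negbTE (subset_notin uU uJ uV)) andbF.
exists (lincomb 1 c0 1 c1); split; first exact: Adm_lincomb.
  move=> V x h; rewrite /lincomb s0 ?s1 ?mulr0 ?addr0 //.
    apply: contraNN h => /and3P[+ VQ ->]; rewrite finset.subUset => /andP[_ ->]; by rewrite -eQ VQ.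
  apply: contraNN h => /and3P[-> VQ ->]; rewrite andbT /= eQ'.
  by apply: (fintype.subset_trans VQ); apply: finset.subsetUr.
move=> V x UV VQ; rewrite ddJ_lincomb !mul1r.
have [uV|uV] := boolP (u \in V).
  rewrite [X in (X + _)%R]big1 ?add0r => [|s _]; last by rewrite c0u ?mulr0 // inE uV orbT.
  by rewrite ddJ_setU1 // uV /= add0r d1 ?eQ // ?finset.subUset ?finset.sub1set ?uV // /restrict uV.
have VQ' : V \subset U :|: J by rewrite -(subset_setU1l _ _ uV) -eQ'.
rewrite [X in (X + _)%R]ddJ_setU1 // uV c0u ?finset.setU11 // mulr0 add0r d0 //.
rewrite /b0 /restrict UV /lincomb; ring.
Qed.

Lemma in_R_sub J (Q : {set 'I_n}) : J \subset Q -> in_R m Q q -> in_R m J q.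
Proof.
move=> JQ [h1 h2]; split=> //; apply: le_lt_trans h2; apply: esum_sub.
  by move=> C [u ou <-]; exists u => //; exact: over_sub ou.
by move=> C [u _ <-]; rewrite (wt_cls hm hq) lee_fin ltW // qe_gt0.
Qed.

Lemma disjoint_setU1 u U J : u \notin J -> disj U J -> disj (u |: U) J.
Proof.
move=> uJ dis; rewrite disjoint_subset; apply/fintype.subsetP => s; rewrite !inE.
by case/orP=> [/eqP -> //|sU]; rewrite (disjointFr dis).
Qed.

(** The elements of [U] are moved into [J] one by one. [Ex_core] needs positive degree and each
    [Ex_link] raises the degree by one, hence |U| < d. *)
Lemma Ex_in_R (Q : {set 'I_n}) U J d : in_R m Q q -> U :|: J \subset Q -> disj U J -> (#|U| < d)%N -> Ex U J d.
Proof.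
move=> hQ; move: {2}#|U| (erefl #|U|) => k; elim: k U J d => [|k IH] U J d cU UJQ dis Ud.
  rewrite (cards0_eq cU) in UJQ Ud *; apply: Ex_core; last by rewrite cards0 in Ud.
  by apply: in_R_sub hQ; rewrite finset.set0U in UJQ.
have [u uU] : exists u, u \in U by apply/card_gt0P; rewrite cU.
have uJ : u \notin J by rewrite (disjointFr dis).
pose U0 := U :\ u; have eU : u |: U0 = U by apply: finset.setD1K.
have uU0 : u \notin U0 by rewrite !inE eqxx.
have cU0 : #|U0| = k by move: cU; rewrite -eU cardsU1 uU0 => -[].
have dis0 : disj U0 J by apply: disjointWl dis; apply: finset.subD1set.
case: d Ud => // d Ud; rewrite cU ltnS in Ud; rewrite -eU; apply: Ex_link => //.
- apply: IH => //; first by rewrite finset.setUCA finset.setUA eU.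
    by rewrite disjoint_sym; apply: disjoint_setU1 => //; rewrite disjoint_sym.
  by rewrite cU0; apply: leqW.
- apply: IH => //; last by rewrite cU0.
  by apply: fintype.subset_trans UJQ; apply: finset.setSU; apply: finset.subD1set.
Qed.

Lemma Ex_vanish U J d : (forall b, Adm b -> suppz U J d b -> forall V x, b V x = 0%R) -> Ex U J d.
Proof.
move=> h b Ab sb _; exists (fun _ _ => 0%R); split=> [|//|V x _ _]; first exact: Adm0.
by rewrite (h b) //; apply: big1 => s _; rewrite mulr0.
Qed.

Variable k : nat.
Hypothesis hk : forall T : {set 'I_n}, spherical m T -> #|T| = k -> in_R m (St m T) q.

(** A spherical type above [U] only has letters in St(U), so admissible chains do not distinguish
    [J] from its part in St(U), where the convergence hypothesis applies. *)
Lemma Ex_top U J d : #|U| = k -> disj U J -> (k < d)%N -> Ex U J d.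
Proof.
move=> cU dis kd; have [sU|nU] := pselect (spherical m U); last first.
  apply: Ex_vanish => b Ab sb V x; apply/eqP/negPn/negP => nz; apply: nU.
  apply: sub_spherical (adm_sph Ab nz); apply: contraNT nz => h; by rewrite sb // (negbTE h).
pose J' := J :&: St m U.
have J'J : J' \subset J by apply: finset.subsetIl.
have UJ' : U :|: J' \subset U :|: J by apply: finset.setUS.
have USt : U \subset St m U.
  by apply/fintype.subsetP => s sU'; rewrite inE; apply/asboolP; exists U; rewrite finset.setUid.
have E : Ex U J' d.
  apply: (Ex_in_R (hk sU cU)); last by rewrite cU.
    by rewrite finset.subUset USt finset.subsetIr.
  by rewrite disjoint_sym; apply: disjointWl J'J _; rewrite disjoint_sym.
move=> b Ab sb cy.
have sphJ V : spherical m V -> U \subset V -> V \subset U :|: J -> V \subset U :|: J'.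
  move=> sV UV /fintype.subsetP VQ; apply/fintype.subsetP => s sV'; have := VQ s sV'; rewrite !inE.
  case/orP=> [->//|->]; apply/orP; right; apply/asboolP; exists V; split=> //.
  by rewrite (finset.setUidPl UV).
have zJ b' V x : Adm b' -> U \subset V -> V \subset U :|: J -> ~~ (V \subset U :|: J') -> b' V x = 0%R.
  move=> Ab' UV VQ; apply: contraNeq => /(adm_sph Ab') sV; exact: sphJ.
have ddE b' T x : Adm b' -> U \subset T -> T \subset U :|: J' -> ddJ J b' T x = ddJ J' b' T x.
  move=> Ab' UT TQ; rewrite /ddJ (bigID (fun s => s \in J')) /= [X in (_ + X)%R]big1 ?addr0.
    apply: eq_bigl => s; have [sJ'|] := boolP (s \in J'); last by rewrite andbF.
    by rewrite (fintype.subsetP J'J s sJ') /= andbT.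
  move=> s /andP[/andP[sJ sT] sJ']; rewrite zJ ?mulr0 //.
  - exact: (fintype.subset_trans UT (finset.subsetUr _ _)).
  - by rewrite finset.subUset finset.sub1set inE sJ orbT (fintype.subset_trans TQ).
  - rewrite finset.subUset finset.sub1set inE (negbTE sJ') orbF; apply: contraNN sT => /andP[sU' _].
    exact: (fintype.subsetP UT).
have [c [Ac sc dc]] : exists c, [/\ Adm c, suppz U J' d.+1 c &
    forall V x, U \subset V -> V \subset U :|: J' -> ddJ J' c V x = b V x].
  apply: E => // [V x h|T x UT TQ]; last by rewrite -ddE // cy // (fintype.subset_trans TQ).
  have [/and3P[UV VQ cV]|] := boolP [&& U \subset V, V \subset U :|: J & #|V| == d]; last exact: sb.
  by apply: zJ => //; apply: contraNN h => ->; rewrite UV cV.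
exists c; split=> // [V x h|V x UV VQ].
  by apply: sc; apply: contraNN h => /and3P[-> VQ ->]; rewrite andbT /= (fintype.subset_trans VQ).
have [VQ'|VQ'] := boolP (V \subset U :|: J'); first by rewrite ddE // dc.
rewrite (zJ b V x Ab UV VQ VQ'); apply: big1 => s _; rewrite sc ?mulr0 //.
have -> : (s |: V \subset U :|: J') = false by rewrite finset.subUset (negbTE VQ') andbF.
by rewrite andbF.
Qed.

(** The outer induction is on k - |U|, the inner one on |J|: for a letter of [J], the types without
    it have smaller [J], those with it have larger [U]. *)
Lemma Ex_all U J d : (#|U| <= k)%N -> disj U J -> (k < d)%N -> Ex U J d.
Proof.
move: {2}(k - #|U|)%N (erefl (k - #|U|)%N) => j; elim: j U J => [|j IH] U J ej Uk dis kd.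
  by apply: Ex_top => //; apply/eqP; rewrite eqn_leq Uk -subn_eq0 ej.
have Uk' : (#|U| < k)%N by rewrite -subn_gt0 ej.
move: {2}#|J| (erefl #|J|) => i; elim: i J dis => [|i IHi] J dis cJ.
  rewrite (cards0_eq cJ); apply: Ex_vanish => b Ab sb V x; apply: sb; rewrite finset.setU0.
  apply/negP => /and3P[UV VU /eqP cV]; have := subset_leq_card VU; rewrite cV => h.
  by have := leq_trans (ltn_trans Uk' kd) h; rewrite ltnn.
have [u uJ] : exists u, u \in J by apply/card_gt0P; rewrite cJ.
have uU : u \notin U by rewrite (disjointFl dis).
pose J0 := J :\ u; have eJ : u |: J0 = J by apply: finset.setD1K.
have uJ0 : u \notin J0 by rewrite !inE eqxx.
have cJ0 : #|J0| = i by move: cJ; rewrite -eJ cardsU1 uJ0 => -[].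
have dis0 : disj U J0.
  by rewrite disjoint_sym; apply: disjointWl (finset.subD1set _ _) _; rewrite disjoint_sym.
rewrite -eJ; apply: Ex_join => //; first exact: IHi.
apply: IH => //; rewrite ?cardsU1 ?uU ?add1n //.
- by rewrite subnS ej.
- exact: disjoint_setU1.
Qed.
End Exactness.

(** * Weighted chains *)

Section Translation.
Variables (R : realType) (n : nat) (m : 'I_n -> 'I_n -> nat) (q : 'I_n -> R).
Hypothesis hm : coxeter_matrix m.
Hypothesis hq : multiparameter m q.
Implicit Types (g : chain n R) (U V : {set 'I_n}) (x y : word n) (s : 'I_n).
Local Notation qe := (qe m q).
Local Notation cs V x := ((coset m x V, V) : cell n).
Notation "u ~ v" := (cox_eq m u v) (at level 70).

Lemma coset_refl V x : coset m x V x.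
Proof. by rewrite coset_same //; apply: same_refl. Qed.

Lemma mu_coset V x : exists2 w, same m V x w & mu q (cs V x) = qe w.
Proof.
have [w [Cw sw e]] := wtE q (coset_refl V x); rewrite coset_same // in Cw.
exists w => //; rewrite /mu /= e (qe_reduced hm hq) // /reduced eqn_leq len_le_size /=.
have [[v wv <-] _] := lenP m w; rewrite sw; apply: (minlenP (coset_refl V x)).2.
by rewrite coset_same //; apply: (same_trans hm Cw); apply: same_eq.
Qed.

Lemma mu_gt0 V x : 0 < mu q (cs V x).
Proof. by have [w _ ->] := mu_coset V x; apply: qe_gt0. Qed.

(** Elements of one coset of a finite [W_V] differ by words of bounded length, so their weights are
    comparable with that of the shortest one. *)
Lemma mu_qe V : spherical m V -> exists2 K : R, 0 < K &
  forall x, mu q (cs V x) <= K * qe x /\ qe x <= K * mu q (cs V x).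
Proof.
move=> /spherical_bound [L hL]; have K1 := qK_ge1 hq.
exists (qK q ^+ L); first by apply: exprn_gt0; apply: lt_le_trans K1.
have b x y : same m V x y -> qe y <= qK q ^+ L * qe x.
  move=> sm; have e : y ~ x ++ nf m (rev x ++ y).
    apply: cox_sym; apply: (cox_trans (cox_catl x (cox_nfl m _))); exact: cox_ple_mul.
  rewrite (qe_eq q e); apply: (le_trans (qe_bound hm hq _ _)).
  apply: ler_wpM2r; first by apply: ltW; apply: qe_gt0.
  by apply: ler_weXn2l => //; rewrite size_nf; apply: hL.
by move=> x; have [w sw ->] := mu_coset V x; split; apply: b => //; apply: same_sym.
Qed.

(* In these coordinates the weighted boundary becomes the unweighted operator [ddJ], and the
   norm becomes [sum_x b(x)^2 / q_x] up to constants. *)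
Definition cochain g : {set 'I_n} -> word n -> R :=
  fun V x => (-1) ^+ minlen (coset m x V) * (mu q (cs V x) * g (cs V x)).

Lemma icell_cs i V x : spherical m V -> #|V| = i -> icell m i (cs V x).
Proof. by move=> sV cV; split=> //; split=> //; exists x. Qed.

(** The sign in [cochain] absorbs the shortest-element lengths of the incidence numbers and the
    factor mu absorbs the weights of the adjoint; only (-1)^pos is left. *)
Lemma bdry_cochain i g U x : (forall c, ~ icell m i.+1 c -> g c = 0) -> spherical m U -> #|U| = i ->
  ddJ [set: 'I_n]%SET (cochain g) U x =
  (-1) ^+ minlen (coset m x U) * (mu q (cs U x) * bdry m q i g (cs U x)).
Proof.
move=> g0 sU cU; have ic : icell m i (cs U x) by apply: icell_cs.
rewrite /bdry asboolT // mulVKf ?gt_eqF ?mu_gt0 //.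
pose F (t : cell n) := @inc R _ t (cs U x) * mu q t * g t.
(* The cofaces of the cell: one for each letter s outside U with s + U spherical. *)
pose l : seq (cell n) := [seq cs (s |: U)%SET x | s <- enum (~: U)%SET & `[< spherical m (s |: U)%SET >]].
have incE s : s \notin U -> inc R (cs (s |: U)%SET x) (cs U x) =
    (-1) ^+ (pos s (s |: U)%SET + minlen (coset m x U) + minlen (coset m x (s |: U)%SET)).
  move=> sU'; rewrite /inc (bigD1 s) /=; last by rewrite setU11.
  rewrite finset.setU1K // eqxx asboolT /=; last first.
    rewrite !coset_same // => y /=; apply: same_sub; exact: finset.subsetUr.
  rewrite big1 ?addr0 // => t /andP[tU ts].
  case: eqP => // e; case/negP: sU'; by rewrite e !inE eq_sym ts eqxx.
have -> : \sum_(t \in [set t | icell m i.+1 t /\ (cs U x).1 `<=` t.1]) F t = \sum_(t <- l) F t.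
  rewrite [RHS]fsbig_seq; last first.
    rewrite /l map_inj_in_uniq; first by apply: filter_uniq; apply: enum_uniq.
    move=> s t; rewrite (mem_filter _ s) (mem_filter _ t) !mem_enum !inE.
    move=> /andP[_ sU'] /andP[_ tU'] [_ e].
    by have : s \in (t |: U)%SET; [rewrite -e setU11|rewrite !inE (negbTE sU') orbF => /eqP].
  symmetry; apply: fsbig_widen.
    move=> t /mapP [s]; rewrite mem_filter mem_enum inE => /andP[/asboolP sp sU'] ->; split.
      by apply: icell_cs => //; rewrite cardsU1 sU' cU.
    rewrite !coset_same // => y /=; apply: same_sub; exact: finset.subsetUr.
  move=> [C T] [[[[sT /= [y eC]] /= cT] /= sub] nl]; rewrite /F /=.
  suff -> : inc R (C, T) (cs U x) = 0 by rewrite !mul0r.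
  rewrite /inc /= big1 // => s sT'; case: andP => // -[/eqP eU _]; case: nl.
  have sU' : s \notin U by rewrite eU !inE eqxx.
  have eT : T = (s |: U)%SET by rewrite eU finset.setD1K.
  apply/mapP; exists s.
    by rewrite mem_filter mem_enum inE sU' andbT; apply/asboolP; rewrite -eT.
  rewrite -eT eC; congr (_, _); apply/(coset_eqP hm).
  by have := sub _ (coset_refl U x); rewrite eC coset_same.
rewrite /l big_map big_filter big_enum_cond /= mulr_sumr /ddJ.
rewrite [LHS]big_mkcond [RHS]big_mkcond; apply: eq_bigr => s _; rewrite !inE /=.
case: (boolP (s \in U)) => sU' //=; case: asboolP => sp.
  rewrite /F incE // /cochain !exprD; set a := (-1) ^+ minlen (coset m x U).
  have aa : a * a = 1 by rewrite -exprD addnn -signr_odd odd_double expr0.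
  by rewrite -[LHS]mul1r -aa; ring.
by rewrite /cochain g0 ?mulr0 // => -[[]].
Qed.

Lemma Adm_cochain i g : L2chain m q i g -> Adm m q (cochain g).
Proof.
move=> [g0 fin]; split.
- by move=> V x y /(coset_eqP hm) e; rewrite /cochain e.
- move=> V x nz; apply: contrapT => nV; move/eqP: nz; apply; rewrite /cochain g0 ?mulr0 // => -[[]].
  by [].
- move=> V; have [sV|nV] := pselect (spherical m V); last first.
    rewrite /l2 esum1 // => x _; rewrite /cochain g0 ?mulr0 ?expr0n ?mul0r // => -[[sp _] _]; exact: nV.
  have [cV|cV] := eqVneq #|V| i; last first.
    rewrite /l2 esum1 // => x _; rewrite /cochain g0 ?mulr0 ?expr0n ?mul0r // => -[_ /= e].
    by rewrite e eqxx in cV.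
  have [K K0 hK] := mu_qe sV; have [l hl] := spherical_reps sV.
  pose G (c : cell n) := g c ^+ 2 * mu q c.
  have G0 x : 0 <= G (cs V x) by rewrite mulr_ge0 ?sqr_ge0 // ltW // mu_gt0.
  have le x : cochain g V x ^+ 2 / qe x <= K * G (cs V x).
    rewrite ler_pdivrMr ?qe_gt0 // /cochain exprMn sqrr_sign mul1r exprMn /G.
    have [h _] := hK x; set M := mu q (cs V x) in h *; set z := g (cs V x).
    have M0 : 0 < M by apply: mu_gt0.
    have -> : K * (z ^+ 2 * M) * qe x = (z ^+ 2 * M) * (K * qe x) by ring.
    have -> : M ^+ 2 * z ^+ 2 = (z ^+ 2 * M) * M by ring.
    by apply: ler_wpM2l => //; rewrite mulr_ge0 ?sqr_ge0 // ltW.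
  (* W is covered by finitely many sets, each meeting a coset of [W_V] at most once: u is the
     position of x relative to the chosen representative. *)
  pose X (u : word n) : set (word n) := [set x | Wset m x /\ x ~ xget [::] (coset m x V) ++ u].
  have rep x : same m V x (xget [::] (coset m x V)).
    have : exists y, coset m x V y by exists x; apply: coset_refl.
    by move=> /(@xgetPex _ [::]); rewrite {1}coset_same.
  apply: (@le_lt_trans _ _ (\sum_(u <- l) \esum_(x in X u) (K * G (cs V x))%:E)%E).
    apply: (@le_trans _ _ (\esum_(x in Wset m) (K * G (cs V x))%:E)%E).
      by apply: le_esum => x _; rewrite lee_fin.
    apply: esum_cover => [x Wx|x]; last by rewrite lee_fin mulr_ge0 // ltW.
    have [u ul e] := hl _ (same_sym hm (rep x)); exists u => //; split=> //.
    apply: cox_sym; apply: (cox_trans (cox_catl _ (cox_sym e))); exact: cox_ple_mul.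
  apply: (@big_ind _ (fun z => z < +oo)%E) => [|a b|u _]; [by rewrite ltry|exact: lte_add_pinfty|].
  have fin' : (\esum_(c in icell m i) (K * G c)%:E < +oo)%E.
    apply: (@le_lt_trans _ _ (K%:E * \esum_(c in icell m i) (G c)%:E)%E).
      apply: esumZ_le; first exact: ltW.
      by move=> [C T] [[_ [y /= ->]] _]; rewrite mulr_ge0 ?sqr_ge0 // ltW // mu_gt0.
    rewrite esum_fin // -?EFinM ?ltry //.
    by move=> [C T] [[_ [y /= ->]] _]; rewrite mulr_ge0 ?sqr_ge0 // ltW // mu_gt0.
  apply: le_lt_trans fin'; apply: (@esum_le_inj _ _ _ _ _ (fun x => cs V x)).
  + move=> x y /set_mem [Wx ex] /set_mem [Wy ey] [e]; apply: (Wset_inj Wx Wy).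
    by apply: (cox_trans ex); rewrite e; apply: cox_sym.
  + by move=> x _; apply: icell_cs.
  + by move=> [C T] [[_ [y /= ->]] _]; rewrite lee_fin mulr_ge0 ?(ltW K0) // mulr_ge0 ?sqr_ge0 // ltW // mu_gt0.
  + by move=> x _.
Qed.

(** The inverse of [cochain]; right invariance makes the choice of representative immaterial. *)
Definition of_cochain i (c : {set 'I_n} -> word n -> R) : chain n R := fun t =>
  if `[< icell m i t >] then (-1) ^+ minlen t.1 * ((mu q t)^-1 * c t.2 (xget [::] t.1)) else 0.

Lemma xget_coset V x : same m V x (xget [::] (coset m x V)).
Proof.
have : exists y, coset m x V y by exists x; apply: coset_refl.
by move=> /(@xgetPex _ [::]); rewrite {1}coset_same.
Qed.

Lemma of_cochainK i c V x : Adm m q c -> (forall V x, c V x != 0 -> #|V| = i) ->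
  cochain (of_cochain i c) V x = c V x.
Proof.
move=> Ac sc; rewrite /cochain /of_cochain.
have e : c V (xget [::] (coset m x V)) = c V x.
  by symmetry; apply: (adm_inv Ac); apply: xget_coset.
case: asboolP => [_|nic]; last first.
  rewrite !mulr0; symmetry; apply/eqP/negPn/negP => nz; apply: nic.
  by apply: icell_cs; [exact: (adm_sph Ac nz)|exact: (sc V x nz)].
rewrite /= e [mu _ _ * _]mulrCA mulVKf ?gt_eqF ?mu_gt0 // mulrA -exprD addnn.
by rewrite -signr_odd odd_double mul1r.
Qed.

Lemma of_cochain_L2 i c : Adm m q c -> L2chain m q i (of_cochain i c).
Proof.
move=> Ac; split=> [t nt|]; first by rewrite /of_cochain asboolF.
pose X V : set (cell n) := [set t | icell m i t /\ t.2 = V].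
have G0 t : is_cell m t -> 0 <= of_cochain i c t ^+ 2 * mu q t.
  by case: t => C T [_ [y /= ->]]; rewrite mulr_ge0 ?sqr_ge0 // ltW // mu_gt0.
(* Absolute values make the summand nonnegative on all pairs, cells or not, as [esum_cover]
   requires. *)
apply: (@le_lt_trans _ _ (\sum_(V <- enum {: {set 'I_n}}) \esum_(t in X V) `|of_cochain i c t ^+ 2 * mu q t|%:E)%E).
  apply: (@le_trans _ _ (\esum_(t in icell m i) `|of_cochain i c t ^+ 2 * mu q t|%:E)%E).
    by apply: le_esum => t _; rewrite lee_fin ler_norm.
  apply: esum_cover => // t it; exists t.2; [by rewrite mem_enum|by split].
apply: (@big_ind _ (fun z => z < +oo)%E) => [|a b|V _]; [by rewrite ltry|exact: lte_add_pinfty|].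
have [sV|nV] := pselect (spherical m V); last first.
  by rewrite (_ : X V = set0) ?esum_set0 ?ltry // -subset0 => t [[[sp _] _] e]; apply: nV; rewrite -e.
have [K K0 hK] := mu_qe sV.
have l2c : (\esum_(x in Wset m) (K * (c V x ^+ 2 / qe x))%:E < +oo)%E.
  apply: (@le_lt_trans _ _ (K%:E * \esum_(x in Wset m) (c V x ^+ 2 / qe x)%:E)%E).
    apply: esumZ_le; first exact: ltW.
    by move=> x _; rewrite divr_ge0 ?sqr_ge0 // ltW // qe_gt0.
  rewrite esum_fin; [by rewrite -EFinM ltry| |exact: adm_l2 Ac V].
  by move=> x _; rewrite divr_ge0 ?sqr_ge0 // ltW // qe_gt0.
apply: le_lt_trans l2c; apply: (@esum_le_inj _ _ _ _ _ (fun t => nf m (xget [::] t.1))).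
- move=> [C T] [C' T'] /set_mem [[[_ [x /= ->]] _] /= e1] /set_mem [[[_ [y /= ->]] _] /= e2] e.
  move: e1 e2 e => -> -> e; congr (_, _); apply/(coset_eqP hm).
  apply: (same_trans hm (xget_coset V x)); apply: (same_trans hm _ (same_sym hm (xget_coset V y))).
  by apply: same_eq => //; apply: nf_inj.
- by move=> t _; apply: Wset_nf.
- by move=> x _; rewrite lee_fin mulr_ge0 ?(ltW K0) // divr_ge0 ?sqr_ge0 // ltW // qe_gt0.
move=> [C T] [ic /= eT]; move: ic; rewrite eT => ic; have [[_ [x /= eC]] cV] := ic; rewrite eC in ic *.
rewrite lee_fin ger0_norm; last by apply: G0; case: ic.
set y := xget _ _; have sy : same m V x y by apply: xget_coset.
have -> : c V (nf m y) = c V y by apply: (adm_inv Ac); apply: same_eq => //; apply: cox_nfl.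
have -> : qe (nf m y) = qe y by apply: qe_eq; apply: cox_nfl.
rewrite /of_cochain asboolT //= -/y exprMn sqrr_sign mul1r exprMn.
have [_ h] := hK y; have exy : coset m y V = coset m x V by apply/(coset_eqP hm); apply: same_sym.
rewrite exy in h; set M := mu q (cs V x) in h *.
have M0 : 0 < M by apply: mu_gt0.
have -> : M^-1 ^+ 2 * c V y ^+ 2 * M = c V y ^+ 2 / M by field; rewrite gt_eqF.
rewrite mulrCA; apply: ler_wpM2l; first exact: sqr_ge0.
by rewrite ler_pdivlMr ?qe_gt0 // mulrC ler_pdivrMr.
Qed.
End Translation.

Lemma sqnorm0 (R : realType) n (m : 'I_n -> 'I_n -> nat) (q : 'I_n -> R) i (f : chain n R) :
  (forall c, f c = 0) -> sqnorm m q i f = 0%E.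
Proof. by move=> h; rewrite /sqnorm esum1 // => c _; rewrite h expr0n mul0r. Qed.

Theorem theorem6p2 (R : realType) (n : nat) (m : 'I_n -> 'I_n -> nat)
  (q : 'I_n -> R) (k : nat) :
  coxeter_matrix m -> (1 <= k)%N -> multiparameter m q ->
  (forall T : {set 'I_n}, spherical m T -> #|T| = k -> in_R m (St m T) q) ->
  forall i : nat, i <> k -> relL2H_vanishes m q k i.
Proof.
move=> hm k1 hq hk i ik z [hz cyc] e e0.
have [ki|ik'] := leqP k i; last first.
  rewrite /relL2chain leqNgt ik' /= in hz; exists (fun=> 0); split.
    rewrite /relL2chain; case: ifP => // _; split=> //.
    by rewrite sqnorm0 ?ltry.
  by rewrite sqnorm0 ?lte_fin // => c; rewrite hz /relbdry leqNgt ik' subr0.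
have {ik}ki' : (k < i)%N by rewrite ltn_neqAle ki andbT eq_sym; apply/eqP.
case: i ki ki' hz cyc => // i ki ki' hz cyc.
rewrite /relL2chain ki in hz; have kii : (k <= i)%N by [].
rewrite /relbdry kii in cyc; have [z0 _] := hz.
have Aa := Adm_cochain hm hq hz.
have nz V x : cochain m q z V x != 0 -> #|V| = i.+1.
  move=> h; apply/eqP; apply: contraNT h => cV; rewrite /cochain z0 ?mulr0 // => -[_ /= cV'].
  by rewrite cV' eqxx in cV.
have cy T x : ddJ [set: 'I_n]%SET (cochain m q z) T x = 0.
  (* The cycle condition speaks of spherical T of size i; for any other T every term of type T + s
     vanishes. *)
  have [cT|cT] := eqVneq #|T| i; last first.
    apply: big1 => s /andP[_ sT]; have [->|/nz] := eqVneq (cochain m q z (s |: T)%SET x) 0; rewrite ?mulr0 //.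
    by rewrite cardsU1 sT add1n => -[e']; rewrite e' eqxx in cT.
  have [sT|nT] := pselect (spherical m T).
    by rewrite (bdry_cochain hm hq x z0 sT cT) cyc !mulr0.
  apply: big1 => s _; have [->|h] := eqVneq (cochain m q z (s |: T)%SET x) 0; rewrite ?mulr0 //.
  by case: nT; apply: sub_spherical (adm_sph Aa h); apply: finset.subsetUr.
have dis : fintype.disjoint (mem (finset.set0 : {set 'I_n})) (mem [set: 'I_n]%SET).
  by rewrite disjoint_subset; apply/fintype.subsetP => s; rewrite inE.
have E : Ex m q finset.set0 [set: 'I_n]%SET i.+1.
  by apply: (Ex_all hm hq hk) => //; rewrite cards0.
have sz : suppz finset.set0 [set: 'I_n]%SET i.+1 (cochain m q z).
  move=> V x; rewrite finset.sub0set finset.set0U finset.subsetT /= => h.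
  by apply/eqP; apply: contraNT h => /nz ->.
have [c [Ac sc dc]] := E _ Aa sz (fun T x _ _ => cy T x).
have nc V x : c V x != 0 -> #|V| = i.+2.
  by move=> h; apply/eqP; apply: contraNT h => cV; rewrite sc // (negbTE cV) !andbF.
pose g := of_cochain m q i.+2 c.
have Lg : L2chain m q i.+2 g by apply: of_cochain_L2.
exists g; split; first by rewrite /relL2chain (leqW ki).
rewrite sqnorm0 ?lte_fin // => -[C V]; rewrite /relbdry ki.
have [ic|nic] := pselect (icell m i.+1 (C, V)); last first.
  by rewrite z0 // /bdry asboolF // subr0.
have [[sV [x /= eC]] cV] := ic; rewrite /= in sV cV; rewrite eC.
have := bdry_cochain hm hq x Lg.1 sV cV.
have -> : ddJ [set: 'I_n]%SET (cochain m q g) V x = cochain m q z V x.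
  rewrite -dc ?finset.sub0set ?finset.set0U ?finset.subsetT //.
  by apply: eq_bigr => s _; rewrite (of_cochainK hm hq _ _ Ac nc).
rewrite /cochain; set sg1 := (-1) ^+ _ => /(mulfI _) h.
have {h} : mu q (coset m x V, V) * z (coset m x V, V) = mu q (coset m x V, V) * bdry m q i.+1 g (coset m x V, V).
  by apply: h; rewrite signr_eq0.
by move=> /(mulfI (lt0r_neq0 (mu_gt0 hm hq V x))) ->; rewrite subrr.
Qed.
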